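(* Let $X$ be a separable noncompact metrizable space, and assume that $Y$ is a connected, complete Riemannian manifold (finite-dimensional, of class $C^\infty$, without boundary) equipped with the geodesic metric. Then $C_B(X,Y)$ is an $\ell^2(2^{\aleph_0})$-manifold.
   Context: The geodesic metric on a connected Riemannian manifold is the Riemannian distance (infimum of lengths of curves joining two points). For a space $X$ and a metric space $(Y,d)$, $C_B(X,Y)$ is the space of bounded continuous maps from $X$ into $Y$ (those whose image is a bounded subset of $Y$) with the uniform topology, i.e. the topology induced by the metric $(f,g)\mapsto \min\{1,\sup_{x\in X} d(f(x),g(x))\}$. For an infinite cardinal $\tau$, $\ell^2(\tau)$ denotes the (real) Hilbert space of weight $\tau$, i.e. with an orthonormal basis of cardinality $\tau$. A metrizable space is an $\ell^2(\tau)$-manifold if every point has an open neighborhood homeomorphic to some open set in $\ell^2(\tau)$.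
   Formalization: The manifold Y is assumed to have positive dimension; for a one-point (0-dimensional) Y, the space C_B(X,Y) is a single point and is not an ℓ²(2^{ℵ₀})-manifold, so the claim fails there. *)

(* Defs.v *)
From HB Require Import structures.
From mathcomp Require Import all_boot all_order all_algebra.
From mathcomp Require Import all_classical all_reals all_analysis.
Set Implicit Arguments.
Unset Strict Implicit.
Unset Printing Implicit Defensive.
Import Order.TTheory GRing.Theory Num.Theory.
Import numFieldNormedType.Exports.
Local Open Scope classical_set_scope.
Local Open Scope ring_scope.

Section Metric.
Context {R : realType}.

Definition is_metric (T : Type) (d : T -> T -> R) : Prop :=
  [/\ forall x y, 0 <= d x y,
      forall x y, d x y = 0 <-> x = y,
      forall x y, d x y = d y x &
      forall x y z, d x z <= d x y + d y z].

Definition dist_open (T : Type) (d : T -> T -> R) (U : set T) : Prop :=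
  forall x, U x -> exists2 e : R, 0 < e & forall y, d x y < e -> U y.

Definition dist_complete (T : Type) (d : T -> T -> R) : Prop :=
  forall u : nat -> T,
    (forall e : R, 0 < e -> exists N, forall m k : nat,
       (N <= m)%N -> (N <= k)%N -> d (u m) (u k) < e) ->
    exists l : T, forall e : R, 0 < e -> exists N, forall m : nat,
       (N <= m)%N -> d (u m) l < e.

Definition dist_bounded (T : Type) (d : T -> T -> R) (A : set T) : Prop :=
  exists M : R, forall x y, A x -> A y -> d x y <= M.

(* [T] with the topology induced by [d]; the family [dist_open d] is a topology
   without any axiom on [d], so this can be used before proving that [d] is a
   metric. *)
Definition dist_space (T : Type) (d : T -> T -> R) : Type := T.

Section DistSpace.
Variables (T : Type) (d : T -> T -> R).

Let dist_openT : dist_open d setT.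
Proof. by move=> x _; exists 1. Qed.

Let dist_openI : setI_closed (dist_open d).
Proof.
move=> A B oA oB x [/oA[a a0 aA] /oB[b b0 bB]].
exists (Num.min a b); first by rewrite lt_min a0.
by move=> y; rewrite lt_min => /andP[/aA ? /bB ?].
Qed.

Let dist_open_bigU (I : Type) (f : I -> set T) :
  (forall i, dist_open d (f i)) -> dist_open d (\bigcup_i f i).
Proof.
move=> of_ x [i _ /of_[e e0 ef]].
by exists e => // y /ef ?; exists i.
Qed.

HB.instance Definition _ := gen_eqMixin (dist_space d).
HB.instance Definition _ := gen_choiceMixin (dist_space d).
HB.instance Definition _ := isOpenTopological.Build (dist_space d)
  dist_openT dist_openI dist_open_bigU.

End DistSpace.
End Metric.

Definition metrizable (R : realType) (T : topologicalType) : Prop :=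
  exists d : T -> T -> R,
    is_metric d /\ forall U : set T, open U <-> dist_open d U.

Definition separable (T : topologicalType) : Prop :=
  exists2 D : set T, countable D & dense D.

Definition homeo_on (S T : topologicalType) (U : set S) (V : set T)
    (f : S -> T) (g : T -> S) : Prop :=
  [/\ set_fun U V f, set_fun V U g,
      forall x, U x -> g (f x) = x & forall y, V y -> f (g y) = y] /\
  {within U, continuous f} /\ {within V, continuous g}.

Section SmoothManifold.
Variables (R : realType) (n : nat).

Fixpoint Ck_on (W : normedModType R) (k : nat) (U : set 'rV[R]_n)
    (f : 'rV[R]_n -> W) : Prop :=
  (forall x, U x -> {for x, continuous f}) /\
  if k is k'.+1 then forall i : 'I_n,
    (forall x, U x -> derivable f x (delta_mx 0 i)) /\
    Ck_on k' U (fun x => 'D_(delta_mx 0 i) f x)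
  else True.

Definition smooth_on (W : normedModType R) (U : set 'rV[R]_n)
    (f : 'rV[R]_n -> W) : Prop :=
  forall k, Ck_on k U f.

(* A smooth atlas modelled on R^n; [chart_at] selects a chart around each
   point, which also says that the charts cover [Y]. *)
Record smooth_manifold (Y : topologicalType) := SmoothManifold {
  chart_idx : Type;
  chart_dom : chart_idx -> set Y;
  chart_cod : chart_idx -> set 'rV[R]_n;
  chart : chart_idx -> Y -> 'rV[R]_n;
  chart_inv : chart_idx -> 'rV[R]_n -> Y;
  chart_at : Y -> chart_idx;
  manifold_hausdorff : hausdorff_space Y;
  manifold_second_countable : @second_countable Y;
  chart_dom_open : forall i, open (chart_dom i);
  chart_cod_open : forall i, open (chart_cod i);
  chart_homeo : forall i,
    homeo_on (chart_dom i) (chart_cod i) (chart i) (chart_inv i);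
  mem_chart_at : forall p, chart_dom (chart_at p) p;
  chart_transition_smooth : forall i j,
    smooth_on (chart i @` (chart_dom i `&` chart_dom j))
      (chart j \o chart_inv i)
}.

Definition qform (G : 'M[R]_n) (u v : 'rV[R]_n) : R := (u *m G *m v^T) 0 0.

(* [gram i x] is the Gram matrix, at the point of coordinates [x] in the chart
   [i], of the coordinate vector fields. *)
Record riemannian_metric (Y : topologicalType) (M : smooth_manifold Y) :=
  RiemannianMetric {
  gram : chart_idx M -> 'rV[R]_n -> 'M[R]_n;
  gram_smooth : forall i (a b : 'I_n),
    smooth_on (chart_cod i) (fun x => gram i x a b : R);
  gram_sym : forall i x, chart_cod i x -> (gram i x)^T = gram i x;
  gram_pos : forall i x (v : 'rV[R]_n), chart_cod i x -> v != 0 ->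
    0 < qform (gram i x) v v;
  gram_transition : forall i j p (u v : 'rV[R]_n),
    chart_dom i p -> chart_dom j p ->
    qform (gram i (chart i p)) u v =
    qform (gram j (chart j p))
      ('D_u (chart j \o chart_inv i) (chart i p))
      ('D_v (chart j \o chart_inv i) (chart i p))
}.

Section Distance.
Variables (Y : topologicalType) (M : smooth_manifold Y).
Variable g : riemannian_metric M.

Definition C1_at (c : R -> Y) (t : R) : Prop :=
  (\forall s \near t, {for s, continuous c}) /\
  forall i, chart_dom (s := M) i (c t) ->
    (\forall s \near t, derivable (chart i \o c) s 1) /\
    {for t, continuous (derive1 (chart i \o c))}.

(* C^1 up to the endpoints: the restriction of a curve that is C^1 on a
   neighbourhood of [a, b]. *)
Definition C1_segment (c : R -> Y) (a b : R) : Prop :=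
  exists2 c' : R -> Y, {in `[a, b], c =1 c'} &
    forall t, t \in `[a, b] -> C1_at c' t.

Definition piecewise_C1 (c : R -> Y) : Prop :=
  {within `[0, 1], continuous c} /\
  exists s : seq R, [/\ path <%R 0 s, last 0 s = 1 &
    forall k, (k < size s)%N -> C1_segment c (nth 0 (0 :: s) k) (nth 0 s k)].

(* At the finitely many break points of a piecewise C^1 curve the value is
   irrelevant. *)
Definition speed (c : R -> Y) (t : R) : R :=
  let i := chart_at M (c t) in
  let v := derive1 (chart i \o c) t in
  Num.sqrt (qform (gram g i (chart i (c t))) v v).

Definition curve_length (c : R -> Y) : R :=
  (\int[lebesgue_measure]_(t in `[0, 1]) speed c t)%R.

Definition geodesic_dist (p q : Y) : R :=
  inf [set curve_length c | c in
        [set c | [/\ piecewise_C1 c, c 0 = p & c 1 = q]]].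

End Distance.
End SmoothManifold.

Section BoundedMaps.
Variables (R : realType) (X Y : topologicalType) (d : Y -> Y -> R).

Record bounded_map := BoundedMap {
  bmap :> X -> Y;
  bmap_continuous : continuous bmap;
  bmap_bounded : dist_bounded d (range bmap)
}.

Definition bmap_dist (f g : bounded_map) : R :=
  Num.min 1 (sup (range (fun x => d (f x) (g x)))).

Definition CB_space : topologicalType := dist_space bmap_dist.

End BoundedMaps.

Section Ell2.
Variables (R : realType) (A : choiceType).

Record ell2_vec := Ell2Vec {
  ell2_coord :> A -> R;
  ell2_summable : (\esum_(a in [set: A]) ((ell2_coord a) ^+ 2)%:E < +oo)%E
}.

Definition ell2_dist (x y : ell2_vec) : R :=
  Num.sqrt (fine (\esum_(a in [set: A]) ((x a - y a) ^+ 2)%:E)).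

(* The Hilbert space with an orthonormal basis indexed by [A]. *)
Definition ell2 : topologicalType := dist_space ell2_dist.

End Ell2.

Definition ell2_manifold (R : realType) (A : choiceType)
    (T : topologicalType) : Prop :=
  metrizable R T /\
  forall x : T, exists (U : set T) (V : set (ell2 R A))
    (f : T -> ell2 R A) (g : ell2 R A -> T),
    [/\ open U, U x, open V & homeo_on U V f g].

(* Main.v *)
Require Import Defs.
From HB Require Import structures.
From mathcomp Require Import all_boot all_order all_algebra finmap.
From mathcomp Require Import ring lra wochoice.
From mathcomp Require Import all_classical all_reals all_analysis measurable_realfun.
Set Implicit Arguments.
Unset Strict Implicit.
Unset Printing Implicit Defensive.
Import Order.TTheory GRing.Theory Num.Theory.
Import numFieldNormedType.Exports.
Local Open Scope classical_set_scope.
Local Open Scope ring_scope.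

(** Let [Y] carry a metric with local bi-Lipschitz charts and finitely coverable
    bounded sets. Around [f0 : X -> Y] finitely many closed cells [C k], each
    mapped by [f0] into one chart, cover [X]. Recording on [C k] the
    chart displacement of [f] minus the Hausdorff extension of what the earlier
    cells already determine is a locally bi-Lipschitz bijection from the maps
    near [f0] onto an open part of a Banach space [E] of bounded functions. As
    [X] is separable, [E] has at most continuum many elements; as [X] is not
    compact it contains an infinite locally finite sequence, and signs along
    it, taken from an independent family of sets, span a copy of l1(2^nat) in
    [E]. A space with these two properties is homeomorphic to l1(2^nat): it is
    a continuous linear image of l1(2^nat) and contains it, and continuous
    (Bartle-Graves) sections of linear surjections split it as l1 x F and
    split l1 as F x K; the shift on a countable l1-sum absorbs [F]. The sections
    come from a partition of unity made of the increments of a transfinite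
    running supremum. Mazur's map carries l1 to l2.

    The geodesic distance is such a metric. Curves enter only through chains of
    C^1 segments carrying a primitive of their speed. In a chart the metric is
    pinched between multiples of the Euclidean one; straight segments give upper
    bounds, and a cut-off of the coordinate distance, which is Lipschitz along
    every curve, gives lower bounds. Cutting a curve at a given length provides
    intermediate points, and with completeness the set of radii whose balls are
    finitely coverable is all of R, as in the Hopf-Rinow theorem. *)

(** * Unordered sums in Banach spaces *)

Section NormedSets.
Context {R : realType}.

(** The domain is not compact, yet one chart radius and one Lipschitz constant must serve all [x].
    Boundedness of [f0] provides this, as a bounded part of [Y] is covered by finitely many small
    chart balls. Data on different cells have to agree on overlaps. Subtracting an extension of what
    is already fixed turns this constraint into the linear condition of vanishing on the overlap.
    The extension operator is not linear, but it is nonexpansive for the sup norm, so a triangular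
    recursion over the cells inverts the construction with Lipschitz bounds. The splitting and the
    shift are Pelczynski's decomposition method made nonlinear: a closed subspace may have no linear
    complement, but it always splits off through a continuous section of the quotient map. Quotients
    are never formed; the distance to a subspace serves as a seminorm on the whole space, which is
    why sections are built for seminormed targets. The index set [set nat] plays two roles: it is
    large enough to code all elements of [E], and it indexes an independent family of signs on a
    countable set. *)

Record seminormed (V : lmodType R) (A : set V) (N : V -> R) : Prop := Seminormed {
  sn_mem0 : A 0;
  sn_memD : forall x y, A x -> A y -> A (x + y);
  sn_memZ : forall (a : R) x, A x -> A (a *: x);
  sn_ge0 : forall x, A x -> 0 <= N x;
  sn_leD : forall x y, A x -> A y -> N (x + y) <= N x + N y;
  sn_Z : forall (a : R) x, A x -> N (a *: x) = `|a| * N x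
}.

(** The space is a subset of an ambient module with a norm constrained only there, so l1 and the
    cell functions are plain predicates on function types, and one set can carry both a norm and a
    quotient seminorm. *)
Record banach (V : lmodType R) (A : set V) (N : V -> R) : Prop := Banach {
  banach_sn :> seminormed A N;
  banach_eq0 : forall x, A x -> N x = 0 -> x = 0;
  banach_complete : forall u : nat -> V, (forall n, A (u n)) ->
    (forall e : R, 0 < e -> exists M, forall m k : nat,
       (M <= m)%N -> (M <= k)%N -> N (u m - u k) < e) ->
    exists2 l, A l & forall e : R, 0 < e -> exists M, forall m : nat,
       (M <= m)%N -> N (u m - l) < e
}.

Section SeminormTheory.
Variables (V : lmodType R) (A : set V) (N : V -> R).
Hypothesis sA : seminormed A N.

Lemma sn_memN x : A x -> A (- x).
Proof. by move=> Ax; rewrite -scaleN1r; apply: (sn_memZ sA). Qed.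

Lemma sn_memB x y : A x -> A y -> A (x - y).
Proof. by move=> Ax Ay; apply: (sn_memD sA) => //; apply: sn_memN. Qed.

Lemma sn0 : N 0 = 0.
Proof. by rewrite -(scale0r (0 : V)) (sn_Z sA) ?normr0 ?mul0r//; apply: (sn_mem0 sA). Qed.

Lemma snN x : A x -> N (- x) = N x.
Proof. by move=> Ax; rewrite -scaleN1r (sn_Z sA)// normrN normr1 mul1r. Qed.

Lemma sn_distC x y : A x -> A y -> N (x - y) = N (y - x).
Proof. by move=> Ax Ay; rewrite -opprB snN//; apply: sn_memB. Qed.

Lemma sn_leB x y : A x -> A y -> N (x - y) <= N x + N y.
Proof.
by move=> Ax Ay; rewrite -(snN Ay); apply: (sn_leD sA) => //; apply: sn_memN.
Qed.

Lemma sn_distD z x y : A x -> A y -> A z -> N (x - y) <= N (x - z) + N (z - y).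
Proof.
move=> Ax Ay Az; have -> : x - y = (x - z) + (z - y) by rewrite addrA subrK.
by apply: (sn_leD sA); apply: sn_memB.
Qed.

Lemma sn_suble x y : A x -> A y -> N x - N y <= N (x - y).
Proof.
move=> Ax Ay; rewrite lerBlDr -[X in N X <= _](subrK y).
by apply: (sn_leD sA) => //; apply: sn_memB.
Qed.

Lemma sn_normB x y : A x -> A y -> `|N x - N y| <= N (x - y).
Proof.
move=> Ax Ay; rewrite ler_norml sn_suble// andbT lerNl opprB sn_distC//.
exact: sn_suble.
Qed.

Lemma sn_memsum (I : Type) (r : seq I) (f : I -> V) :
  (forall i, A (f i)) -> A (\sum_(i <- r) f i).
Proof.
move=> Af; elim/big_rec : _ => [|i x _ Ax]; first exact: (sn_mem0 sA).
exact: (sn_memD sA).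
Qed.

Lemma sn_lesum (I : Type) (r : seq I) (f : I -> V) :
  (forall i, A (f i)) -> N (\sum_(i <- r) f i) <= \sum_(i <- r) N (f i).
Proof.
move=> Af; elim: r => [|i r IH]; first by rewrite !big_nil sn0.
rewrite !big_cons; apply: (le_trans (sn_leD sA _ _)) => //.
  exact: sn_memsum.
by rewrite lerD2l.
Qed.

End SeminormTheory.

(* Finite partial sums of a nonnegative family; [tsum f] is a junk value unless
   they are bounded. *)
Section Total.
Variable J : choiceType.
Implicit Types (f g : J -> R) (F G : {fset J}).

Definition fsum f F : R := \sum_(j <- F) f j.

Definition fbounded f := exists M, forall F, fsum f F <= M.

Definition tsum f : R := sup (range (fsum f)).

Lemma fsum_ge0 f F : (forall j, 0 <= f j) -> 0 <= fsum f F.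
Proof. by move=> f0; apply: sumr_ge0. Qed.

Lemma fsum0 f : fsum f fset0 = 0.
Proof. by rewrite /fsum big_seq_fset0. Qed.

Lemma fsumU1 f j F : j \notin F -> fsum f (j |` F)%fset = f j + fsum f F.
Proof. exact: big_fsetU1. Qed.

Lemma le_fsum f g F : (forall j, f j <= g j) -> fsum f F <= fsum g F.
Proof. by move=> fg; apply: ler_sum => j _. Qed.

Lemma le_fsum_in f g F : (forall j, j \in F -> f j <= g j) ->
  fsum f F <= fsum g F.
Proof.
by move=> fg; rewrite /fsum big_seq [leRHS]big_seq; apply: ler_sum => j /fg.
Qed.

Lemma fsum_le_tsum f F : fbounded f -> fsum f F <= tsum f.
Proof.
move=> [M fM]; apply: ub_le_sup; last by exists F.
by exists M => _ [G _ <-]; exact: fM.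
Qed.

Lemma tsum_le f M : (forall F, fsum f F <= M) -> tsum f <= M.
Proof.
move=> fM; apply: ge_sup; first by exists (fsum f fset0), fset0.
by move=> _ [G _ <-]; exact: fM.
Qed.

Lemma fbounded_approx f (e : R) : fbounded f -> 0 < e ->
  exists F, tsum f - e < fsum f F.
Proof.
move=> [M fM] e0.
have hs : has_sup (range (fsum f)).
  split; first by exists (fsum f fset0), fset0.
  by exists M => _ [G _ <-]; exact: fM.
by have [_ [F _ <-] lt] := sup_adherent e0 hs; exists F.
Qed.

Lemma tsum_ge0 f : fbounded f -> 0 <= tsum f.
Proof. by move=> fb; rewrite -(fsum0 f); apply: fsum_le_tsum. Qed.

Lemma le_fbounded f g : (forall j, f j <= g j) -> fbounded g -> fbounded f.
Proof. by move=> fg [M gM]; exists M => F; apply: (le_trans (le_fsum _ fg)). Qed.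

Lemma le_tsum f g : (forall j, f j <= g j) -> fbounded g -> tsum f <= tsum g.
Proof.
move=> fg gb; apply: tsum_le => F.
by apply: (le_trans (le_fsum _ fg)); apply: fsum_le_tsum.
Qed.

Lemma fsumD f g F : fsum (fun j => f j + g j) F = fsum f F + fsum g F.
Proof. exact: big_split. Qed.

Lemma fsumZ a f F : fsum (fun j => a * f j) F = a * fsum f F.
Proof. by rewrite /fsum mulr_sumr. Qed.

Lemma fboundedD f g : fbounded f -> fbounded g -> fbounded (fun j => f j + g j).
Proof. by move=> [M fM] [K gK]; exists (M + K) => F; rewrite fsumD lerD. Qed.

Lemma tsumD_le f g : fbounded f -> fbounded g ->
  tsum (fun j => f j + g j) <= tsum f + tsum g.
Proof.
by move=> fb gb; apply: tsum_le => F; rewrite fsumD lerD// fsum_le_tsum.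
Qed.

Lemma fboundedZ a f : 0 <= a -> fbounded f -> fbounded (fun j => a * f j).
Proof. by move=> a0 [M fM]; exists (a * M) => F; rewrite fsumZ ler_wpM2l. Qed.

Lemma tsumZ a f : 0 <= a -> fbounded f -> tsum (fun j => a * f j) = a * tsum f.
Proof.
move=> a0 fb; have zle b g : 0 <= b -> fbounded g ->
    tsum (fun j => b * g j) <= b * tsum g.
  by move=> b0 gb; apply: tsum_le => F; rewrite fsumZ ler_wpM2l// fsum_le_tsum.
apply/eqP; rewrite eq_le zle//=.
have [->|an0] := eqVneq a 0.
  by rewrite mul0r; apply: tsum_ge0; exact: fboundedZ.
rewrite -ler_pdivlMl ?lt0r ?an0//.
rewrite [X in tsum X <= _](_ : f = (fun j => a^-1 * (a * f j))).
  by apply: zle; [rewrite invr_ge0|exact: fboundedZ].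
by apply/funext => j; rewrite mulKf.
Qed.

Lemma fsumID f F G : (F `<=` G)%fset -> fsum f G = fsum f F + fsum f (G `\` F)%fset.
Proof.
move=> FG; rewrite /fsum (big_fsetID _ (mem F))/=; congr (_ + _).
  by apply: eq_fbigl => j; rewrite !inE /=; have := fsubsetP FG j; case: (j \in F) => [->//|]; rewrite ?andbF.
by apply: eq_fbigl => j; rewrite !inE /= andbC.
Qed.

Lemma fsumU_le f F G : (forall j, 0 <= f j) -> fsum f F <= fsum f (F `|` G)%fset.
Proof.
by move=> f0; rewrite (fsumID f (fsubsetUl F G)) lerDl fsum_ge0.
Qed.

Lemma fsum_tail f F G (e : R) : fbounded f -> tsum f - e < fsum f F ->
  [disjoint F & G]%fset -> fsum f G < e.
Proof.
move=> fb FE FG.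
have := fsum_le_tsum (F `|` G)%fset fb.
rewrite (fsumID f (fsubsetUl F G)).
have -> : ((F `|` G) `\` F)%fset = G.
  rewrite fsetDUl fsetDv fset0U; apply/fsetDidPl.
  by rewrite fdisjoint_sym.
by lra.
Qed.

Lemma tsum1 (j0 : J) (a : R) : 0 <= a ->
  fbounded (fun j => if j == j0 then a else 0) /\
  tsum (fun j => if j == j0 then a else 0) = a.
Proof.
move=> a0; set f := fun j => _.
have f0 j : 0 <= f j by rewrite /f; case: ifP.
have fle F : fsum f F <= a.
  have [jF|jF] := boolP (j0 \in F).
    rewrite /fsum (big_fsetD1 j0)//= big1_fset ?addr0 /f ?eqxx//.
    by move=> j; rewrite !inE => /andP[/negPf->].
  rewrite /fsum big1_fset// => j jF' _; rewrite /f; case: eqP => // jE.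
  by rewrite -jE jF' in jF.
have fb : fbounded f by exists a.
split=> //; apply/eqP; rewrite eq_le tsum_le//=.
by rewrite -{1}(_ : fsum f [fset j0]%fset = a) ?fsum_le_tsum// /fsum big_seq_fset1 /f eqxx.
Qed.

End Total.

Section UnorderedSums.
Variables (J : choiceType) (V : lmodType R) (A : set V) (N : V -> R).
Hypothesis bA : banach A N.
Implicit Types (f g : J -> V).
Let sA := banach_sn bA.

Definition has_usum f l := forall e : R, 0 < e -> exists F : {fset J},
  forall G : {fset J}, (F `<=` G)%fset -> N (\sum_(j <- G) f j - l) < e.

(** The default 0 covers families without a sum; absolute summability, [fbounded (N \o f)], makes
    the value meaningful. *)
Definition usum f : V := xget 0 [set l | A l /\ has_usum f l].

Lemma has_usum_unique f l l' : (forall j, A (f j)) -> A l -> A l' ->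
  has_usum f l -> has_usum f l' -> l = l'.
Proof.
move=> Af Al Al' fl fl'; apply/eqP; rewrite -subr_eq0; apply/eqP.
apply: (banach_eq0 bA); first exact: (sn_memB sA).
apply/eqP; rewrite eq_le (sn_ge0 sA) ?andbT; last exact: (sn_memB sA).
apply/ler_addgt0Pr => e e0; rewrite add0r.
have [F FE] := fl _ (divr_gt0 e0 (@ltr0n R 2)).
have [G GE] := fl' _ (divr_gt0 e0 (@ltr0n R 2)).
have := FE (F `|` G)%fset (fsubsetUl _ _).
have := GE (F `|` G)%fset (fsubsetUr _ _).
set S := \sum_(j <- _) _ => h1 h2.
have AS : A S by apply: (sn_memsum sA).
have := sn_distD sA Al Al' AS; rewrite (sn_distC sA Al AS).
by lra.
Qed.

(** Finite sets [F n] carrying all but 1/(n+1) of the total norm give a Cauchy sequence of partial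
    sums. Every finite superset of [F n] has a sum within 1/(n+1) of [u n], so the limit of the
    sequence is the limit of the whole net. *)
Lemma usum_exists f : (forall j, A (f j)) -> fbounded (N \o f) ->
  A (usum f) /\ has_usum f (usum f).
Proof.
move=> Af fb; rewrite /usum; case: xgetP => [l _ []//|nl]; exfalso.
have /choice[F FE] : forall n : nat, exists F : {fset J},
    tsum (N \o f) - n.+1%:R^-1 < fsum (N \o f) F.
  by move=> n; apply: fbounded_approx => //; rewrite invr_gt0.
pose u n := \sum_(j <- F n) f j.
have Au n : A (u n) by apply: (sn_memsum sA).
have near G n : (F n `<=` G)%fset -> N (\sum_(j <- G) f j - u n) < n.+1%:R^-1.
  move=> FG; rewrite /u.
  have -> : \sum_(j <- G) f j = \sum_(j <- F n) f j + \sum_(j <- (G `\` F n)%fset) f j.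
    rewrite (big_fsetID _ (mem (F n)))/=; congr (_ + _).
      apply: eq_fbigl => j; rewrite !inE /=.
      by have := fsubsetP FG j; case: (j \in F n) => [->//|]; rewrite ?andbF.
    by apply: eq_fbigl => j; rewrite !inE /= andbC.
  rewrite addrC addKr; apply: (le_lt_trans (sn_lesum sA _ _)) => //.
  by apply: (fsum_tail fb (FE n)); apply/fdisjointP => j jF; rewrite inE jF.
have smallN (e : R) : 0 < e -> exists M, forall m, (M <= m)%N -> m.+1%:R^-1 < e.
  move=> e0; exists (Num.truncn e^-1) => m Mm.
  rewrite invf_plt ?posrE//.
  by apply: (lt_le_trans (truncnS_gt _)); rewrite ler_nat.
have [||l Al ul] := banach_complete bA (u := u).
- exact: Au.
- move=> e e0; have [M Me] := smallN _ (divr_gt0 e0 (@ltr0n R 2)).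
  exists M => m k Mm Mk.
  have := lt_trans (near (F m `|` F k)%fset m (fsubsetUl _ _)) (Me _ Mm).
  have := lt_trans (near (F m `|` F k)%fset k (fsubsetUr _ _)) (Me _ Mk).
  set S := \sum_(j <- _) _ => h1 h2.
  have AS : A S by apply: (sn_memsum sA).
  have := sn_distD sA (Au m) (Au k) AS; rewrite (sn_distC sA (Au m) AS).
  by lra.
apply: (nl l); split=> // e e0.
have [M Me] := smallN _ (divr_gt0 e0 (@ltr0n R 2)).
have [M' M'e] := ul _ (divr_gt0 e0 (@ltr0n R 2)).
exists (F (maxn M M')) => G FG.
have AS : A (\sum_(j <- G) f j) by apply: (sn_memsum sA).
have := sn_distD sA AS Al (Au (maxn M M')).
have := M'e _ (leq_maxr M M').
by have := lt_trans (near _ _ FG) (Me _ (leq_maxl M M')); lra.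
Qed.

Section One.
Variable f : J -> V.
Hypotheses (Af : forall j, A (f j)) (fb : fbounded (N \o f)).

Lemma usum_mem : A (usum f). Proof. exact: (usum_exists Af fb).1. Qed.

Lemma usum_has : has_usum f (usum f). Proof. exact: (usum_exists Af fb).2. Qed.

Lemma usum_eq l : A l -> has_usum f l -> usum f = l.
Proof. by move=> Al fl; apply: (has_usum_unique Af usum_mem Al usum_has fl). Qed.

Lemma usum_norm : N (usum f) <= tsum (N \o f).
Proof.
apply/ler_addgt0Pr => e e0; have [F /(_ F (fsubset_refl _))] := usum_has e0.
have AS : A (\sum_(j <- F) f j) by apply: (sn_memsum sA).
have := sn_suble sA usum_mem AS; rewrite (sn_distC sA usum_mem AS).
have := sn_lesum sA F Af.
by have := fsum_le_tsum F fb; rewrite /fsum/=; lra.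
Qed.

End One.

Lemma usumD f g : (forall j, A (f j)) -> (forall j, A (g j)) ->
  fbounded (N \o f) -> fbounded (N \o g) ->
  usum (fun j => f j + g j) = usum f + usum g.
Proof.
move=> Af Ag fb gb.
have Afg j : A (f j + g j) by apply: (sn_memD sA).
apply: usum_eq => //.
- apply: le_fbounded (fboundedD fb gb) => j /=; exact: (sn_leD sA).
- by apply: (sn_memD sA); apply: usum_mem.
move=> e e0.
have [F FE] := usum_has Af fb (divr_gt0 e0 (@ltr0n R 2)).
have [G GE] := usum_has Ag gb (divr_gt0 e0 (@ltr0n R 2)).
exists (F `|` G)%fset => H; rewrite fsubUset => /andP[/FE h1 /GE h2].
rewrite big_split/= opprD addrACA.
apply: (le_lt_trans (sn_leD sA _ _)); [| |by lra].
all: apply: (sn_memB sA); [exact: (sn_memsum sA)|exact: usum_mem].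
Qed.

Lemma usumZ a f : (forall j, A (f j)) -> fbounded (N \o f) ->
  usum (fun j => a *: f j) = a *: usum f.
Proof.
move=> Af fb.
apply: usum_eq.
- by move=> j; apply: (sn_memZ sA).
- apply: (@le_fbounded _ _ (fun j => `|a| * (N \o f) j)); last exact: fboundedZ.
  by move=> j /=; rewrite (sn_Z sA).
- by apply: (sn_memZ sA); apply: usum_mem.
move=> e e0.
have a0 : 0 < `|a| + 1 by have := normr_ge0 a; lra.
have [F FE] := usum_has Af fb (divr_gt0 e0 a0).
exists F => G /FE; rewrite -scaler_sumr -scalerBr (sn_Z sA); last first.
  by apply: (sn_memB sA); [exact: (sn_memsum sA)|exact: usum_mem].
rewrite ltr_pdivlMr// => h; apply: le_lt_trans h; rewrite mulrC ler_wpM2l//.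
  by apply: (sn_ge0 sA); apply: (sn_memB sA); [exact: (sn_memsum sA)|exact: usum_mem].
by rewrite lerDl.
Qed.

Lemma usum_finite (F : {fset J}) f : (forall j, A (f j)) ->
  (forall j, j \notin F -> f j = 0) -> usum f = \sum_(j <- F) f j.
Proof.
move=> Af f0.
have key G : (F `<=` G)%fset -> \sum_(j <- G) f j = \sum_(j <- F) f j.
  by move=> FG; apply/esym/big_fset_incl => // j _; exact: f0.
have key' (G : {fset J}) : \sum_(j <- G) N (f j) <= \sum_(j <- F) N (f j).
  have -> : \sum_(j <- F) N (f j) = \sum_(j <- (F `|` G)%fset) N (f j).
    by apply: big_fset_incl; [exact: fsubsetUl|move=> j _ /f0 ->; rewrite (sn0 sA)].
  rewrite fsetUC; apply: (@fsumU_le _ (N \o f)) => j /=.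
  exact: (sn_ge0 sA).
apply: usum_eq => //.
- by exists (\sum_(j <- F) N (f j)) => G; exact: key'.
- exact: (sn_memsum sA).
by move=> e e0; exists F => G /key ->; rewrite subrr (sn0 sA).
Qed.

End UnorderedSums.

End NormedSets.

Section Scheffe.
Context {R : realType} (J : choiceType).

(** Scheffe's lemma: [F] carries almost all of [c], so if [c'] is close to [c] on [F] and has hardly
    more total mass, little mass of [c'] is left outside [F]. *)
Lemma total_dist_small (c : J -> R) (e : R) : (forall j, 0 <= c j) ->
  fbounded c -> 0 < e -> exists (F : {fset J}) (eta : R), 0 < eta /\
  forall c' : J -> R, (forall j, 0 <= c' j) -> fbounded c' ->
    tsum c' < tsum c + eta -> (forall j, j \in F -> `|c' j - c j| < eta) ->
    tsum (fun j => `|c' j - c j|) < e.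
Proof.
move=> c0 cb e0.
have [F FE] := fbounded_approx cb (divr_gt0 e0 (@ltr0n R 5)).
pose n := (#|` F|)%:R : R.
have n0 : 0 <= n by rewrite ler0n.
exists F, (e / (5 * (n + 1))); set eta := e / _.
have eta0 : 0 < eta by apply: divr_gt0 => //; nra.
have etan : eta * n + eta = e / 5.
  by rewrite /eta; field; rewrite gt_eqF//; lra.
split=> // c' c'0 c'b tc' cF.
(* On [F] the difference is at most [eta * n]. Off [F] it is at most the tail of [c], within e/5,
   plus the tail of [c'], within e/5 + [eta * n + eta]. As [eta * n + eta] is e/5, the sum stays
   within 4e/5. *)
apply: (@le_lt_trans _ _ (4 * (e / 5))); last by lra.
apply: tsum_le => G.
set f := fun j => `|c' j - c j|.
have f0 j : 0 <= f j by rewrite /f.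
apply: (le_trans (fsumU_le G F f0)); rewrite fsetUC (fsumID f (fsubsetUl F G)).
have hF : fsum f F <= eta * n.
  apply: (@le_trans _ _ (fsum (fun=> eta) F)).
    by apply: le_fsum_in => j /cF /ltW.
  by rewrite /fsum big_const_seq count_predT /n iter_addr_0 mulr_natr.
set H := (_ `\` _)%fset.
have hc : fsum c H <= e / 5.
  apply/ltW/(fsum_tail cb FE); apply/fdisjointP => j jF.
  by rewrite inE jF.
have hc' : fsum c F - eta * n <= fsum c' F.
  rewrite lerBlDr; apply: le_trans (lerD (lexx _) hF); rewrite -fsumD.
  by apply: le_fsum => j; rewrite /f; have := ler_norm (c j - c' j); rewrite distrC; lra.
have hH : fsum f H <= fsum c' H + fsum c H.
  rewrite -fsumD; apply: le_fsum => j; rewrite /f.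
  by apply: (le_trans (ler_normB _ _)); rewrite !ger0_norm.
have hT : fsum c' F + fsum c' H <= tsum c'.
  by rewrite -(fsumID c' (fsubsetUl F G)); apply: fsum_le_tsum.
by lra.
Qed.

End Scheffe.

(* For a well-ordered family [g] the successive increments of the running
   supremum add up to the supremum of [g]; they form a partition of unity
   indexed by points without any local finiteness argument. *)
Section RunningSup.
Context {R : realType} (T : choiceType) (r : rel T) (r_wo : well_order r).
Implicit Types (g : T -> R) (a b : T).

Definition wo_lt b a := r b a && (b != a).

(** Adjoining 0 gives the value 0 at the least index and keeps the running supremum nonnegative. *)
Definition running_sup g a : R := sup [set x | x = 0 \/ exists2 b, wo_lt b a & x = g b].

Definition jump g a : R := Num.max 0 (g a - running_sup g a).

Let min_principle (P : T -> Prop) : (exists a, P a) ->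
  exists2 a, P a & forall b, P b -> r a b.
Proof.
move=> [a Pa]; have [|m [[Pm mP] _]] := r_wo (A := [pred x | `[<P x>]]).
  by exists a; apply/asboolP.
exists m; first by move: Pm => /asboolP.
by move=> b Pb; apply: mP; apply/asboolP.
Qed.

Let r_total a b : r a b || r b a.
Proof.
have [c [->|->] cP] := min_principle (P := fun x => x = a \/ x = b) (ex_intro _ a (or_introl erefl)).
  by apply/orP; left; apply: cP; right.
by apply/orP; right; apply: cP; left.
Qed.

Let r_anti a b : r a b -> r b a -> a = b.
Proof.
move=> ab ba; have [|m [_ mU]] := r_wo (A := [pred x | (x == a) || (x == b)]).
  by exists a; rewrite inE /= eqxx.
rewrite -(mU a) ?(mU b)//; split; rewrite ?inE ?eqxx ?orbT// => x; rewrite inE => /orP[]/eqP ->//.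
  by have := r_total b b; rewrite orbb.
by have := r_total a a; rewrite orbb.
Qed.

Let r_trans a b c : r a b -> r b c -> r a c.
Proof.
move=> ab bc.
have [m mI mP] := min_principle (P := fun x => [\/ x = a, x = b | x = c])
  (ex_intro _ a (Or31 _ _ erefl)).
have ma : r m a by apply: mP; constructor 1.
have mb : r m b by apply: mP; constructor 2.
have mc : r m c by apply: mP; constructor 3.
case: mI => mE; rewrite mE in ma mb mc; first by [].
  by rewrite (r_anti ab ma).
by rewrite (r_anti bc mb) in ab *.
Qed.

Let lt_trans' a b c : wo_lt a b -> wo_lt b c -> wo_lt a c.
Proof.
move=> /andP[ab nab] /andP[bc nbc]; rewrite /wo_lt (r_trans ab bc)/=.
by apply: contra_neq nab => ac; apply: r_anti => //; rewrite ac.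
Qed.

Lemma running_sup_le g a (M : R) : 0 <= M -> (forall b, wo_lt b a -> g b <= M) ->
  running_sup g a <= M.
Proof.
move=> M0 gM; apply: ge_sup; first by exists 0; left.
by move=> _ [->//|[b /gM ? ->]].
Qed.

Section Bounded.
Variables (g : T -> R) (M : R).
Hypothesis gM : forall a, 0 <= g a <= M.

Let M0 a : 0 <= M.
Proof. by have /andP[] := gM a; apply: le_trans. Qed.

Let hub a : has_ubound [set x | x = 0 \/ exists2 b, wo_lt b a & x = g b].
Proof. by exists M => _ [->|[b _ ->]]; [exact: M0|have /andP[] := gM b]. Qed.

Lemma running_sup_ge0 a : 0 <= running_sup g a.
Proof. by apply: ub_le_sup => //; left. Qed.

Lemma running_sup_ub a b : wo_lt b a -> g b <= running_sup g a.
Proof. by move=> ba; apply: ub_le_sup => //; right; exists b. Qed.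

Lemma running_sup_mono a b : wo_lt b a -> running_sup g b <= running_sup g a.
Proof.
move=> ba; apply: running_sup_le; first exact: running_sup_ge0.
by move=> c cb; apply: running_sup_ub; exact: lt_trans' ba.
Qed.

Lemma jump_le a : jump g a <= g a.
Proof.
have /andP[g0 _] := gM a; have := running_sup_ge0 a.
by rewrite ge_max g0/=; lra.
Qed.

Lemma jumpD a : running_sup g a + jump g a = Num.max (running_sup g a) (g a).
Proof. by rewrite /jump addr_maxr addr0 addrC subrK. Qed.

Let fset_max (F : {fset T}) : F != fset0 ->
  exists2 m, m \in F & forall b, b \in F -> b != m -> wo_lt b m.
Proof.
elim/fset1U_rect: F => [|a F aF IH]; first by rewrite eqxx.
move=> _; have [->|/IH[m mF mP]] := @eqVneq {fset T} F fset0.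
  exists a; first by rewrite !inE eqxx.
  by move=> b; rewrite !inE orbF => /eqP ->; rewrite eqxx.
have am : a != m by apply: contraNneq aF => ->.
have [ram|rma] := orP (r_total a m).
  exists m; first by rewrite !inE mF orbT.
  move=> b; rewrite !inE => /orP[/eqP -> _|bF bm]; last exact: mP.
  by rewrite /wo_lt ram am.
exists a; first by rewrite !inE eqxx.
move=> b; rewrite !inE => /orP[->//|bF ba].
have ma : wo_lt m a by rewrite /wo_lt rma eq_sym am.
by have [->//|bm] := eqVneq b m; apply: lt_trans' ma; exact: mP.
Qed.

(** Remove the last index [m] of [F]: by induction the other jumps sum to at most [running_sup g m],
    and adding the jump at [m] gives the larger of [running_sup g m] and [g m]. *)
Lemma fsum_jump_le (F : {fset T}) (B : R) : 0 <= B ->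
  (forall b, b \in F -> g b <= B /\ running_sup g b <= B) ->
  fsum (jump g) F <= B.
Proof.
move En : #|` F|%N => n; elim: n F En B => [|n IH] F Fn B B0 FB.
  by move/eqP: Fn; rewrite cardfs_eq0 => /eqP ->; rewrite fsum0.
have F0 : F != fset0 by rewrite -cardfs_eq0 Fn.
have [m mF mP] := fset_max F0.
rewrite /fsum (big_fsetD1 m)//= -/(fsum _ _).
have cF : #|` F `\ m|%fset = n.
  by apply/eqP; rewrite -eqSS -Fn (cardfsD1 m F) mF add1n.
have S0 := running_sup_ge0 m.
have [gB SB] := FB m mF.
apply: (@le_trans _ _ (jump g m + running_sup g m)); last first.
  by rewrite addrC jumpD ge_max SB gB.
rewrite lerD2l; apply: IH => // b; rewrite !inE => /andP[bm bF].
by split; [apply: running_sup_ub|apply: running_sup_mono]; exact: mP.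
Qed.

Lemma fsum_jump_bound (F : {fset T}) : 0 <= M -> fsum (jump g) F <= M.
Proof.
move=> M0'; apply: fsum_jump_le => // b _; split; first by have /andP[] := gM b.
by apply: running_sup_le => // c _; have /andP[] := gM c.
Qed.

(** Transfinite induction through a least counterexample [m] with deficit [d]: either the running
    supremum at [m] is below d/2 and the jump at [m] alone suffices, or it is nearly attained at an
    earlier [b], whose approximation enlarged by [m] beats the deficit. *)
Lemma fsum_jump_approx a (e : R) : 0 < e -> exists F, g a - e < fsum (jump g) F.
Proof.
move=> e0.
suff : exists2 F : {fset T}, (forall b, b \in F -> r b a) & g a - e < fsum (jump g) F.
  by case=> F _; exists F.
pose bad x := exists2 d, 0 < d & forall F : {fset T}, (forall b, b \in F -> r b x) ->
  fsum (jump g) F <= g x - d.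
have [[x badx]|nbad] := pselect (exists x, bad x); last first.
  apply: contrapT => nF; apply: nbad; exists a, e => // F Fa.
  by rewrite leNgt; apply/negP => lt; apply: nF; exists F.
have [m [d d0 mF] mmin] := min_principle (ex_intro _ x badx).
have hs : has_sup [set y | y = 0 \/ exists2 b, wo_lt b m & y = g b].
  by split; [exists 0; left|exact: hub].
have mm : r m m by have := r_total m m; rewrite orbb.
have jm : g m - running_sup g m <= jump g m by rewrite le_max lexx orbT.
have [y [->|[b bm ->]]] := sup_adherent (divr_gt0 d0 (@ltr0n R 2)) hs;
    rewrite -/(running_sup g m) => ly.
  have Fm b : b \in [fset m]%fset -> r b m by rewrite !inE => /eqP ->.
  by have := mF _ Fm; rewrite /fsum big_seq_fset1; lra.
have nb : ~ bad b.
  move=> /mmin mb; move/andP : bm => [bm]; rewrite (r_anti bm mb) eqxx.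
  by [].
have [F FP Fb] : exists2 F : {fset T}, (forall c, c \in F -> r c b) &
    g b - d / 2 < fsum (jump g) F.
  apply: contrapT => nF; apply: nb; exists (d / 2); first by lra.
  by move=> F FP; rewrite leNgt; apply/negP => lt; apply: nF; exists F.
have mNF : m \notin F.
  apply/negP => /FP mb; move/andP : bm => [bm]; rewrite (r_anti bm mb) eqxx.
  by [].
have Fm c : c \in (m |` F)%fset -> r c m.
  rewrite !inE => /orP[/eqP ->//|/FP cb].
  by apply: r_trans cb _; case/andP : bm.
by have := mF _ Fm; rewrite (fsumU1 _ mNF); lra.
Qed.

End Bounded.

(** As [g] is largest at [a], the increments fill exactly the height [g a]; division by [g a] turns
    them into a partition of unity. *)
Lemma tsum_jump g a : (forall b, 0 <= g b <= g a) ->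
  fbounded (jump g) /\ tsum (jump g) = g a.
Proof.
move=> gM; have ga : 0 <= g a by have /andP[] := gM a.
have fb : fbounded (jump g).
  by exists (g a) => F; apply: (fsum_jump_bound gM).
split=> //; apply/eqP; rewrite eq_le tsum_le/=; last first.
  by move=> F; apply: (fsum_jump_bound gM).
apply/ler_addgt0Pr => e e0; have [F] := fsum_jump_approx gM a e0.
by have := fsum_le_tsum F fb; lra.
Qed.

Lemma running_sup_lip g g' (M M' d : R) a : (forall b, 0 <= g b <= M) ->
  (forall b, 0 <= g' b <= M') -> (forall b, `|g b - g' b| <= d) ->
  running_sup g a - running_sup g' a <= d.
Proof.
move=> gM g'M gg'; rewrite lerBlDl.
have d0 : 0 <= d := le_trans (normr_ge0 _) (gg' a).
apply: running_sup_le => [|b ba].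
  by rewrite addr_ge0//; exact: (running_sup_ge0 g'M).
have := gg' b; rewrite ler_norml => /andP[_].
by have := running_sup_ub g'M ba; lra.
Qed.

(** The change of [g a] and the change of the running supremum contribute one [d] each. *)
Lemma jump_lip g g' (M M' d : R) a : (forall b, 0 <= g b <= M) ->
  (forall b, 0 <= g' b <= M') -> (forall b, `|g b - g' b| <= d) ->
  `|jump g a - jump g' a| <= 2 * d.
Proof.
move=> gM g'M gg'.
have g'g b : `|g' b - g b| <= d by rewrite distrC.
have h1 := running_sup_lip a gM g'M gg'.
have h2 := running_sup_lip a g'M gM g'g.
have := gg' a; rewrite !ler_norml /jump => /andP[h3 h4].
by case: (leP 0 (g a - _)) => ?; case: (leP 0 (g' a - _)) => ?; apply/andP; split; lra.
Qed.

End RunningSup.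

(** * Continuous sections of linear surjections *)

Section GeometricFamilies.
Context {R : realType}.

Lemma exp2n_lt (c e : R) : 0 < e -> exists M, forall m, (M <= m)%N -> c / 2 ^+ m < e.
Proof.
move=> e0; exists (Num.truncn (`|c| / e)) => m Mm.
have p0 : (0 : R) < 2 ^+ m by rewrite exprn_gt0.
rewrite ltr_pdivrMr//; apply: (le_lt_trans (ler_norm _)).
rewrite -ltr_pdivrMl// mulrC; apply: (lt_le_trans (truncnS_gt _)).
apply: (@le_trans _ _ (m.+1%:R)); first by rewrite ler_nat.
by rewrite -natrX ler_nat ltn_expl.
Qed.

Lemma geo_sum (c : R) (m k : nat) : 0 <= c -> (m <= k)%N ->
  \sum_(m <= i < k) c / 2 ^+ i <= 2 * c / 2 ^+ m.
Proof.
move=> c0 mk.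
suff -> : \sum_(m <= i < k) c / 2 ^+ i = 2 * c / 2 ^+ m - 2 * c / 2 ^+ k.
  by rewrite gerBl divr_ge0 ?mulr_ge0// exprn_ge0.
elim: k mk => [|k IH]; first by rewrite leqn0 => /eqP ->; rewrite big_geq// subrr.
rewrite leq_eqVlt => /orP[/eqP ->|mk]; first by rewrite big_geq// subrr.
rewrite big_nat_recr//= IH// exprS invfM; lra.
Qed.

Lemma fsum_iota (f : nat -> R) k :
  fsum f [fset n in iota 0 k]%fset = \sum_(0 <= i < k) f i.
Proof.
rewrite /fsum /index_iota subn0; apply: perm_big; apply: uniq_perm.
- exact: fset_uniq.
- exact: iota_uniq.
by move=> i; rewrite !inE.
Qed.

Lemma in_fset_iota (k i : nat) : (i \in [fset n in iota 0 k]%fset) = (i < k)%N.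
Proof. by rewrite !inE mem_iota add0n. Qed.

Lemma fset_iota (F : {fset nat}) : exists k, (F `<=` [fset n in iota 0 k])%fset.
Proof.
exists (\max_(i <- F) i).+1; apply/fsubsetP => i iF; rewrite in_fset_iota ltnS.
exact: (@leq_bigmax_seq _ _ xpredT id).
Qed.

Lemma fsum_head_tail (f : nat -> R) (c : R) m (F : {fset nat}) : 0 <= c ->
  (forall n, 0 <= f n <= c / 2 ^+ n) ->
  fsum f F <= \sum_(0 <= i < m) f i + 2 * c / 2 ^+ m.
Proof.
move=> c0 fc; have f0 n : 0 <= f n by case/andP: (fc n).
have [k Fk] := fset_iota (F `|` [fset n in iota 0 m])%fset.
have /fsubsetP Fk' : (F `<=` [fset n in iota 0 (maxn m k)])%fset.
  apply/fsubsetP => i iF; rewrite in_fset_iota.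
  have /(fsubsetP Fk) : i \in (F `|` [fset n in iota 0 m])%fset by rewrite inE iF.
  by rewrite in_fset_iota leq_max => ->; rewrite orbT.
have := fsumU_le F [fset n in iota 0 (maxn m k)]%fset f0.
move=> /le_trans; apply.
have -> : (F `|` [fset n in iota 0 (maxn m k)])%fset = [fset n in iota 0 (maxn m k)]%fset.
  by apply/fsetUidPr; apply/fsubsetP.
rewrite fsum_iota (big_cat_nat _ (n := m)) ?leq_maxl//= lerD2l.
apply: le_trans (geo_sum c0 (leq_maxl m k)).
by apply: ler_sum => i _; case/andP: (fc i).
Qed.

Lemma fbounded_geo (f : nat -> R) (c : R) : 0 <= c ->
  (forall n, 0 <= f n <= c / 2 ^+ n) -> fbounded f /\ tsum f <= 2 * c.
Proof.
move=> c0 fc; have H F : fsum f F <= 2 * c.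
  by have := fsum_head_tail 0 F c0 fc; rewrite big_geq// add0r expr0 divr1.
by split; [exists (2 * c)|exact: tsum_le].
Qed.

End GeometricFamilies.

Section BartleGraves.
Context {R : realType} (V W : lmodType R).
Variables (A : set V) (N : V -> R) (B : set W) (p : W -> R).
Hypotheses (bA : banach A N) (sB : seminormed B p).
Variables (T : V -> W) (C K : R).
Hypothesis TB : forall x, A x -> B (T x).
Hypothesis TD : forall x y, A x -> A y -> T (x + y) = T x + T y.
Hypothesis TZ : forall (a : R) x, A x -> T (a *: x) = a *: T x.
Hypothesis TK : forall x, A x -> p (T x) <= K * N x.
Hypotheses (C0 : 0 <= C) (K0 : 0 <= K).
Variable lift : W -> V.
Hypothesis lift_mem : forall y, A (lift y).
Hypothesis lift_eq : forall y, B y -> p (T (lift y) - y) = 0.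
Hypothesis lift_norm : forall y, B y -> N (lift y) <= C * p y.
Variables (r : rel W) (r_wo : well_order r).

Let sA := banach_sn bA.

Let T0 : T 0 = 0.
Proof. by rewrite -(scale0r (0 : V)) TZ ?scale0r//; apply: (sn_mem0 sA). Qed.

Let TBsub x y : A x -> A y -> T (x - y) = T x - T y.
Proof.
by move=> Ax Ay; rewrite (TD Ax (sn_memN sA Ay)) -(scaleN1r y) (TZ _ Ay) scaleN1r.
Qed.

Let Tsum (I : Type) (s : seq I) (f : I -> V) : (forall i, A (f i)) ->
  T (\sum_(i <- s) f i) = \sum_(i <- s) T (f i).
Proof.
move=> Af; elim: s => [|i s IH]; first by rewrite !big_nil T0.
by rewrite !big_cons TD// ?IH//; exact: (sn_memsum sA).
Qed.

(** A tent of height and radius [p y / 2] around [y], as a function of the centre [a]. Letting it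
    shrink with [p y] makes the error of the averaged lifts proportional to [p y]. *)
Let g y a : R := if `[< B a >] then Num.max 0 (p y / 2 - p (y - a)) else 0.

(** The tent peaks at [a = y] with value [p y / 2], so its jumps divided by this value sum to 1. For
    [p y = 0] the division yields 0, whence the total in [c_total]. *)
Let c y a : R := jump r (g y) a / (p y / 2).

Let g_bound y : B y -> forall a, 0 <= g y a <= p y / 2.
Proof.
move=> By a; have py := sn_ge0 sB By; rewrite /g; case: asboolP => Ba.
  have := sn_ge0 sB (sn_memB sB By Ba).
  by rewrite le_max lexx/= ge_max; lra.
by rewrite lexx/=; lra.
Qed.

Let g_self y : B y -> g y y = p y / 2.
Proof.
move=> By; rewrite /g asboolT// subrr (sn0 sB) subr0.
by apply/max_idPr; have := sn_ge0 sB By; lra.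
Qed.

Let c_ge0 y a : B y -> 0 <= c y a.
Proof.
by move=> By; rewrite divr_ge0// ?divr_ge0// ?(sn_ge0 sB)// le_max lexx.
Qed.

Let c_zero y a : p y = 0 -> c y a = 0.
Proof. by move=> py; rewrite /c py mul0r invr0 mulr0. Qed.

Let c_total y : B y -> fbounded (c y) /\ tsum (c y) = (p y != 0)%:R.
Proof.
move=> By; have [py|py] := eqVneq (p y) 0.
  have -> : c y = fun=> 0 by apply/funext => a; exact: c_zero.
  have f0 F : fsum (fun=> 0 : R) F = 0 :> R by rewrite /fsum big1_seq.
  have fb : fbounded (fun=> 0 : R) (J := W) by exists 0 => F; rewrite f0.
  split=> //; apply/eqP; rewrite eq_le tsum_ge0// andbT.
  by apply: tsum_le => F; rewrite f0.
have py0 : 0 < p y by rewrite lt0r py (sn_ge0 sB).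
have [fb tE] : fbounded (jump r (g y)) /\ tsum (jump r (g y)) = g y y.
  by apply: tsum_jump => // b; rewrite g_self// g_bound.
have -> : c y = fun a => (p y / 2)^-1 * jump r (g y) a.
  by apply/funext => a; rewrite /c mulrC.
have i0 : 0 <= (p y / 2)^-1 by rewrite invr_ge0; lra.
split; first exact: fboundedZ.
by rewrite tsumZ// tE g_self// mulVf// gt_eqF//; lra.
Qed.

Let c_le1 y : B y -> tsum (c y) <= 1.
Proof. by move=> /c_total[_ ->]; case: (_ != _); rewrite ?ler01. Qed.

Let c_supp y a : B y -> c y a != 0 -> B a /\ p (y - a) <= p y / 2.
Proof.
move=> By; rewrite mulf_eq0 negb_or => /andP[ja _].
have := jump_le r (g_bound By) a; have : 0 <= jump r (g y) a by rewrite le_max lexx.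
rewrite le_eqVlt eq_sym (negPf ja)/= => j0 jg.
have : 0 < g y a by apply: lt_le_trans jg.
rewrite /g; case: asboolP => [Ba|]; last by rewrite ltxx.
by rewrite lt_max ltxx/= => h; split=> //; lra.
Qed.

Let c_lift y a : B y -> c y a != 0 -> N (lift a) <= C * (3 / 2 * p y).
Proof.
move=> By /(c_supp By)[Ba pa]; apply: (le_trans (lift_norm Ba)).
rewrite ler_wpM2l//; have := sn_suble sB Ba By.
by rewrite (sn_distC sB Ba By); lra.
Qed.

(** A continuous average of lifts that were chosen without any continuity. Only centres within
    [p y / 2] of [y] carry weight, so it solves the equation up to half of [p y]. *)
Let approx y : V := usum A N (fun a => c y a *: lift a).

Let term_mem y a : A (c y a *: lift a).
Proof. exact: (sn_memZ sA). Qed.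

Let term_le y a : B y -> N (c y a *: lift a) <= C * (3 / 2 * p y) * c y a.
Proof.
move=> By; rewrite (sn_Z sA)// ger0_norm ?c_ge0// mulrC.
have [->|ca] := eqVneq (c y a) 0; first by rewrite !mulr0.
by rewrite ler_wpM2r ?c_ge0// c_lift.
Qed.

Let Cp y : B y -> 0 <= C * (3 / 2 * p y).
Proof. by move=> By; have py := sn_ge0 sB By; rewrite mulr_ge0//; lra. Qed.

Let term_bounded y : B y -> fbounded (N \o (fun a => c y a *: lift a)).
Proof.
move=> By; apply: le_fbounded (fboundedZ (Cp By) (c_total By).1) => a /=.
exact: term_le.
Qed.

Let approx_mem y : B y -> A (approx y).
Proof. by move=> By; apply: usum_mem => //; exact: term_bounded. Qed.

Let approx_norm y : B y -> N (approx y) <= C * (3 / 2 * p y).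
Proof.
move=> By; apply: (le_trans (usum_norm bA (term_mem y) (term_bounded By))).
apply: (le_trans (le_tsum (fun a => term_le a By) (fboundedZ (Cp By) (c_total By).1))).
rewrite tsumZ ?Cp//; last exact: (c_total By).1.
by rewrite ler_piMr// ?Cp// c_le1.
Qed.

Let approx_zero y : B y -> p y = 0 -> approx y = 0.
Proof.
move=> By py; apply: (banach_eq0 bA); first exact: approx_mem.
apply/eqP; rewrite eq_le (sn_ge0 sA (approx_mem By)) andbT.
by have := approx_norm By; rewrite py !mulr0.
Qed.

Let approx_close y : B y -> p (T (approx y) - y) <= p y / 2.
Proof.
move=> By; have [py|py] := eqVneq (p y) 0.
  by rewrite approx_zero// T0 sub0r (snN sB By) py mul0r.
have py0 : 0 < p y by rewrite lt0r py (sn_ge0 sB).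
have [cb c1] := c_total By; rewrite py in c1.
apply/ler_addgt0Pr => e e0.
(* Replacing the infinite average by a finite one costs [K * d] after [T], and the missing weight
   costs [d * p y]; with this [d] the two add up to [e]. *)
have d0 : 0 < e / (K + p y) by rewrite divr_gt0// ltr_wpDl.
set d := e / _ in d0.
have dE : d * K + d * p y = e by rewrite -mulrDr /d divfK// gt_eqF// ltr_wpDl.
have [F FE] := usum_has bA (term_mem y) (term_bounded By) d0.
have [G GE] := fbounded_approx cb d0.
have {FE} := FE (F `|` G)%fset (fsubsetUl _ _).
have := lt_le_trans GE (fsumU_le G F (fun a => c_ge0 a By)).
rewrite fsetUC; set H := (F `|` G)%fset => HG HF.
set S := \sum_(j <- H) c y j *: lift j in HF.
have AS : A S by exact: (sn_memsum sA).
have Aa := approx_mem By.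
have BT := TB Aa; have BS := TB AS.
have h1 : p (T (approx y) - T S) <= K * d.
  rewrite -TBsub//; apply: (le_trans (TK (sn_memB sA Aa AS))).
  by rewrite ler_wpM2l// (sn_distC sA Aa AS); apply: ltW.
have h2 : T S - y = \sum_(a <- H) c y a *: (T (lift a) - y) + (fsum (c y) H - 1) *: y.
  rewrite /S Tsum// scalerBl scale1r /fsum scaler_suml addrA; congr (_ - _).
  by rewrite -big_split/=; apply: eq_bigr => a _; rewrite TZ// scalerBr subrK.
have Bd a : B (T (lift a) - y) by apply: (sn_memB sB) => //; apply: TB.
have Bs : B (\sum_(a <- H) c y a *: (T (lift a) - y)).
  by apply: (sn_memsum sB) => a; apply: (sn_memZ sB).
have h3 : p (\sum_(a <- H) c y a *: (T (lift a) - y)) <= p y / 2.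
  have cH : fsum (c y) H <= 1 by rewrite -[1]c1; apply: fsum_le_tsum.
  apply: (@le_trans _ _ (p y / 2 * fsum (c y) H)); last first.
    by rewrite ler_piMr//; lra.
  apply: (le_trans (sn_lesum sB _ _)) => [a|]; first exact: (sn_memZ sB).
  rewrite -fsumZ; apply: ler_sum => a _.
  rewrite (sn_Z sB)// ger0_norm ?c_ge0// mulrC.
  have [->|ca] := eqVneq (c y a) 0; first by rewrite !mulr0.
  rewrite ler_wpM2r ?c_ge0//; have [Ba pa] := c_supp By ca.
  have BTa := TB (lift_mem a).
  apply: (le_trans (sn_distD sB BTa By Ba)).
  by rewrite lift_eq// add0r (sn_distC sB Ba By).
have h4 : p ((fsum (c y) H - 1) *: y) <= d * p y.
  rewrite (sn_Z sB)// ler_wpM2r ?(sn_ge0 sB)// ler_norml.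
  have := fsum_le_tsum H cb; rewrite c1; rewrite c1 in HG.
  by move: HG => /= HG1 HG2; apply/andP; split; lra.
have := sn_distD sB BT By BS; rewrite h2.
have := sn_leD sB Bs (sn_memZ sB (fsum (c y) H - 1) By).
by rewrite -h2; lra.
Qed.

(** Tents move by at most 3/2 [d] and jumps by 3 [d], hence 6 [d] after division by half the
    seminorm; the change of the normaliser adds one more [d]. *)
Let c_lip y y' (d : R) a : B y -> B y' -> 0 < p y -> p (y' - y) <= d ->
  `|c y' a - c y a| * p y <= 7 * d.
Proof.
move=> By By' py pd.
have g_lip b : `|g y' b - g y b| <= 3 / 2 * d.
  have h0 := sn_normB sB By' By.
  rewrite /g; case: asboolP => Bb; last by rewrite subrr normr0; have := normr_ge0 (p y' - p y); lra.
  have h1 := sn_suble sB (sn_memB sB By' Bb) (sn_memB sB By Bb).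
  have h2 := sn_suble sB (sn_memB sB By Bb) (sn_memB sB By' Bb).
  have e1 : y' - b - (y - b) = y' - y by rewrite opprB addrA subrK.
  have e2 : y - b - (y' - b) = y - y' by rewrite opprB addrA subrK.
  rewrite e1 in h1; rewrite e2 (sn_distC sB By By') in h2.
  rewrite ler_norml; move: h0; rewrite ler_norml => /andP[h3 h4].
  by case: (leP 0 (p y' / 2 - _)) => ?; case: (leP 0 (p y / 2 - _)) => ?; apply/andP; split; lra.
have jl := jump_lip r a (g_bound By') (g_bound By) g_lip.
have j0 : 0 <= jump r (g y') a by rewrite le_max lexx.
have j1 : jump r (g y') a <= p y' / 2.
  apply: (le_trans (jump_le r (g_bound By') a)).
  by have /andP[] := g_bound By' a.
have j0' : 0 <= jump r (g y) a by rewrite le_max lexx.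
have := sn_normB sB By' By; rewrite ler_norml => /andP[n1 n2].
move: jl j0 j1 j0'; rewrite /c; set j' := jump r (g y') a; set j := jump r (g y) a.
move=> jl j0 j1 j0'.
have [py'|py'] := eqVneq (p y') 0.
  have -> : j' = 0 by apply/eqP; rewrite eq_le j0 andbT; lra.
  rewrite mul0r sub0r normrN ger0_norm; last by apply: divr_ge0 => //; lra.
  have -> : j / (p y / 2) * p y = 2 * j by field; rewrite gt_eqF.
  have /andP[_ gy] := g_bound By a; have := jump_le r (g_bound By) a.
  by rewrite -/j; lra.
have py'0 : 0 < p y' by rewrite lt0r py' (sn_ge0 sB).
have -> : `|j' / (p y' / 2) - j / (p y / 2)| * p y =
    `|(j' / (p y' / 2)) * (p y - p y') + 2 * (j' - j)|.
  rewrite -[X in _ * X](gtr0_norm py) -normrM; congr (`|_|).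
  by field; rewrite py' gt_eqF.
apply: (le_trans (ler_normD _ _)).
rewrite (normrM _ (p y - p y')) (normrM 2).
have k1 : `|j' / (p y' / 2)| <= 1.
  by rewrite ger0_norm ?divr_ge0//; [rewrite ler_pdivrMr; lra|lra].
have k2 : `|p y - p y'| <= d by rewrite ler_norml; apply/andP; split; lra.
have k3 : `|2 : R| = 2 by rewrite ger0_norm.
rewrite k3; have := ler_wpM2r (normr_ge0 (p y - p y')) k1; rewrite mul1r.
by lra.
Qed.

(** Each weight is continuous and the total weight does not exceed 1, so by Scheffe the weights
    converge in l1; the lifts involved have norm at most [C * (3 * p y)] while [p y'] is below twice
    [p y]. Where [p y = 0] the norm bound alone gives continuity. *)
Let approx_cont y (e : R) : B y -> 0 < e -> exists2 d, 0 < d &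
  forall y', B y' -> p (y' - y) < d -> N (approx y' - approx y) < e.
Proof.
move=> By e0; have [py|py] := eqVneq (p y) 0.
  exists (e / (C * 3 + 1)); first by rewrite divr_gt0// ltr_wpDl ?mulr_ge0.
  move=> y' By'; rewrite ltr_pdivlMr; last by rewrite ltr_wpDl ?mulr_ge0.
  move=> h; rewrite (approx_zero By py) subr0; apply: (le_lt_trans (approx_norm By')).
  have := sn_suble sB By' By; rewrite py subr0.
  have := sn_ge0 sB By'; have := sn_ge0 sB (sn_memB sB By' By).
  set a := p y'; set b := p (y' - y) in h * => b0 a0 ab.
  apply: le_lt_trans h.
  have : C * a <= C * b by apply: ler_wpM2l.
  have : 0 <= C * b by apply: mulr_ge0.
  by rewrite mulrDr mulr1; lra.
have py0 : 0 < p y by rewrite lt0r py (sn_ge0 sB).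
pose M := C * (3 * p y) + 1.
have M0 : 0 < M by rewrite /M ltr_wpDl// mulr_ge0//; lra.
have [cb c1] := c_total By; rewrite py in c1.
have [F [eta [eta0 H]]] := total_dist_small (fun a => c_ge0 a By) cb (divr_gt0 e0 M0).
exists (Num.min (p y) (eta * p y / 8)); first by rewrite lt_min py0/= divr_gt0// mulr_gt0.
move=> y' By'; rewrite lt_min => /andP[d1 d2].
have [cb' c1'] := c_total By'.
have {}H : tsum (fun a => `|c y' a - c y a|) < e / M.
  apply: H => //; first by move=> a; exact: c_ge0.
    by rewrite c1; apply: (le_lt_trans (c_le1 By')); rewrite ltrDl.
  move=> a _; have := c_lip a By By' py0 (ltW d2).
  rewrite -ler_pdivlMr// => h; apply: (le_lt_trans h).
  by rewrite ltr_pdivrMr//; have : 0 < eta * p y by [exact: mulr_gt0]; lra.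
have fb : fbounded (fun a => `|c y' a - c y a|).
  apply: le_fbounded (fboundedD cb' cb) => a /=.
  by apply: (le_trans (ler_normB _ _)); rewrite !ger0_norm// c_ge0.
have tm a : N ((c y' a - c y a) *: lift a) <= M * `|c y' a - c y a|.
  rewrite (sn_Z sA)// mulrC; have [->|ne] := eqVneq (c y' a - c y a) 0.
    by rewrite normr0 !mulr0.
  rewrite ler_wpM2r//.
  have [ca|ca] := eqVneq (c y a) 0.
    have ca' : c y' a != 0 by apply: contraNneq ne => ->; rewrite ca subrr.
    apply: (le_trans (c_lift By' ca')); have := sn_suble sB By' By.
    rewrite /M => h; apply: (@le_trans _ _ (C * (3 * p y))); last by rewrite lerDl.
    by rewrite ler_wpM2l//; lra.
  apply: (le_trans (c_lift By ca)).
  rewrite /M; apply: (@le_trans _ _ (C * (3 * p y))); last by rewrite lerDl.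
  by rewrite ler_wpM2l//; lra.
have fb2 : fbounded (N \o (fun a => (c y' a - c y a) *: lift a)).
  by apply: le_fbounded (fboundedZ (ltW M0) fb) => a /=; exact: tm.
have -> : approx y' - approx y = usum A N (fun a => (c y' a - c y a) *: lift a).
  apply/esym/eqP; rewrite -subr_eq opprK eq_sym; apply/eqP.
  rewrite /approx -(usumD bA)//.
  - by congr usum; apply/funext => a; rewrite -scalerDl subrK.
  - by move=> a; apply: (sn_memZ sA).
  - exact: term_bounded.
apply: (le_lt_trans (usum_norm bA _ fb2)); first by move=> a; apply: (sn_memZ sA).
apply: (le_lt_trans (le_tsum tm (fboundedZ (ltW M0) fb))).
by rewrite tsumZ//; [rewrite -ltr_pdivlMl// mulrC|exact: ltW].
Qed.

(** Feeding the residual back into [approx] halves it each time, so the corrections form a geometric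
    series whose sum is an exact section. *)
Let res y := y - T (approx y).

Let res_mem y : B y -> B (res y).
Proof. by move=> By; apply: (sn_memB sB) => //; apply/TB/approx_mem. Qed.

Let iter_mem n y : B y -> B (iter n res y).
Proof. by move=> By; elim: n => //= n; exact: res_mem. Qed.

Let iter_norm n y : B y -> p (iter n res y) <= p y / 2 ^+ n.
Proof.
move=> By; elim: n => [|n IH]; first by rewrite expr0 divr1.
have Bn := iter_mem n By.
rewrite iterS /res (sn_distC sB Bn (TB (approx_mem Bn))).
apply: (le_trans (approx_close Bn)).
rewrite exprSr invfM mulrA; lra.
Qed.

Let iter_cont n y (e : R) : B y -> 0 < e -> exists2 d, 0 < d &
  forall y', B y' -> p (y' - y) < d -> p (iter n res y' - iter n res y) < e.
Proof.
move=> By; elim: n e => [|n IH] e e0; first by exists e.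
have Bn := iter_mem n By.
have k0 : 0 < e / (2 * (K + 1)) by rewrite divr_gt0// mulr_gt0// ltr_wpDl.
have [d d0 H] := approx_cont Bn k0.
have e20 : 0 < Num.min d (e / 2) by rewrite lt_min d0 divr_gt0.
have [d' d'0 H'] := IH _ e20.
exists d' => // y' By' yd; have Bn' := iter_mem n By'.
have := H' _ By' yd; rewrite lt_min => /andP[h1 h2].
have := H _ Bn' h1; rewrite /= {2 4}/res.
set u := iter n res y' in Bn' h1 h2 *; set v := iter n res y in Bn h1 h2 *.
rewrite ltr_pdivlMr; last by rewrite mulr_gt0// ltr_wpDl.
move=> h; have K0' := K0.
have Au := approx_mem Bn'; have Av := approx_mem Bn.
have -> : u - T (approx u) - (v - T (approx v)) = (u - v) - T (approx u - approx v).
  by rewrite TBsub// !opprB addrACA [RHS]addrACA [- T _ - _]addrC.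
apply: (le_lt_trans (sn_leB sB (sn_memB sB Bn' Bn) (TB (sn_memB sA Au Av)))).
have := TK (sn_memB sA Au Av); have := sn_ge0 sA (sn_memB sA Au Av).
by nra.
Qed.

Let piece y n := approx (iter n res y).
Let D := C * (3 / 2).

Let D0 : 0 <= D. Proof. by rewrite mulr_ge0//; lra. Qed.

Let piece_mem n y : B y -> A (piece y n).
Proof. by move=> By; apply/approx_mem/iter_mem. Qed.

Let piece_norm n y : B y -> 0 <= N (piece y n) <= D * p y / 2 ^+ n.
Proof.
move=> By; rewrite (sn_ge0 sA (piece_mem n By))/=.
apply: (le_trans (approx_norm (iter_mem n By))).
by rewrite mulrA -/D -mulrA ler_wpM2l ?D0// iter_norm.
Qed.

Let Dp y : B y -> 0 <= D * p y.
Proof. by move=> By; rewrite mulr_ge0 ?D0 ?(sn_ge0 sB). Qed.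

Let piece_bounded y : B y -> fbounded (N \o piece y) /\ tsum (N \o piece y) <= 2 * (D * p y).
Proof. by move=> By; apply: fbounded_geo (Dp By) _ => n; exact: piece_norm. Qed.

Let bgs y := usum A N (piece y).

Let bgs_mem y : B y -> A (bgs y).
Proof.
by move=> By; apply: usum_mem => // [n|]; [exact: piece_mem|exact: (piece_bounded By).1].
Qed.

(** The geometric series doubles the factor 3/2 of [approx]. *)
Let bgs_norm y : B y -> N (bgs y) <= 3 * C * p y.
Proof.
move=> By; have [fb tb] := piece_bounded By.
apply: (le_trans (usum_norm bA (fun n => piece_mem n By) fb)).
by apply: (le_trans tb); rewrite /D; lra.
Qed.

Let piece_sum y M : B y -> T (\sum_(0 <= i < M) piece y i) = y - iter M res y.
Proof.
move=> By; elim: M => [|M IH]; first by rewrite big_geq// T0 subrr.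
have AM := piece_mem M By.
rewrite big_nat_recr//= TD//; last by apply: (sn_memsum sA) => i; exact: piece_mem.
by rewrite IH /res opprB addrA addrAC.
Qed.

Let bgs_eq y : B y -> p (T (bgs y) - y) = 0.
Proof.
move=> By; have BT := TB (bgs_mem By).
apply/eqP; rewrite eq_le (sn_ge0 sB (sn_memB sB BT By)) andbT.
apply/ler_addgt0Pr => e e0; rewrite add0r.
have d0 : 0 < e / (2 * (K + 1)) by rewrite divr_gt0// mulr_gt0// ltr_wpDl.
have [F FE] := usum_has bA (fun n => piece_mem n By) (piece_bounded By).1 d0.
have [k Fk] := fset_iota F.
have e20 : 0 < e / 2 by rewrite divr_gt0.
have [M Me] := exp2n_lt (p y) e20.
pose m := maxn k M.
have Fm : (F `<=` [fset n in iota 0 m])%fset.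
  apply: (fsubset_trans Fk); apply/fsubsetP => i.
  by rewrite !in_fset_iota leq_max => ->.
have := FE _ Fm.
have -> : \sum_(j <- [fset n in iota 0 m]%fset) piece y j = \sum_(0 <= i < m) piece y i.
  rewrite /index_iota subn0; apply: perm_big; apply: uniq_perm.
  - exact: fset_uniq.
  - exact: iota_uniq.
  by move=> i; rewrite !inE.
set S := \sum_(0 <= i < m) piece y i => h.
have AS : A S by apply: (sn_memsum sA) => i; exact: piece_mem.
have Ab := bgs_mem By; have Bm := iter_mem m By.
have := sn_distD sB BT By (TB AS); rewrite -(TBsub Ab AS).
have -> : T S - y = - iter m res y by rewrite piece_sum// addrC addrA addNr add0r.
rewrite (snN sB Bm).
have h1 := TK (sn_memB sA Ab AS).
rewrite (sn_distC sA Ab AS) in h1.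
have h2 := le_lt_trans (iter_norm m By) (Me _ (leq_maxr k M)).
have h3 : K * N (S - bgs y) <= e / 2.
  move: h; rewrite ltr_pdivlMr; last by rewrite mulr_gt0// ltr_wpDl.
  have := K0; have := sn_ge0 sA (sn_memB sA AS Ab); nra.
by lra.
Qed.

Let bgs_cont y (e : R) : B y -> 0 < e -> exists2 d, 0 < d &
  forall y', B y' -> p (y' - y) < d -> N (bgs y' - bgs y) < e.
Proof.
(* For [p (y' - y) < 1] the n-th corrections at [y] and [y'] together are at most [c0 / 2 ^+ n]: the
   tails are small uniformly in [y'], and only finitely many continuous corrections remain. *)
move=> By e0; pose c0 := D * (2 * p y + 1).
have py := sn_ge0 sB By.
have c00 : 0 <= c0 by rewrite mulr_ge0 ?D0//; lra.
have e20 : 0 < e / 2 by rewrite divr_gt0.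
have [m /(_ m (leqnn m)) me] := exp2n_lt (2 * c0) e20.
have [d d0 H] : exists2 d, 0 < d & forall y', B y' -> p (y' - y) < d ->
    \sum_(0 <= i < m) N (piece y' i - piece y i) < e / 2.
  elim: m {me} (e / 2) e20 => [|m IH] e2 e20.
    by exists 1 => // y' _ _; rewrite big_geq.
  have e40 : 0 < e2 / 2 by rewrite divr_gt0.
  have [d1 d10 H1] := IH _ e40.
  have [d2 d20 H2] := approx_cont (iter_mem m By) e40.
  have [d3 d30 H3] := iter_cont m By d20.
  exists (Num.min d1 d3); first by rewrite lt_min d10.
  move=> y' By'; rewrite lt_min => /andP[h1 h3].
  rewrite big_nat_recr//=; have := H1 _ By' h1.
  have := H2 _ (iter_mem m By') (H3 _ By' h3); rewrite /piece; lra.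
exists (Num.min d 1); first by rewrite lt_min d0 ltr01.
move=> y' By'; rewrite lt_min => /andP[h1 h2].
have py' : p y' <= p y + 1 by have := sn_suble sB By' By; lra.
have Am n : A (piece y' n - piece y n) by apply: (sn_memB sA); exact: piece_mem.
have f_geo n : 0 <= N (piece y' n - piece y n) <= c0 / 2 ^+ n.
  rewrite (sn_ge0 sA)//=; apply: (le_trans (sn_leB sA (piece_mem n By') (piece_mem n By))).
  have /andP[_ n1] := piece_norm n By; have /andP[_ n2] := piece_norm n By'.
  apply: (le_trans (lerD n2 n1)); rewrite -mulrDl ler_wpM2r ?invr_ge0 ?exprn_ge0//.
  by rewrite -mulrDr ler_wpM2l ?D0//; lra.
have [fb _] := fbounded_geo c00 f_geo.
have -> : bgs y' - bgs y = usum A N (fun n => piece y' n - piece y n).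
  apply/esym/eqP; rewrite -subr_eq opprK eq_sym; apply/eqP.
  rewrite /bgs -(usumD bA)//.
  - by congr usum; apply/funext => n; rewrite subrK.
  - by move=> n; exact: piece_mem.
  - exact: (piece_bounded By).1.
apply: (le_lt_trans (usum_norm bA Am fb)).
have /le_lt_trans -> // : tsum (N \o (fun n => piece y' n - piece y n)) <=
    \sum_(0 <= i < m) N (piece y' i - piece y i) + 2 * c0 / 2 ^+ m.
  by apply: tsum_le => F; exact: fsum_head_tail.
by have := H _ By' h1; lra.
Qed.

Lemma bartle_graves_wo : exists s : W -> V, [/\ forall y, B y -> A (s y),
  forall y, B y -> p (T (s y) - y) = 0,
  forall y, B y -> N (s y) <= 3 * C * p y &
  forall y (e : R), B y -> 0 < e -> exists2 d, 0 < d &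
    forall y', B y' -> p (y' - y) < d -> N (s y' - s y) < e].
Proof.
exists bgs; split; [exact: bgs_mem|exact: bgs_eq|exact: bgs_norm|].
by move=> y e; exact: bgs_cont.
Qed.

End BartleGraves.

(** Choice turns the quantitative surjectivity into a lift, and a well-ordering of [W] provides the
    jumps. *)
Lemma bartle_graves (R : realType) (V W : lmodType R) (A : set V) (N : V -> R)
    (B : set W) (p : W -> R) (T : V -> W) (C K : R) :
  banach A N -> seminormed B p ->
  (forall x, A x -> B (T x)) ->
  (forall x y, A x -> A y -> T (x + y) = T x + T y) ->
  (forall (a : R) x, A x -> T (a *: x) = a *: T x) ->
  (forall x, A x -> p (T x) <= K * N x) -> 0 <= C -> 0 <= K ->
  (forall y, B y -> exists x, [/\ A x, p (T x - y) = 0 & N x <= C * p y]) ->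
  exists s : W -> V, [/\ forall y, B y -> A (s y),
    forall y, B y -> p (T (s y) - y) = 0,
    forall y, B y -> N (s y) <= 3 * C * p y &
    forall y (e : R), B y -> 0 < e -> exists2 d, 0 < d &
      forall y', B y' -> p (y' - y) < d -> N (s y' - s y) < e].
Proof.
move=> bA sB TB TD TZ TK C0 K0 open.
have /choice[lift liftP] : forall y, exists x, A x /\
    (B y -> p (T x - y) = 0 /\ N x <= C * p y).
  move=> y; have [/open[x [Ax h1 h2]]|nBy] := pselect (B y).
    by exists x.
  by exists 0; split => //; exact: (sn_mem0 bA).
have [r r_wo] := well_ordering_principle W.
apply: (@bartle_graves_wo _ _ _ _ _ _ _ bA sB _ _ _ TB TD TZ TK C0 K0 lift _ _ _ _ r_wo).
- by move=> y; have [] := liftP y.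
- by move=> y By; have [_ /(_ By)[]] := liftP y.
- by move=> y By; have [_ /(_ By)[]] := liftP y.
Qed.

(** * Homeomorphisms with l1 *)

Section MetricContinuity.
Context {R : realType}.

(** Continuity for bare distance functions on bare sets: subsets, products and seminorms are handled
    alike, and topologies enter only when the final homeomorphism is translated. *)
Definition mcont (S T : Type) (A : set S) (dS : S -> S -> R) (dT : T -> T -> R)
    (f : S -> T) : Prop :=
  forall x (e : R), A x -> 0 < e -> exists2 d, 0 < d &
    forall y, A y -> dS x y < d -> dT (f x) (f y) < e.

Definition mhomeo (S T : Type) (A : set S) (dS : S -> S -> R) (B : set T)
    (dT : T -> T -> R) (f : S -> T) (g : T -> S) : Prop :=
  [/\ forall x, A x -> B (f x), forall y, B y -> A (g y),
      forall x, A x -> g (f x) = x & forall y, B y -> f (g y) = y] /\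
  mcont A dS dT f /\ mcont B dT dS g.

Lemma mcont_comp (S T U : Type) (A : set S) (B : set T) dS dT dU (f : S -> T) (g : T -> U) :
  (forall x, A x -> B (f x)) -> mcont A dS dT f -> mcont B dT dU g ->
  mcont A dS dU (g \o f).
Proof.
move=> AB cf cg x e Ax e0; have [d d0 H] := cg _ _ (AB _ Ax) e0.
have [d' d'0 H'] := cf _ _ Ax d0.
by exists d' => // y Ay /(H' _ Ay) /(H _ (AB _ Ay)).
Qed.

Lemma mcont_sub (S T : Type) (A B : set S) (dS : S -> S -> R) (dT : T -> T -> R) f :
  (forall x, A x -> B x) -> mcont B dS dT f -> mcont A dS dT f.
Proof.
move=> AB cf x e Ax e0; have [d d0 H] := cf _ _ (AB _ Ax) e0.
by exists d => // y Ay; apply/H/AB.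
Qed.

Lemma mhomeo_sym (S T : Type) (A : set S) (dS : S -> S -> R) (B : set T)
  (dT : T -> T -> R) (f : S -> T) (g : T -> S) :
  mhomeo A dS B dT f g -> mhomeo B dT A dS g f.
Proof. by move=> [[? ? ? ?] [? ?]]; split. Qed.

Lemma mhomeo_trans (S T U : Type) (A : set S) (dS : S -> S -> R) (B : set T)
  (dT : T -> T -> R) (C : set U) (dU : U -> U -> R) f g f' g' :
  mhomeo A dS B dT f g -> mhomeo B dT C dU f' g' ->
  mhomeo A dS C dU (f' \o f) (g \o g').
Proof.
move=> [[fA gB gf fg] [cf cg]] [[f'B g'C g'f' f'g'] [cf' cg']]; split.
  split => x /=; [by move/fA/f'B|by move/g'C/gB| |].
    by move=> Ax; rewrite g'f' ?gf//; exact: fA.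
  by move=> Cx; rewrite fg ?f'g'//; exact: g'C.
by split; [exact: (mcont_comp fA cf cf')|exact: (mcont_comp g'C cg' cg)].
Qed.

Definition pdist (S T : Type) (dS : S -> S -> R) (dT : T -> T -> R) (x y : S * T) : R :=
  dS x.1 y.1 + dT x.2 y.2.

Definition ndist (V : lmodType R) (N : V -> R) (x y : V) : R := N (y - x).

Definition nonneg_on (S : Type) (A : set S) (d : S -> S -> R) :=
  forall x y, A x -> A y -> 0 <= d x y.

Lemma ndist_ge0 (V : lmodType R) (A : set V) (N : V -> R) :
  seminormed A N -> nonneg_on A (ndist N).
Proof. by move=> sA x y Ax Ay; apply: (sn_ge0 sA); apply: (sn_memB sA). Qed.

Lemma mcont_fst (S T : Type) (A : set S) (B : set T) dS dT :
  nonneg_on B dT -> mcont (A `*` B) (pdist dS dT) dS fst.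
Proof.
move=> d0 [x1 x2] e [/= A1 B2] e0; exists e => // -[y1 y2] [/= _ By].
by rewrite /pdist/=; have := d0 _ _ B2 By; lra.
Qed.

Lemma mcont_snd (S T : Type) (A : set S) (B : set T) dS dT :
  nonneg_on A dS -> mcont (A `*` B) (pdist dS dT) dT snd.
Proof.
move=> d0 [x1 x2] e [/= A1 B2] e0; exists e => // -[y1 y2] [/= Ay _].
by rewrite /pdist/=; have := d0 _ _ A1 Ay; lra.
Qed.

Lemma mcont_pair (S T U : Type) (A : set S) dS dT dU (f : S -> T) (g : S -> U) :
  mcont A dS dT f -> mcont A dS dU g ->
  mcont A dS (pdist dT dU) (fun x => (f x, g x)).
Proof.
move=> cf cg x e Ax e0; have e20 : 0 < e / 2 by rewrite divr_gt0.
have [d d0 H] := cf _ _ Ax e20; have [d' d'0 H'] := cg _ _ Ax e20.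
exists (Num.min d d'); first by rewrite lt_min d0.
move=> y Ay; rewrite lt_min => /andP[/(H _ Ay) h /(H' _ Ay) h'].
by rewrite /pdist/=; lra.
Qed.

Lemma mcontD (S : Type) (A : set S) dS (V : lmodType R) (B : set V) (N : V -> R) f g :
  seminormed B N -> (forall x, A x -> B (f x)) -> (forall x, A x -> B (g x)) ->
  mcont A dS (ndist N) f -> mcont A dS (ndist N) g ->
  mcont A dS (ndist N) (fun x => f x + g x).
Proof.
move=> sB fB gB cf cg x e Ax e0; have e20 : 0 < e / 2 by rewrite divr_gt0.
have [d d0 H] := cf _ _ Ax e20; have [d' d'0 H'] := cg _ _ Ax e20.
exists (Num.min d d'); first by rewrite lt_min d0.
move=> y Ay; rewrite lt_min => /andP[/(H _ Ay) + /(H' _ Ay)].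
rewrite /ndist => h h'; rewrite opprD addrACA.
apply: (le_lt_trans (sn_leD sB _ _)); [| |by lra].
all: by apply: (sn_memB sB); auto.
Qed.

Lemma mcontB (S : Type) (A : set S) dS (V : lmodType R) (B : set V) (N : V -> R) f g :
  seminormed B N -> (forall x, A x -> B (f x)) -> (forall x, A x -> B (g x)) ->
  mcont A dS (ndist N) f -> mcont A dS (ndist N) g ->
  mcont A dS (ndist N) (fun x => f x - g x).
Proof.
move=> sB fB gB cf cg; apply: (mcontD sB) => // [x Ax|]; first exact/(sn_memN sB)/gB.
move=> x e Ax e0; have [d d0 H] := cg _ _ Ax e0; exists d => // y Ay /(H _ Ay).
by rewrite /ndist -opprD (snN sB)//; apply: (sn_memB sB); exact: gB.
Qed.

Lemma mcont_lip (S T : Type) (A : set S) dS dT (f : S -> T) (C : R) : 0 <= C ->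
  nonneg_on A dS -> (forall x y, A x -> A y -> dT (f x) (f y) <= C * dS x y) ->
  mcont A dS dT f.
Proof.
move=> C0 d0 H x e Ax e0; exists (e / (C + 1)); first by rewrite divr_gt0// ltr_wpDl.
move=> y Ay; rewrite ltr_pdivlMr ?ltr_wpDl// => h.
apply: (le_lt_trans (H _ _ Ax Ay)); apply: le_lt_trans h.
by rewrite mulrDr mulr1 mulrC lerDl d0.
Qed.

End MetricContinuity.

Section RealComplete.
Context {R : realType}.

Lemma banach_real : @banach R R^o setT (fun x => `|x|).
Proof.
split.
- split => //.
  + by move=> x y _ _; exact: ler_normD.
  + by move=> a x _; exact: normrM.
- by move=> x _ /normr0_eq0.
move=> u _ uC.
(* The supremum of the eventual lower bounds is the limit inferior of [u]. *)
pose L := [set x | exists M, forall m, (M <= m)%N -> x <= u m].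
have key (e : R) M : (forall m k, (M <= m)%N -> (M <= k)%N -> `|u m - u k| < e) ->
    u M - e <= sup L <= u M + e.
  move=> H; have LM : L (u M - e).
    exists M => m Mm; have := H _ _ (leqnn M) Mm.
    by rewrite ltr_norml => /andP[]; lra.
  have ubL : ubound L (u M + e).
    move=> x [K Kx]; have := Kx _ (leq_maxl K M).
    have := H _ _ (leq_maxr K M) (leqnn M).
    by rewrite ltr_norml => /andP[]; lra.
  apply/andP; split; first by apply: ub_le_sup => //; exists (u M + e).
  by apply: ge_sup => //; exists (u M - e).
exists (sup L) => // e e0; have e20 : 0 < e / 2 by rewrite divr_gt0.
have [M ME] := uC _ e20; exists M => m Mm.
have /andP[h1 h2] : u m - e / 2 <= sup L <= u m + e / 2.
  by apply: key => a b ma mb; apply: ME; apply: leq_trans Mm _.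
by rewrite ltr_norml; apply/andP; split; lra.
Qed.

End RealComplete.

Section Ell1.
Context {R : realType}.

Definition l1 (J : choiceType) : set (J -> R^o) := fun a => fbounded (fun j => `|a j|).
Arguments l1 : clear implicits.

Definition n1 (J : choiceType) (a : J -> R^o) : R := tsum (fun j => `|a j|).

Section OneIndex.
Variable J : choiceType.
Implicit Types a b : J -> R^o.

Lemma n1_ge_coord a j : l1 J a -> `|a j| <= n1 a.
Proof.
move=> la; have := fsum_le_tsum [fset j]%fset la.
by rewrite /fsum big_seq_fset1.
Qed.

Lemma seminormed_l1 : seminormed (l1 J) (@n1 J).
Proof.
have leD a b j : `|(a + b) j| <= `|a j| + `|b j| by exact: ler_normD.
split.
- by exists 0 => F; rewrite /fsum big1// => j _; rewrite normr0.
- by move=> a b la lb; apply: le_fbounded (fboundedD la lb).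
- move=> c a la; apply: le_fbounded (fboundedZ (normr_ge0 c) la) => j.
  by rewrite /GRing.scale/= normrM.
- by move=> a la; exact: tsum_ge0.
- move=> a b la lb; apply: le_trans (tsumD_le la lb).
  by apply: le_tsum => //; exact: fboundedD.
- move=> c a la; rewrite /n1 -tsumZ//; congr tsum; apply/funext => j.
  by rewrite /GRing.scale/= normrM.
Qed.

Lemma banach_l1 : banach (l1 J) (@n1 J).
Proof.
split; first exact: seminormed_l1.
  move=> a la a0; apply/funext => j; apply/normr0_eq0/eqP.
  by rewrite eq_le normr_ge0 -a0 n1_ge_coord.
move=> u lu uC.
have lB m k : l1 J (u m - u k) by apply: (sn_memB seminormed_l1).
have /choice[l lP] : forall j, exists x : R, forall e : R, 0 < e ->
    exists M, forall m, (M <= m)%N -> `|u m j - x| < e.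
  move=> j; have [||x _ xP] := banach_complete (@banach_real R) (u := fun n => u n j) => //.
    move=> e /uC[M ME]; exists M => m k Mm Mk.
    by apply: le_lt_trans (ME _ _ Mm Mk); exact: (n1_ge_coord j (lB m k)).
  by exists x.
(* A bound on [n1 (u m - u k)] for all late [k] passes to the coordinatewise limit on each finite
   set, as in Fatou's lemma. *)
have key (e : R) M m : (forall k, (M <= k)%N -> n1 (u m - u k) <= e) ->
    forall F, fsum (fun j => `|u m j - l j|) F <= e.
  move=> H F; apply/ler_addgt0Pr => d d0.
  have : exists K, forall k, (K <= k)%N -> fsum (fun j => `|u k j - l j|) F <= d.
    elim/fset1U_rect : F d d0 => [|j F jF IH] d d0.
      by exists 0%N => k _; rewrite fsum0 ltW.
    have d20 : 0 < d / 2 by rewrite divr_gt0.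
    have [K1 H1] := IH _ d20; have [K2 H2] := lP j _ d20.
    exists (maxn K1 K2) => k; rewrite geq_max => /andP[/H1 h1 /H2 /ltW h2].
    by rewrite fsumU1//; lra.
  move=> [K KP]; have h1 := KP _ (leq_maxl K M); have h2 := H _ (leq_maxr K M).
  set k := maxn K M in h1 h2.
  have : fsum (fun j => `|u m j - l j|) F <=
      fsum (fun j => `|(u m - u k) j|) F + fsum (fun j => `|u k j - l j|) F.
    by rewrite -fsumD; apply: le_fsum => j; exact: ler_distD.
  by have := fsum_le_tsum F (lB m k); rewrite /n1 in h2; lra.
have ll : l1 J l.
  have [M ME] := uC 1 ltr01.
  have H F : fsum (fun j => `|u M j - l j|) F <= 1.
    by apply: (key _ M) => k Mk; apply/ltW/ME.
  have l1B : l1 J (u M - l) by exists 1.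
  have -> : l = u M - (u M - l) by rewrite opprB addrC subrK.
  exact: (sn_memB seminormed_l1).
exists l => // e e0; have e20 : 0 < e / 2 by rewrite divr_gt0.
have [M ME] := uC _ e20; exists M => m Mm.
apply: (@le_lt_trans _ _ (e / 2)); last by lra.
by apply: tsum_le => F; apply: (key _ M) => k Mk; apply/ltW/ME.
Qed.

Definition delta (j0 : J) (c : R) : J -> R^o := fun j => if j == j0 then c else 0.

Lemma delta_l1 j0 c : l1 J (delta j0 c) /\ n1 (delta j0 c) = `|c|.
Proof.
have -> : n1 (delta j0 c) = tsum (fun j => if j == j0 then `|c| else 0).
  by congr tsum; apply/funext => j; rewrite /delta; case: ifP => //; rewrite normr0.
rewrite /l1 (_ : (fun j => `|delta j0 c j|) = fun j => if j == j0 then `|c| else 0).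
  exact: tsum1.
by apply/funext => j; rewrite /delta; case: ifP => //; rewrite normr0.
Qed.

End OneIndex.

Section Synthesis.
Variables (J : choiceType) (V : lmodType R) (E : set V) (N : V -> R).
Hypothesis bE : banach E N.
Variable b : J -> V.
Hypotheses (Eb : forall j, E (b j)) (Nb : forall j, N (b j) <= 1).
Let sE := banach_sn bE.

(** The operator on l1 sending the basis vector at [j] to [b j]; it yields both the map of l1 onto
    [E] and the embedding of l1 into [E]. *)
Definition synth (a : J -> R^o) : V := usum E N (fun j => a j *: b j).

Let term_mem (a : J -> R^o) j : E (a j *: b j).
Proof. exact: (sn_memZ sE). Qed.

Let term_le (a : J -> R^o) j : N (a j *: b j) <= `|a j|.
Proof. by rewrite (sn_Z sE)// ler_piMr. Qed.

Let term_bounded (a : J -> R^o) : l1 J a -> fbounded (N \o (fun j => a j *: b j)).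
Proof. by apply: le_fbounded => j; exact: term_le. Qed.

Lemma synth_mem a : l1 J a -> E (synth a).
Proof. by move=> la; apply: (usum_mem bE) => //; exact: term_bounded. Qed.

Lemma synth_has a : l1 J a -> has_usum N (fun j => a j *: b j) (synth a).
Proof. by move=> la; apply: (usum_has bE) => //; exact: term_bounded. Qed.

Lemma synth_norm a : l1 J a -> N (synth a) <= n1 a.
Proof.
move=> la; apply: (le_trans (usum_norm bE (term_mem a) (term_bounded la))).
by apply: le_tsum => // j; exact: term_le.
Qed.

Lemma synthD a a' : l1 J a -> l1 J a' -> synth (a + a') = synth a + synth a'.
Proof.
move=> la la'; rewrite /synth -(usumD bE)//; try exact: term_bounded.
by congr usum; apply/funext => j; rewrite -scalerDl.
Qed.

Lemma synthZ c a : l1 J a -> synth (c *: a) = c *: synth a.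
Proof.
move=> la; rewrite /synth -(usumZ bE)//; last exact: term_bounded.
by congr usum; apply/funext => j; rewrite scalerA.
Qed.

Lemma synthB a a' : l1 J a -> l1 J a' -> synth (a - a') = synth a - synth a'.
Proof.
move=> la la'; rewrite synthD//; last exact: (sn_memN (seminormed_l1 J)).
by rewrite -(scaleN1r a') synthZ// scaleN1r.
Qed.

Lemma synth_delta j c : synth (delta j c) = c *: b j.
Proof.
rewrite /synth (usum_finite bE (F := [fset j]%fset))//.
  by rewrite big_seq_fset1 /delta eqxx.
by move=> i; rewrite inE /delta => /negPf ->; rewrite scale0r.
Qed.

(** The infinite sum is approximated by sums over finite sets containing [F], so the lower bound on
    finite combinations passes to it. *)
Lemma synth_isometry a : l1 J a ->
  (forall F, fsum (fun j => `|a j|) F <= N (\sum_(j <- F) a j *: b j)) ->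
  N (synth a) = n1 a.
Proof.
move=> la H; apply/eqP; rewrite eq_le synth_norm//=; apply: tsum_le => F.
apply/ler_addgt0Pr => e e0; have [G GE] := synth_has la e0.
have := GE (F `|` G)%fset (fsubsetUr _ _).
have := H (F `|` G)%fset; have := fsumU_le F G (fun j => normr_ge0 (a j)).
set S := \sum_(j <- _) _.
have ES : E S by apply: (sn_memsum sE).
by have := sn_suble sE ES (synth_mem la); lra.
Qed.

End Synthesis.

End Ell1.
Arguments l1 {R J}.
Arguments n1 {R J}.

Section IteratedSums.
Context {R : realType} (I J : choiceType).
Implicit Type f : I * J -> R.

Lemma fsum_product f (A : {fset I}) (B : {fset J}) :
  fsum f (A `*` B)%fset = \sum_(i <- A) fsum (fun j => f (i, j)) B.
Proof.
rewrite /fsum -big_allpairs; apply: perm_big; apply: uniq_perm.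
- exact: fset_uniq.
- by apply: allpairs_uniq; [exact: fset_uniq|exact: fset_uniq|move=> [? ?] [? ?]].
move=> [i j]; rewrite in_fsetM/=; apply/andP/allpairsP => [[iA jB]|].
  by exists (i, j).
by move=> [[i' j'] /= [? ? [-> ->]]].
Qed.

Lemma tsum_rows_le f (F : {fset I}) : (forall p, 0 <= f p) -> fbounded f ->
  fsum (fun i => tsum (fun j => f (i, j))) F <= tsum f.
Proof.
move=> f0 fb.
have rb i : fbounded (fun j => f (i, j)).
  exists (tsum f) => B; have := fsum_le_tsum ([fset i] `*` B)%fset fb.
  by rewrite fsum_product big_seq_fset1.
apply/ler_addgt0Pr => e e0.
pose n := (#|` F|)%:R : R; have n0 : 0 <= n by rewrite ler0n.
have d0 : 0 < e / (n + 1) by rewrite divr_gt0// ltr_wpDl.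
set d := e / _ in d0.
(* One finite set of columns serves all rows in [F] up to [d], and [d] times the number of rows
   stays below [e]. *)
have [B BP] : exists B : {fset J}, forall i, i \in F ->
    tsum (fun j => f (i, j)) <= fsum (fun j => f (i, j)) B + d.
  rewrite /d in d0 *; elim/fset1U_rect : F {n n0 d} (e / (n + 1)) d0 => [|i F iF IH] d d0.
    by exists fset0.
  have [B BP] := IH _ d0; have [C CP] := fbounded_approx (rb i) d0.
  exists (B `|` C)%fset => k; rewrite !inE => /orP[/eqP ->|kF].
    have := fsumU_le C B (fun j => f0 (i, j)); rewrite fsetUC; lra.
  by have := BP _ kF; have := fsumU_le B C (fun j => f0 (k, j)); lra.
apply: (@le_trans _ _ (fsum (fun i => fsum (fun j => f (i, j)) B + d) F)).
  exact: le_fsum_in.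
rewrite fsumD lerD//; first by rewrite /fsum -fsum_product; apply: fsum_le_tsum.
rewrite /fsum big_const_seq count_predT iter_addr_0 -mulr_natr -/n.
by rewrite /d mulrAC ler_pdivrMr ?ltr_wpDl// ler_pM2l// lerDl.
Qed.

Lemma tsum_glue f : (forall p, 0 <= f p) ->
  (forall i, fbounded (fun j => f (i, j))) ->
  fbounded (fun i => tsum (fun j => f (i, j))) ->
  fbounded f /\ tsum f <= tsum (fun i => tsum (fun j => f (i, j))).
Proof.
move=> f0 rb tb.
have H (G : {fset I * J}) : fsum f G <= tsum (fun i => tsum (fun j => f (i, j))).
  pose A := [fset p.1 | p in G]%fset; pose B := [fset p.2 | p in G]%fset.
  have GAB : (G `<=` A `*` B)%fset.
    by apply/fsubsetP => p pG; rewrite in_fsetM !in_imfset.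
  apply: (@le_trans _ _ (fsum f (A `*` B)%fset)).
    by rewrite (fsumID f GAB) lerDl fsum_ge0.
  rewrite fsum_product; apply: le_trans (fsum_le_tsum A tb).
  by apply: ler_sum => i _; apply: fsum_le_tsum.
by split; [eexists; exact: H|exact: tsum_le].
Qed.

End IteratedSums.

(** * Splitting l1 over a product index into rows *)

Section Rows.
Context {R : realType} (J : choiceType).

Definition row (x : nat * J -> R^o) (i : nat) : J -> R^o := fun j => x (i, j).

Definition glue (z : nat -> J -> R^o) : nat * J -> R^o := fun p => z p.1 p.2.

Lemma row_l1 x : l1 x -> [/\ forall i, l1 (row x i),
  fbounded (fun i => n1 (row x i)) & tsum (fun i => n1 (row x i)) <= n1 x].
Proof.
move=> lx.
have H F : fsum (fun i => n1 (row x i)) F <= n1 x.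
  exact: (tsum_rows_le (f := fun p => `|x p|)).
split; [|by exists (n1 x)|exact: tsum_le].
move=> i; exists (n1 x) => B; have := fsum_le_tsum ([fset i] `*` B)%fset lx.
by rewrite fsum_product big_seq_fset1.
Qed.

Lemma row_le x i : l1 x -> n1 (row x i) <= n1 x.
Proof.
move=> /row_l1[lr fb]; apply: le_trans; have := fsum_le_tsum [fset i]%fset fb.
by rewrite /fsum big_seq_fset1.
Qed.

Lemma glue_l1 z : (forall i, l1 (z i)) -> fbounded (fun i => n1 (z i)) ->
  l1 (glue z) /\ n1 (glue z) <= tsum (fun i => n1 (z i)).
Proof.
by move=> lz fb; apply: (tsum_glue (f := fun p => `|glue z p|)).
Qed.

Section UniformTails.
Variables (S : Type) (D : set S) (dS : S -> S -> R).
Implicit Type m : S -> nat -> R.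

(** Tails small uniformly near each point: the condition under which infinitely many continuous rows
    glue to a continuous map into l1. *)
Definition utail m := forall s (e : R), D s -> 0 < e -> exists M : nat,
  exists2 d, 0 < d & forall s', D s' -> dS s s' < d ->
    forall F : {fset nat}, (forall i, i \in F -> (M <= i)%N) -> fsum (m s') F < e.

Lemma utailD m m' : utail m -> utail m' -> utail (fun s i => m s i + m' s i).
Proof.
move=> h h' s e Ds e0; have e20 : 0 < e / 2 by rewrite divr_gt0.
have [M [d d0 H]] := h _ _ Ds e20; have [M' [d' d'0 H']] := h' _ _ Ds e20.
exists (maxn M M'), (Num.min d d'); first by rewrite lt_min d0.
move=> s' Ds'; rewrite lt_min => /andP[sd sd'] F FM; rewrite fsumD.
have := H _ Ds' sd F (fun i iF => leq_trans (leq_maxl _ _) (FM i iF)).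
have := H' _ Ds' sd' F (fun i iF => leq_trans (leq_maxr _ _) (FM i iF)).
by lra.
Qed.

Lemma utailZ C m : 0 <= C -> utail m -> utail (fun s i => C * m s i).
Proof.
move=> C0 h s e Ds e0; have e20 : 0 < e / (C + 1) by rewrite divr_gt0// ltr_wpDl.
have [M [d d0 H]] := h _ _ Ds e20; exists M, d => // s' Ds' sd F FM.
rewrite fsumZ; have := H _ Ds' sd F FM; rewrite ltr_pdivlMr ?ltr_wpDl// => lt.
have [f0|f0] := leP 0 (fsum (m s') F).
  by apply: le_lt_trans lt; rewrite mulrDr mulr1 mulrC lerDl.
by apply: le_lt_trans e0; rewrite mulr_ge0_le0// ltW.
Qed.

Lemma utail_succ m : utail m -> utail (fun s i => m s i.+1).
Proof.
move=> h s e Ds e0; have [M [d d0 H]] := h _ _ Ds e0.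
exists M, d => // s' Ds' sd F FM.
have -> : fsum (fun i => m s' i.+1) F = fsum (m s') [fset i.+1 | i in F]%fset.
  by rewrite /fsum big_imfset//= => i j _ _ [].
by apply: H => // k /imfsetP[i /= iF ->]; apply: leqW; exact: FM.
Qed.

Definition shift0 (g : nat -> R) (i : nat) := if i is i'.+1 then g i' else 0.

Lemma fsum_shift0 g (F : {fset nat}) :
  fsum (shift0 g) F = fsum g [fset i.-1 | i in (F `\ 0%N)]%fset.
Proof.
have -> : fsum (shift0 g) F = fsum (shift0 g) (F `\ 0%N)%fset.
  rewrite /fsum; apply/esym/big_fset_incl; first exact: fsubD1set.
  by move=> i iF; rewrite !inE iF andbT negbK => /eqP ->.
rewrite /fsum [RHS]big_imfset/=; last first.
  by move=> [|i] [|j]; rewrite !inE//= => _ _ ->.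
rewrite big_seq [RHS]big_seq; apply: eq_bigr => -[|i]//=.
by rewrite !inE.
Qed.

Lemma fbounded_shift0 g : fbounded g -> fbounded (shift0 g).
Proof. by move=> [M gM]; exists M => F; rewrite fsum_shift0. Qed.

Lemma utail_shift0 m : utail m -> utail (fun s => shift0 (m s)).
Proof.
move=> h s e Ds e0; have [M [d d0 H]] := h _ _ Ds e0.
exists M.+1, d => // s' Ds' sd F FM; rewrite fsum_shift0; apply: H => // k.
move=> /imfsetP[i /=]; rewrite !inE => /andP[_ iF] ->.
by have := FM _ iF; case: i {iF}.
Qed.

Lemma utail_head (c : S -> R) : utail (fun s i => if i == 0%N then c s else 0).
Proof.
move=> s e Ds e0; exists 1%N, 1 => // s' Ds' _ F FM.
rewrite /fsum big1_seq// => i /andP[_ /FM]; by case: i.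
Qed.

(** Finitely many rows are handled by their own continuity; the others are dominated by [m s'] and
    [m s], whose tails are small together when [s'] is near [s]. *)
Lemma glue_mcont (z : S -> nat -> J -> R^o) m :
  (forall s, D s -> dS s s = 0) ->
  (forall s i, D s -> l1 (z s i) /\ n1 (z s i) <= m s i) ->
  (forall s, D s -> fbounded (m s)) -> utail m ->
  (forall i, mcont D dS (ndist (@n1 R J)) (fun s => z s i)) ->
  mcont D dS (ndist (@n1 R _)) (fun s => glue (z s)).
Proof.
move=> dS0 zm mb mt zc s e Ds e0.
have sl := @seminormed_l1 R J.
have e80 : 0 < e / 8 by rewrite divr_gt0.
have [M [d d0 H]] := mt _ _ Ds e80.
have [d' d'0 H'] : exists2 d', 0 < d' & forall s', D s' -> dS s s' < d' ->
    \sum_(0 <= i < M) n1 (z s' i - z s i) < e / 2.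
  have : 0 < e / 2 by rewrite divr_gt0.
  elim: M (e / 2) {H} => [|M IH] e2 e20.
    by exists 1 => // s' _ _; rewrite big_geq.
  have e40 : 0 < e2 / 2 by rewrite divr_gt0.
  have [d1 d10 H1] := IH _ e40; have [d2 d20 H2] := zc M s _ Ds e40.
  exists (Num.min d1 d2); first by rewrite lt_min d10.
  move=> s' Ds'; rewrite lt_min => /andP[/(H1 _ Ds') + /(H2 _ Ds')].
  by rewrite big_nat_recr//= /ndist; lra.
exists (Num.min d d'); first by rewrite lt_min d0.
move=> s' Ds'; rewrite lt_min => /andP[sd sd'].
have lz i : l1 (z s' i - z s i) by apply: (sn_memB sl); exact: (zm _ _ _).1.
have nz i : n1 (z s' i - z s i) <= m s' i + m s i.
  apply: (le_trans (sn_leB sl _ _)); rewrite ?lerD//; exact: (zm _ _ _).2 || exact: (zm _ _ _).1.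
have fb : fbounded (fun i => n1 (z s' i - z s i)).
  by apply: le_fbounded (fboundedD (mb _ Ds') (mb _ Ds)) => i.
have [_ gl] := glue_l1 lz fb.
apply: (le_lt_trans gl); apply: (@le_lt_trans _ _
    (\sum_(0 <= i < M) n1 (z s' i - z s i) + e / 4)); last first.
  by have := H' _ Ds' sd'; lra.
apply: tsum_le => F.
have n0 i : 0 <= n1 (z s' i - z s i) by exact: (sn_ge0 sl).
rewrite -fsum_iota; set K := [fset n in iota 0 M]%fset.
apply: (le_trans (fsumU_le F K n0)); rewrite fsetUC (fsumID _ (fsubsetUl K F)) lerD2l.
set G := (_ `\` _)%fset.
have GM i : i \in G -> (M <= i)%N by rewrite inE in_fset_iota -leqNgt => /andP[].
apply: (le_trans (le_fsum G nz)); rewrite fsumD.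
have ss : dS s s < d by rewrite dS0.
by have := H _ Ds' sd G GM; have := H _ Ds ss G GM; lra.
Qed.

End UniformTails.

Lemma utail_rows : utail (@l1 R _) (ndist (@n1 R _)) (fun x i => n1 (row x i)).
Proof.
move=> x e lx e0; have e20 : 0 < e / 2 by rewrite divr_gt0.
have [lr fb _] := row_l1 lx.
have [F0 F0e] := fbounded_approx fb e20.
have [M FM] := fset_iota F0.
exists M, (e / 2) => // x' lx' d F FM'.
have sl := @seminormed_l1 R (nat * J)%type; have sr := @seminormed_l1 R J.
have lB : l1 (x' - x) by exact: (sn_memB sl).
have [lr' fb' t'] := row_l1 lB.
have h1 : fsum (fun i => n1 (row x' i)) F <=
    fsum (fun i => n1 (row (x' - x) i)) F + fsum (fun i => n1 (row x i)) F.
  rewrite -fsumD; apply: le_fsum => i.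
  have -> : row x' i = row (x' - x) i + row x i.
    by apply/funext => j; rewrite /row /=; exact/esym/subrK.
  exact: (sn_leD sr).
have h2 := fsum_le_tsum F fb'.
have h3 : fsum (fun i => n1 (row x i)) F < e / 2.
  apply: (fsum_tail fb F0e); apply/fdisjointP => i /(fsubsetP FM).
  rewrite in_fset_iota ltnNge => /negP iM; apply/negP => /FM'; exact: iM.
by move: d; rewrite /ndist; lra.
Qed.

Lemma row_mcont i : mcont (@l1 R _) (ndist (@n1 R _)) (ndist (@n1 R _)) (fun x => row x i).
Proof.
have sl := @seminormed_l1 R (nat * J)%type.
apply: (@mcont_lip _ _ _ _ _ _ _ 1) => //; first exact: (ndist_ge0 sl).
by move=> x y lx ly; rewrite mul1r /ndist; apply: (row_le i (x := y - x)); exact: (sn_memB sl).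
Qed.

End Rows.

Section Absorption.
Context {R : realType} (J : choiceType) (V : lmodType R) (E : set V) (N : V -> R).
Hypothesis sE : seminormed E N.
(** [u x] is the component of [x] in [F], and [c z x] is [x] with that component replaced by [z].
    The laws [uc], [cc] and [cu] express that l1 is a product of [F] with a second factor, without
    naming that factor. *)
Variables (F : set V) (u : (J -> R^o) -> V) (c : V -> (J -> R^o) -> (J -> R^o)) (C : R).
Hypothesis C0 : 0 <= C.
Hypothesis FE : F `<=` E.
Hypothesis uF : forall x, l1 x -> F (u x).
Hypothesis c_l1 : forall z x, F z -> l1 x -> l1 (c z x).
Hypothesis uc : forall z x, F z -> l1 x -> u (c z x) = z.
Hypothesis cc : forall z z' x, F z -> F z' -> l1 x -> c z' (c z x) = c z' x.
Hypothesis cu : forall x, l1 x -> c (u x) x = x.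
Hypothesis u_cont : mcont (@l1 R J) (ndist (@n1 R J)) (ndist N) u.
Hypothesis c_cont : mcont (F `*` (@l1 R J)) (pdist (ndist N) (ndist (@n1 R J)))
  (ndist (@n1 R J)) (fun p => c p.1 p.2).
Hypothesis u_norm : forall x, l1 x -> N (u x) <= C * n1 x.
Hypothesis c_norm : forall z x, F z -> l1 x -> n1 (c z x) <= C * (N z + n1 x).

Let sl := @seminormed_l1 R J.
Let sl2 := @seminormed_l1 R (nat * J)%type.
Let D := F `*` (@l1 R (nat * J)%type).
Let dD := pdist (ndist N) (ndist (@n1 R (nat * J)%type)).

(* Row [i] of [x] splits through [u] and [c] into a component in [F] and a row;
   [fwd] moves every component in [F] one row down, which frees the first row. *)
Let head (p : V * (nat * J -> R^o)) (i : nat) : V :=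
  if i is i'.+1 then u (row p.2 i') else p.1.

Let fwd (p : V * (nat * J -> R^o)) : nat * J -> R^o :=
  glue (fun i => c (head p i) (row p.2 i)).

Let bwd (y : nat * J -> R^o) : V * (nat * J -> R^o) :=
  (u (row y 0%N), glue (fun i => c (u (row y i.+1)) (row y i))).

Let headF p i : D p -> F (head p i).
Proof.
move=> [Fz /row_l1[lr _ _]]; case: i => [//|i]; exact: uF.
Qed.

Let mf (p : V * (nat * J -> R^o)) (i : nat) : R :=
  C * ((if i == 0%N then N p.1 else 0) +
       C * shift0 (fun k => n1 (row p.2 k)) i + n1 (row p.2 i)).

Let mb (y : nat * J -> R^o) (i : nat) : R := C * (C * n1 (row y i.+1) + n1 (row y i)).

Let fwd_row p i : D p -> l1 (c (head p i) (row p.2 i)) /\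
  n1 (c (head p i) (row p.2 i)) <= mf p i.
Proof.
move=> Dp; have [lr _ _] := row_l1 Dp.2; have Fh := headF i Dp.
split; first exact: c_l1.
apply: (le_trans (c_norm Fh (lr i))); rewrite ler_wpM2l// lerD2r.
case: i {Fh} => [|i] /=; first by rewrite mulr0 addr0.
by rewrite add0r; exact: u_norm.
Qed.

Let bwd_row y i : l1 y -> l1 (c (u (row y i.+1)) (row y i)) /\
  n1 (c (u (row y i.+1)) (row y i)) <= mb y i.
Proof.
move=> /row_l1[lr _ _]; split; first by apply: c_l1 => //; exact: uF.
apply: (le_trans (c_norm (uF (lr _)) (lr i))).
by rewrite ler_wpM2l// lerD2r u_norm.
Qed.

Let mf_bounded p : D p -> fbounded (mf p).
Proof.
move=> [Fz lx]; have [lr fb _] := row_l1 lx.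
apply: fboundedZ => //; apply: fboundedD => //; apply: fboundedD.
  by have [] := tsum1 0%N (sn_ge0 sE (FE Fz)).
by apply: fboundedZ => //; exact: (fbounded_shift0 fb).
Qed.

Let mb_bounded y : l1 y -> fbounded (mb y).
Proof.
move=> lx; have [lr [M fM] _] := row_l1 lx.
apply: fboundedZ => //; apply: fboundedD; last by exists M.
apply: fboundedZ => //; exists M => G.
have -> : fsum (fun i => n1 (row y i.+1)) G = fsum (fun i => n1 (row y i)) [fset i.+1 | i in G]%fset.
  by rewrite /fsum big_imfset//= => i j _ _ [].
exact: fM.
Qed.

Let nE : nonneg_on F (ndist N).
Proof. by move=> x y /FE Ex /FE Ey; apply: (ndist_ge0 sE). Qed.

Let utail_D m : utail (@l1 R _) (ndist (@n1 R (nat * J)%type)) m ->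
  utail D dD (fun p => m p.2).
Proof.
move=> h [z x] e [/= Fz lx] e0; have [M [d d0 H]] := h _ _ lx e0.
exists M, d => // -[z' x'] [/= Fz' lx']; rewrite /dD /pdist/= => hd.
by apply: H => //; have := nE Fz Fz'; lra.
Qed.

Let fwd_l1 p : D p -> l1 (fwd p).
Proof.
move=> Dp; apply: (glue_l1 _ _).1 => [i|]; first exact: (fwd_row i Dp).1.
by apply: le_fbounded (mf_bounded Dp) => i; exact: (fwd_row i Dp).2.
Qed.

Let bwd_l1 y : l1 y -> D (bwd y).
Proof.
move=> ly; have [lr _ _] := row_l1 ly; split; first exact: uF.
apply: (glue_l1 _ _).1 => [i|]; first exact: (bwd_row i ly).1.
by apply: le_fbounded (mb_bounded ly) => i; exact: (bwd_row i ly).2.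
Qed.

Let fwd_cont : mcont D dD (ndist (@n1 R _)) fwd.
Proof.
apply: (glue_mcont (m := mf)).
- move=> p [/FE Ez lx]; rewrite /dD /pdist /ndist !subrr.
  by rewrite (sn0 sE) (sn0 sl2) addr0.
- by move=> p i; exact: fwd_row.
- exact: mf_bounded.
- apply: utailZ => //; apply: utailD; last exact: (utail_D (@utail_rows _ _)).
  apply: utailD; first exact: utail_head.
  by apply: utailZ => //; apply: (utail_shift0 (m := fun p i => n1 (row p.2 i))); exact: (utail_D (@utail_rows _ _)).
move=> i.
have row_c k : mcont D dD (ndist (@n1 R _)) (fun p => row p.2 k).
  have sndl (p : V * (nat * J -> R^o)) : D p -> l1 p.2 by case.
  have sndc : mcont D dD (ndist (@n1 R (nat * J)%type)) snd by exact: mcont_snd.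
  have rc := @row_mcont R J k.
  have H := mcont_comp sndl sndc rc.
  exact: H.
apply: (mcont_comp (f := fun p => (head p i, row p.2 i)) (g := fun p => c p.1 p.2)) c_cont.
  by move=> p Dp; case: (row_l1 Dp.2) => lr _ _; split; [exact: headF|exact: lr].
apply: mcont_pair => //; case: i => [|i] /=.
  by apply: mcont_fst; exact: (ndist_ge0 sl2).
apply: (mcont_comp (B := @l1 R _) _ (row_c i) u_cont).
by move=> p Dp; have [] := row_l1 Dp.2.
Qed.

Let bwd_cont : mcont (@l1 R _) (ndist (@n1 R _)) dD bwd.
Proof.
have lr k (y : nat * J -> R^o) : l1 y -> l1 (row y k) by case/row_l1.
apply: mcont_pair; first exact: (mcont_comp (lr 0%N) (row_mcont 0%N) u_cont).
apply: (glue_mcont (m := mb)).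
- by move=> y ly; rewrite /ndist subrr (sn0 sl2).
- by move=> y i; exact: bwd_row.
- exact: mb_bounded.
- apply: utailZ => //; apply: utailD; last exact: utail_rows.
  by apply: utailZ => //; apply: (utail_succ (m := fun y i => n1 (row y i))); exact: utail_rows.
move=> i.
apply: (mcont_comp (f := fun y => (u (row y i.+1), row y i)) (g := fun p => c p.1 p.2)) c_cont.
  by move=> y ly; split; [exact/uF/lr|exact: lr].
apply: mcont_pair; last exact: row_mcont.
exact: (mcont_comp (lr i.+1) (row_mcont i.+1) u_cont).
Qed.

Lemma absorption : exists f g,
  mhomeo (F `*` (@l1 R (nat * J)%type))
    (pdist (ndist N) (ndist (@n1 R (nat * J)%type)))
    (@l1 R (nat * J)%type) (ndist (@n1 R (nat * J)%type)) f g.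
Proof.
exists fwd, bwd; split; last by split.
split; [exact: fwd_l1|exact: bwd_l1| |].
- move=> p Dp; have [lr _ _] := row_l1 Dp.2.
  have uE i : u (row (fwd p) i) = head p i by exact: (uc (headF i Dp) (lr i)).
  rewrite /bwd uE; move: p Dp lr uE => [z x] Dp lr uE; congr pair.
  (* Row by row, [cc] forgets the component that was put in and [cu] restores the original one. *)
  apply/funext => -[i j]; rewrite /glue [(i, j).1]/= [(i, j).2]/= uE.
  change (c (u (row x i)) (c (head (z, x) i) (row x i)) j = x (i, j)).
  by rewrite cc ?cu//; [exact: headF|exact: uF].
- move=> y ly; have [lr _ _] := row_l1 ly.
  have uE i : u (row (bwd y).2 i) = u (row y i.+1) by exact: (uc (uF (lr i.+1)) (lr i)).
  have hE i : head (bwd y) i = u (row y i) by case: i => [//|i]; exact: uE.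
  apply/funext => -[i j]; rewrite /fwd /glue [(i, j).1]/= [(i, j).2]/= hE.
  change (c (u (row y i)) (c (u (row y i.+1)) (row y i)) j = y (i, j)).
  by rewrite cc ?cu//; exact: uF.
Qed.

End Absorption.

Section Reindexing.
Context {R : realType} (I J : choiceType) (f : I -> J) (g : J -> I).
Hypotheses (fK : cancel f g) (gK : cancel g f).

Lemma l1_reindex (x : J -> R^o) : l1 x -> l1 (x \o f) /\ n1 (x \o f) = n1 x.
Proof.
move=> lx.
have E1 (F : {fset I}) : fsum (fun i => `|(x \o f) i|) F =
    fsum (fun j => `|x j|) [fset f i | i in F]%fset.
  by rewrite /fsum big_imfset//= => i j _ _; exact: (can_inj fK).
have E2 (G : {fset J}) : fsum (fun j => `|x j|) G =
    fsum (fun i => `|(x \o f) i|) [fset g j | j in G]%fset.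
  rewrite /fsum big_imfset//=; last by move=> i j _ _; exact: (can_inj gK).
  by apply: eq_bigr => j _; rewrite gK.
have lxf : l1 (x \o f).
  by exists (n1 x) => F; rewrite E1; apply: fsum_le_tsum.
split=> //; apply/eqP; rewrite eq_le; apply/andP; split; apply: tsum_le => F.
  by rewrite E1; apply: fsum_le_tsum.
by rewrite E2; apply: (fsum_le_tsum _ lxf).
Qed.

End Reindexing.

Lemma l1_homeo_bij (R : realType) (I J : choiceType) (f : I -> J) (g : J -> I) :
  cancel f g -> cancel g f ->
  mhomeo (@l1 R J) (ndist (@n1 R J)) (@l1 R I) (ndist (@n1 R I))
    (fun x => x \o f) (fun x => x \o g).
Proof.
move=> fK gK; split.
  split=> x lx.
  - exact: (l1_reindex fK gK lx).1.
  - exact: (l1_reindex gK fK lx).1.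
  - by apply/funext => j /=; rewrite gK.
  - by apply/funext => j /=; rewrite fK.
split; apply: (@mcont_lip _ _ _ _ _ _ _ 1) => //; try exact: (ndist_ge0 (seminormed_l1 _)).
- move=> x y lx ly; rewrite mul1r /ndist.
  by have [_ <-] := l1_reindex fK gK (sn_memB (seminormed_l1 _) ly lx).
- move=> x y lx ly; rewrite mul1r /ndist.
  by have [_ <-] := l1_reindex gK fK (sn_memB (seminormed_l1 _) ly lx).
Qed.

Lemma nat_prod_powerset_bij : exists (f : nat * set nat -> set nat) (g : set nat -> nat * set nat),
  cancel f g /\ cancel g f.
Proof.
have : ([set: nat * set nat] #= [set: set nat])%card.
  rewrite card_eq_le; apply/andP; split; apply/pcard_injP.
    (* A pair [(n, A)] becomes the set with [2n] as its only even element and [2a + 1] for each [a]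
       in [A]; an injection in the other direction and Cantor-Bernstein do the rest. *)
    exists (fun w k => if odd k then w.2 k./2 else k./2 = w.1).
    move=> [n A] [m B] _ _ /= e; congr pair.
      have := congr1 (fun X => X n.*2) e; rewrite /= odd_double doubleK => H.
      by have : n = n by []; rewrite {1}H.
    apply/seteqP; split=> k; have := congr1 (fun X => X k.*2.+1) e;
      by rewrite /= odd_double /= uphalf_double => ->.
  by exists (fun A => (0%N, A)) => A B _ _ [].
move=> /card_set_bijP[f]; rewrite setTT_bijective => -[g fK gK].
by exists f, g.
Qed.

(** * Banach spaces that are an image of l1 and contain l1 *)

Section ModelBanach.
Context {R : realType} (V : lmodType R) (E : set V) (N : V -> R).
Hypothesis bE : banach E N.
Local Notation J := (set nat).
Variable code : V -> J.
Hypothesis code_inj : forall x y, E x -> E y -> code x = code y -> x = y.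
Variable rad : J -> V.
Hypothesis rad_mem : forall j, E (rad j).
Hypothesis rad_norm : forall j, N (rad j) <= 1.
Hypothesis rad_free : forall (F : {fset J}) (a : J -> R),
  \sum_(j <- F) `|a j| <= N (\sum_(j <- F) a j *: rad j).

Let sE := banach_sn bE.
Let bl := @banach_l1 R J.
Let sl := @seminormed_l1 R J.

(** An enumeration of the unit ball of [E] by [set nat], through the injectivity of [code]; indices
    that code no element of the ball give 0. *)
Let unit_vec (j : J) : V := xget 0 [set x | [/\ E x, N x <= 1 & code x = j]].

Let unit_vecP j : E (unit_vec j) /\ N (unit_vec j) <= 1.
Proof.
rewrite /unit_vec; case: xgetP => [x -> []//|_].
by rewrite (sn0 sE); split; [exact: (sn_mem0 sE)|].
Qed.

Let unit_vec_code x : E x -> N x <= 1 -> unit_vec (code x) = x.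
Proof.
move=> Ex Nx; rewrite /unit_vec; case: xgetP => [y -> [Ey _ ]|/(_ x)].
  exact: code_inj.
by case.
Qed.

Let q := synth E N unit_vec.

Let q_mem x : l1 x -> E (q x).
Proof. by apply: (synth_mem bE) => j; case: (unit_vecP j). Qed.

Let q_norm x : l1 x -> N (q x) <= n1 x.
Proof. by apply: (synth_norm bE) => j; case: (unit_vecP j). Qed.

Let qD x y : l1 x -> l1 y -> q (x + y) = q x + q y.
Proof. by apply: (synthD bE) => j; case: (unit_vecP j). Qed.

Let qZ c x : l1 x -> q (c *: x) = c *: q x.
Proof. by apply: (synthZ bE) => j; case: (unit_vecP j). Qed.

Let qB x y : l1 x -> l1 y -> q (x - y) = q x - q y.
Proof. by apply: (synthB bE) => j; case: (unit_vecP j). Qed.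

(** Each [y] is [N y] times a vector of the unit ball, so a multiple of one basis vector maps to it
    without loss of norm. *)
Let q_onto y : E y -> exists x, [/\ l1 x, N (q x - y) = 0 & n1 x <= 1 * N y].
Proof.
move=> Ey; have [y0|y0] := eqVneq (N y) 0.
  exists 0; split; [exact: (sn_mem0 sl)| |by rewrite y0 mulr0 (sn0 sl)].
  have -> : q 0 = 0.
    by rewrite -(scale0r (0 : J -> R^o)) qZ ?scale0r//; exact: (sn_mem0 sl).
  by rewrite sub0r (snN sE).
have Ny : 0 < N y by rewrite lt0r y0 (sn_ge0 sE).
pose z := (N y)^-1 *: y.
have Ez : E z by exact: (sn_memZ sE).
have Nz : N z <= 1 by rewrite (sn_Z sE)// gtr0_norm ?invr_gt0// mulVf.
have [ld nd] := delta_l1 (code z) (N y).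
exists (delta (code z) (N y)); split=> //; last by rewrite nd gtr0_norm// mul1r.
rewrite /q (synth_delta bE) => [|j]; last by case: (unit_vecP j).
by rewrite unit_vec_code// scalerA divff// scale1r subrr (sn0 sE).
Qed.

Let Phi := synth E N rad.

Let Phi_mem x : l1 x -> E (Phi x). Proof. exact: (synth_mem bE). Qed.

Let Phi_norm x : l1 x -> N (Phi x) = n1 x.
Proof. by move=> lx; apply: (synth_isometry bE) => // F; exact: rad_free. Qed.

Let PhiD x y : l1 x -> l1 y -> Phi (x + y) = Phi x + Phi y.
Proof. exact: (synthD bE). Qed.

Let PhiZ c x : l1 x -> Phi (c *: x) = c *: Phi x.
Proof. exact: (synthZ bE). Qed.

Let PhiB x y : l1 x -> l1 y -> Phi (x - y) = Phi x - Phi y.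
Proof. exact: (synthB bE). Qed.

Let Phi0 : Phi 0 = 0.
Proof. by rewrite -(scale0r (0 : J -> R^o)) PhiZ ?scale0r//; exact: (sn_mem0 sl). Qed.

Let Phi_inj x y : l1 x -> l1 y -> Phi x = Phi y -> x = y.
Proof.
move=> lx ly e; apply/eqP; rewrite -subr_eq0; apply/eqP.
apply: (banach_eq0 bl); first exact: (sn_memB sl).
by rewrite -Phi_norm ?PhiB ?e ?subrr ?(sn0 sE)//; exact: (sn_memB sl).
Qed.

(** The norm of the quotient of [E] by the image of [Phi], pulled back to [E]. *)
Let p (x : V) : R := inf [set N (x - Phi a) | a in @l1 R J].

Let p_le x a : E x -> l1 a -> p x <= N (x - Phi a).
Proof.
move=> Ex la; apply: ge_inf; last by exists a.
by exists 0 => _ [b lb <-]; apply: (sn_ge0 sE); apply: (sn_memB sE) => //; exact: Phi_mem.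
Qed.

Let p_ge x (m : R) : (forall a, l1 a -> m <= N (x - Phi a)) -> m <= p x.
Proof.
move=> H; apply: lb_le_inf; first by exists (N (x - Phi 0)), 0 => //; exact: (sn_mem0 sl).
by move=> _ [b lb <-]; exact: H.
Qed.

Let p_approx x (e : R) : E x -> 0 < e -> exists2 a, l1 a & N (x - Phi a) < p x + e.
Proof.
move=> Ex e0; apply: contrapT => H.
have : p x + e <= p x.
  apply: p_ge => a la; rewrite leNgt; apply/negP => lt; apply: H; by exists a.
by lra.
Qed.

Let p_ge0 x : E x -> 0 <= p x.
Proof.
move=> Ex; apply: p_ge => a la; apply: (sn_ge0 sE); apply: (sn_memB sE) => //.
exact: Phi_mem.
Qed.

Let p_le_N x : E x -> p x <= N x.
Proof. by move=> Ex; have := p_le Ex (sn_mem0 sl); rewrite Phi0 subr0. Qed.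

Let seminormed_p : seminormed E p.
Proof.
split; [exact: (sn_mem0 sE)|exact: (sn_memD sE)|exact: (sn_memZ sE)|exact: p_ge0| |].
  move=> x y Ex Ey; apply/ler_addgt0Pr => e e0; have e20 : 0 < e / 2 by rewrite divr_gt0.
  have [a la ha] := p_approx Ex e20; have [b lb hb] := p_approx Ey e20.
  have := p_le (sn_memD sE Ex Ey) (sn_memD sl la lb).
  rewrite PhiD// opprD addrACA.
  have := sn_leD sE (sn_memB sE Ex (Phi_mem la)) (sn_memB sE Ey (Phi_mem lb)).
  by lra.
have pZ c x : E x -> p (c *: x) <= `|c| * p x.
  move=> Ex; apply/ler_addgt0Pr => e e0.
  have e20 : 0 < e / (`|c| + 1) by rewrite divr_gt0// ltr_wpDl.
  have [a la ha] := p_approx Ex e20.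
  have := p_le (sn_memZ sE c Ex) (sn_memZ sl c la).
  rewrite PhiZ// -scalerBr (sn_Z sE); last by apply: (sn_memB sE) => //; exact: Phi_mem.
  move=> /le_trans; apply.
  have := ler_wpM2l (normr_ge0 c) (ltW ha); rewrite mulrDr => /le_trans; apply.
  rewrite lerD2l mulrA mulrAC ler_piMl ?(ltW e0)// ler_pdivrMr ?ltr_wpDl//.
  by rewrite mul1r lerDl.
move=> c x Ex; apply/eqP; rewrite eq_le pZ//=.
have [->|c0] := eqVneq c 0; first by rewrite normr0 mul0r p_ge0//; exact: (sn_memZ sE).
rewrite -[in leLHS](scale1r x) -(mulVf c0) -scalerA.
have := pZ c^-1 (c *: x) (sn_memZ sE c Ex).
by rewrite normfV -ler_pdivrMl ?invr_gt0 ?normr_gt0// invrK.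
Qed.

Let p_Phi a : l1 a -> p (Phi a) = 0.
Proof.
move=> la; apply/eqP; rewrite eq_le (p_ge0 (Phi_mem la)) andbT.
by have := p_le (Phi_mem la) la; rewrite subrr (sn0 sE).
Qed.

(** An isometric copy of the complete space l1 is closed: the approximations [a n] of [x] form a
    Cauchy sequence. *)
Let p_eq0 x : E x -> p x = 0 -> exists2 a, l1 a & Phi a = x.
Proof.
move=> Ex px.
have /choice[a aP] : forall n : nat, exists a, l1 a /\ N (x - Phi a) < 1 / 2 ^+ n.
  move=> n; have e0 : 0 < 1 / 2 ^+ n :> R by rewrite divr_gt0// exprn_gt0.
  by have [a la] := p_approx Ex e0; rewrite px add0r => ?; exists a.
have la n : l1 (a n) by case: (aP n).
have Ea n : E (Phi (a n)) by exact: Phi_mem.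
have [e e0|b lb bP] := banach_complete bl la.
  have e20 : 0 < e / 2 by rewrite divr_gt0.
  have [M MP] := exp2n_lt 1 e20; exists M => m k Mm Mk.
  rewrite -Phi_norm; last exact: (sn_memB sl).
  rewrite PhiB//; apply: (le_lt_trans (sn_distD sE (Ea m) (Ea k) Ex)).
  rewrite (sn_distC sE (Ea m) Ex).
  have := MP _ Mm; have := MP _ Mk; have := (aP m).2; have := (aP k).2; lra.
exists b => //; apply/eqP; rewrite -subr_eq0; apply/eqP.
have Eb := Phi_mem lb.
apply: (banach_eq0 bE); first exact: (sn_memB sE).
apply/eqP; rewrite eq_le (sn_ge0 sE (sn_memB sE Eb Ex)) andbT.
apply/ler_addgt0Pr => e e0; rewrite add0r; have e20 : 0 < e / 2 by rewrite divr_gt0.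
have [M MP] := exp2n_lt 1 e20; have [K KP] := bP _ e20.
have h1 := MP _ (leq_maxl M K); have h2 := KP _ (leq_maxr M K).
set m := maxn M K in h1 h2.
move: h2; rewrite -Phi_norm; last exact: (sn_memB sl).
rewrite PhiB// (sn_distC sE (Ea m) Eb) => h2.
have := sn_distD sE Eb Ex (Ea m); rewrite (sn_distC sE (Ea m) Ex).
by have := (aP m).2; lra.
Qed.

(** [t] is a section of [q]. [s] is a section of the quotient by the image of [Phi], obtained from
    the identity of [E] with [N] on the source and [p] on the target; a class has a representative
    of norm at most [2 * p y], whence 6 = 3 times 2. *)
Let sections : exists (t : V -> J -> R^o) (s : V -> V),
  [/\ forall y, E y -> l1 (t y), forall y, E y -> q (t y) = y,
      forall y, E y -> n1 (t y) <= 3 * N y & mcont E (ndist N) (ndist (@n1 R J)) t] /\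
  [/\ forall y, E y -> E (s y), forall y, E y -> p (s y - y) = 0,
      forall y, E y -> N (s y) <= 6 * p y & mcont E (ndist p) (ndist N) s].
Proof.
have [t [t1 t2 t3 t4]] := bartle_graves bl sE q_mem qD qZ
  (fun x lx => le_trans (q_norm lx) (eq_ind_r (fun z => _ <= z) (lexx _) (mul1r _)))
  ler01 ler01 q_onto.
have id_open y : E y -> exists x, [/\ E x, p (id x - y) = 0 & N x <= 2 * p y].
  move=> Ey; have [y0|y0] := eqVneq (p y) 0.
    exists 0; rewrite sub0r (snN seminormed_p)// y0 (sn0 sE) mulr0.
    by split=> //; exact: (sn_mem0 sE).
  have py : 0 < p y by rewrite lt0r y0 p_ge0.
  have [a la ha] := p_approx Ey py.
  have Ea := Phi_mem la.
  exists (y - Phi a); split; [exact: (sn_memB sE)| |by lra].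
  by rewrite addrAC subrr sub0r (snN seminormed_p)// p_Phi.
have [s [s1 s2 s3 s4]] := bartle_graves bE seminormed_p (T := id) (fun x Ex => Ex)
  (fun x y _ _ => erefl) (fun a x _ => erefl)
  (fun x Ex => le_trans (p_le_N Ex) (eq_ind_r (fun z => _ <= z) (lexx _) (mul1r _)))
  (@ler0n R 2) ler01 id_open.
exists t, s; split; split=> //.
- move=> y Ey; apply/eqP; rewrite -subr_eq0; apply/eqP; apply: (banach_eq0 bE) => //.
    by apply: (sn_memB sE) => //; apply/q_mem/t1.
  exact: t2.
- by move=> y /t3; rewrite mulr1.
- by move=> y /s3; rewrite -natrM.
Qed.

Theorem banach_homeo_l1 : exists f g,
  mhomeo E (ndist N) (@l1 R J) (ndist (@n1 R J)) f g.
Proof.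
have [t [s [[t1 t2 t3 t4] [s1 s2 s3 s4]]]] := sections.
pose ia x := xget 0 [set a | l1 a /\ Phi a = x].
have iaP x : E x -> p x = 0 -> l1 (ia x) /\ Phi (ia x) = x.
  move=> Ex px; rewrite /ia; case: xgetP => [a -> //|H].
  by have [a la ax] := p_eq0 Ex px; case: (H a).
have sp x : E x -> p (x - s x) = 0.
  by move=> Ex; rewrite (sn_distC seminormed_p)//; [exact: s2|exact: s1].
(* Being continuous for [p], [s] takes equal values at [p]-distance 0: it depends only on the class
   modulo the image of [Phi]. *)
have s_eq x y : E x -> E y -> p (x - y) = 0 -> s x = s y.
  move=> Ex Ey xy; apply/eqP; rewrite -subr_eq0; apply/eqP.
  have Esx := s1 _ Ex; have Esy := s1 _ Ey.
  apply: (banach_eq0 bE); first exact: (sn_memB sE).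
  apply/eqP; rewrite eq_le (sn_ge0 sE (sn_memB sE Esx Esy)) andbT.
  apply/ler_addgt0Pr => e e0; rewrite add0r; have [d d0 /(_ x Ex)] := s4 _ _ Ey e0.
  by rewrite /ndist xy => /(_ d0)/ltW.
pose h x := ia (x - s x).
have Exs x : E x -> E (x - s x) by move=> Ex; apply: (sn_memB sE) => //; exact: s1.
have h_l1 x : E x -> l1 (h x) by move=> Ex; exact: (iaP _ (Exs _ Ex) (sp _ Ex)).1.
have hP x : E x -> Phi (h x) = x - s x by move=> Ex; exact: (iaP _ (Exs _ Ex) (sp _ Ex)).2.
(* [F] is the image of [s], one representative per class, and every [x] in [E] decomposes as
   [Phi (h x) + s x]. *)
pose F : set V := [set z | E z /\ s z = z].
have FE : F `<=` E by move=> z [].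
have sF x : E x -> F (s x).
  by move=> Ex; split; [exact: s1|apply: s_eq => //; [exact: s1|exact: s2]].
have EPz a z : l1 a -> F z -> E (Phi a + z).
  by move=> la [Ez _]; apply: (sn_memD sE) => //; exact: Phi_mem.
have s_Pz a z : l1 a -> F z -> s (Phi a + z) = z.
  move=> la Fz; have [Ez sz] := Fz; rewrite -[RHS]sz; apply: s_eq => //; first exact: EPz.
  by rewrite addrK p_Phi.
have h_Pz a z : l1 a -> F z -> h (Phi a + z) = a.
  move=> la Fz; apply: Phi_inj => //; first exact/h_l1/EPz.
  by rewrite hP ?s_Pz ?addrK//; exact: EPz.
have s_cont : mcont E (ndist N) (ndist N) s.
  move=> x e Ex e0; have [d d0 H] := s4 _ _ Ex e0; exists d => // y Ey xy.
  by apply: H => //; apply: le_lt_trans xy; apply: p_le_N; exact: (sn_memB sE).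
have id_cont : mcont E (ndist N) (ndist N) id by move=> x e _ e0; exists e.
have xs_cont : mcont E (ndist N) (ndist N) (fun x => x - s x).
  by apply: (mcontB sE) => // x Ex; exact: s1.
have h_cont : mcont E (ndist N) (ndist (@n1 R J)) h.
  move=> x e Ex e0; have [d d0 H] := xs_cont _ _ Ex e0; exists d => // y Ey /(H _ Ey).
  rewrite /ndist -(Phi_norm (sn_memB sl (h_l1 _ Ey) (h_l1 _ Ex))).
  by rewrite PhiB ?hP//; exact: h_l1.
have Phi_cont : mcont (@l1 R J) (ndist (@n1 R J)) (ndist N) Phi.
  move=> x e lx e0; exists e => // y ly; rewrite /ndist -PhiB// Phi_norm//.
  exact: (sn_memB sl).
have q_cont : mcont (@l1 R J) (ndist (@n1 R J)) (ndist N) q.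
  move=> x e lx e0; exists e => // y ly; rewrite /ndist -qB//; apply: le_lt_trans.
  by apply: q_norm; exact: (sn_memB sl).
have nE := ndist_ge0 sE; have nl := ndist_ge0 sl.
have nF : nonneg_on F (ndist N) by move=> x y /FE Ex /FE Ey; exact: nE.
have sndc : mcont (F `*` (@l1 R J)) (pdist (ndist N) (ndist (@n1 R J))) (ndist (@n1 R J)) snd.
  exact: mcont_snd.
have sndl (w : V * (J -> R^o)) : (F `*` (@l1 R J)) w -> l1 w.2 by case.
have Phiz_cont : mcont (F `*` (@l1 R J)) (pdist (ndist N) (ndist (@n1 R J))) (ndist N)
    (fun w => Phi w.2 + w.1).
  apply: (mcontD sE); [by move=> w [_ /Phi_mem]|by move=> w [/FE]| |exact: mcont_fst].
  have H := mcont_comp sndl sndc Phi_cont.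
  exact: H.
have EF : mhomeo E (ndist N) (F `*` (@l1 R J)) (pdist (ndist N) (ndist (@n1 R J)))
    (fun x => (s x, h x)) (fun w => Phi w.2 + w.1).
  split; first split.
  - by move=> x Ex; split; [exact: sF|exact: h_l1].
  - by move=> [z a] [/= Fz la]; exact: EPz.
  - by move=> x Ex /=; rewrite hP// subrK.
  - by move=> [z a] [/= Fz la]; rewrite s_Pz// h_Pz.
  by split; [exact: mcont_pair|exact: Phiz_cont].
(* The component of [x] in [F] is that of [q x]. To replace it by [z], the new value
   [Phi (h (q x)) + z] of [q] is lifted by [t], and the part [x - t (q x)] in the kernel of [q] is
   kept. *)
pose u x := s (q x).
pose c z x := t (Phi (h (q x)) + z) + (x - t (q x)).
have hq_l1 x : l1 x -> l1 (h (q x)) by move=> lx; apply/h_l1/q_mem.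
have Ec z x : F z -> l1 x -> E (Phi (h (q x)) + z) by move=> Fz lx; apply: EPz => //; exact: hq_l1.
have lxt x : l1 x -> l1 (x - t (q x)).
  by move=> lx; apply: (sn_memB sl) => //; apply/t1/q_mem.
have c_l1 z x : F z -> l1 x -> l1 (c z x).
  by move=> Fz lx; apply: (sn_memD sl); [exact/t1/Ec|exact: lxt].
have qc z x : F z -> l1 x -> q (c z x) = Phi (h (q x)) + z.
  move=> Fz lx; have Ez := Ec _ _ Fz lx; have Eq := q_mem lx.
  rewrite qD ?qB ?t2 ?subrr ?addr0//; [exact: t1|exact: t1|exact: lxt].
have [f [g fg]] : exists f g, mhomeo (F `*` (@l1 R (nat * J)%type))
    (pdist (ndist N) (ndist (@n1 R (nat * J)%type)))
    (@l1 R (nat * J)%type) (ndist (@n1 R (nat * J)%type)) f g.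
  (* The estimates below give 6 for [u] and 25 for [c]; 100 covers both. *)
  apply: (@absorption R J V E N sE F u c 100) => //.
  - by move=> x lx; apply/sF/q_mem.
  - by move=> z x Fz lx; rewrite /u qc// s_Pz//; exact: hq_l1.
  - move=> z z' x Fz Fz' lx; rewrite {1}/c qc// h_Pz//; last exact: hq_l1.
    by rewrite {2}/c /c [_ + (x - _)]addrC addrK.
  - by move=> x lx; rewrite /c /u (hP _ (q_mem lx)) subrK addrC subrK.
  - exact: (mcont_comp q_mem q_cont s_cont).
  - have qs_cont : mcont (F `*` (@l1 R J)) (pdist (ndist N) (ndist (@n1 R J))) (ndist N)
        (fun w => q w.2).
      have H := mcont_comp sndl sndc q_cont.
      exact: H.
    have Eqs w : (F `*` (@l1 R J)) w -> E (q w.2) by move=> [_ /q_mem].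
    apply: (mcontD sl).
    + by move=> w [Fz lx]; exact/t1/Ec.
    + by move=> w [Fz lx]; exact: lxt.
    + apply: (mcont_comp (f := fun w => Phi (h (q w.2)) + w.1) (g := t) (B := E)) t4.
        by move=> w [Fz lx]; exact: Ec.
      apply: (mcontD sE); [by move=> w [_ /hq_l1/Phi_mem]|by move=> w [/FE]| |exact: mcont_fst].
      have := mcont_comp Eqs qs_cont h_cont.
      by move=> /(mcont_comp (fun w Dw => h_l1 _ (Eqs w Dw)))/(_ Phi_cont).
    + apply: (mcontB sl); [by move=> w []|by move=> w /Eqs/t1|exact: mcont_snd|].
      exact: (mcont_comp Eqs qs_cont t4).
  - move=> x lx; apply: (le_trans (s3 _ (q_mem lx))).
    have := p_le_N (q_mem lx); have := q_norm lx; have := sn_ge0 sl lx; lra.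
  - move=> z x Fz lx; apply: (le_trans (sn_leD sl (t1 _ (Ec _ _ Fz lx)) (lxt _ lx))).
    have a1 := t3 _ (Ec _ _ Fz lx).
    have a2 := sn_leB sl lx (t1 _ (q_mem lx)).
    have a3 := t3 _ (q_mem lx).
    have a4 := q_norm lx.
    have a5 := sn_leD sE (Phi_mem (hq_l1 _ lx)) (FE _ Fz).
    have a6 := sn_leB sE (q_mem lx) (s1 _ (q_mem lx)).
    have a7 := s3 _ (q_mem lx); have a8 := p_le_N (q_mem lx).
    have a9 := sn_ge0 sl lx; have a10 := sn_ge0 sE (FE _ Fz).
    rewrite (hP _ (q_mem lx)) in a1 a5 *.
    by lra.
have [phi [psi [phiK psiK]]] := nat_prod_powerset_bij.
have RI := @l1_homeo_bij R _ _ _ _ phiK psiK.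
have RF : mhomeo (F `*` (@l1 R J)) (pdist (ndist N) (ndist (@n1 R J)))
    (F `*` (@l1 R (nat * J)%type)) (pdist (ndist N) (ndist (@n1 R (nat * J)%type)))
    (fun w => (w.1, w.2 \o phi)) (fun w => (w.1, w.2 \o psi)).
  have [[r1 r2 r3 r4] [r5 r6]] := RI.
  have nl2 := ndist_ge0 (@seminormed_l1 R (nat * J)%type).
  split; first split.
  - by move=> [z x] [/= Fz lx]; split=> //; exact: r1.
  - by move=> [z x] [/= Fz lx]; split=> //; exact: r2.
  - by move=> [z x] [/= Fz lx]; congr pair; exact: r3.
  - by move=> [z x] [/= Fz lx]; congr pair; exact: r4.
  split; apply: mcont_pair; try exact: mcont_fst.
    have H := mcont_comp sndl sndc r5.
    exact: H.
  have sndc2 : mcont (F `*` (@l1 R (nat * J)%type))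
      (pdist (ndist N) (ndist (@n1 R (nat * J)%type))) (ndist (@n1 R _)) snd.
    exact: mcont_snd.
  have sndl2 (w : V * (nat * J -> R^o)) : (F `*` (@l1 R _)) w -> l1 w.2 by case.
  have H := mcont_comp sndl2 sndc2 r6.
  exact: H.
(* The chain runs from [E] to F x l1(J), to F x l1(nat x J) by reindexing, to l1(nat x J) by
   absorption, and back to l1(J). *)
do 2 eexists.
exact: (mhomeo_trans (mhomeo_trans (mhomeo_trans EF RF) fg) (mhomeo_sym RI)).
Qed.

End ModelBanach.

(** * Mazur's homeomorphism *)

Section Mazur.
Context {R : realType} (J : choiceType).

Lemma esum_tsum (f : J -> R) : (forall j, 0 <= f j) -> fbounded f ->
  (\esum_(j in [set: J]) (f j)%:E = (tsum f)%:E)%E.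
Proof.
move=> f0 fb; apply/eqP; rewrite eq_le; apply/andP; split.
  apply: ge_ereal_sup => _ [A [finA _] <-].
  rewrite fsbig_finite//= sumEFin lee_fin; exact: fsum_le_tsum.
apply/lee_addgt0Pr => e e0; have [F Fe] := fbounded_approx fb e0.
apply: (@le_trans _ _ ((fsum f F)%:E + e%:E)%E).
  by rewrite -EFinD lee_fin; lra.
rewrite leeD2r//; apply: esum_ge; exists [set` F]; first by split.
by rewrite fsbig_finite//= set_fsetK sumEFin.
Qed.

Lemma esum_fbounded (f : J -> R) : (forall j, 0 <= f j) ->
  (\esum_(j in [set: J]) (f j)%:E < +oo)%E -> fbounded f.
Proof.
move=> f0 foo; exists (fine (\esum_(j in [set: J]) (f j)%:E)) => F.
have fin : (\esum_(j in [set: J]) (f j)%:E)%E \is a fin_num.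
  by rewrite ge0_fin_numE// esum_ge0// => j _; rewrite lee_fin.
rewrite -lee_fin fineK//; apply: esum_ge; exists [set` F]; first by split.
by rewrite fsbig_finite//= set_fsetK sumEFin.
Qed.

Definition signed_sqrt (x : R) : R := Num.sg x * Num.sqrt `|x|.

Lemma signed_sqrt_sqr x : signed_sqrt x ^+ 2 = `|x|.
Proof.
rewrite /signed_sqrt exprMn sqr_sqrtr// sqr_sg.
by have [->|] := eqVneq x 0; rewrite ?normr0 ?mulr0// mul1r.
Qed.

Lemma norm_signed_sqrt x : `|signed_sqrt x| = Num.sqrt `|x|.
Proof.
rewrite /signed_sqrt normrM normr_sg ger0_norm ?sqrtr_ge0//.
by have [->|] := eqVneq x 0; rewrite ?normr0 ?sqrtr0 ?mulr0// mul1r.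
Qed.

Lemma signed_sqrtK x : signed_sqrt x * `|signed_sqrt x| = x.
Proof.
rewrite norm_signed_sqrt /signed_sqrt -mulrA -expr2 sqr_sqrtr//.
by rewrite -numEsg.
Qed.

Lemma signed_sqrKK v : signed_sqrt (v * `|v|) = v.
Proof.
rewrite /signed_sqrt normrM normr_id -expr2 sqrtr_sqr normr_id sgrM.
have [->|v0] := eqVneq v 0; first by rewrite sgr0 !mul0r.
by rewrite [Num.sg `|v|]gtr0_sg ?normr_gt0// mulr1 -numEsg.
Qed.

(** For roots [s], [t] of equal sign, |s - t| (|s| + |t|) is at least (s - t)^2; for opposite signs
    (s - t)^2 is at most 2 (s^2 + t^2), the source of the factor 2. Hence Mazur's map is Hoelder of
    exponent 1/2. *)
Lemma signed_sqrt_dist x y : (signed_sqrt x - signed_sqrt y) ^+ 2 <= 2 * `|x - y|.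
Proof.
rewrite -{2}(signed_sqrtK x) -{2}(signed_sqrtK y).
set s := signed_sqrt x; set t := signed_sqrt y.
have q1 := sqr_ge0 (s + t); have q2 := sqr_ge0 s; have q3 := sqr_ge0 t.
have [s0|s0] := leP 0 s; have [t0|t0] := leP 0 t.
- rewrite !(ger0_norm s0) !(ger0_norm t0).
  have [h|h] := leP t s.
    by rewrite ger0_norm; nra.
  by rewrite ltr0_norm; nra.
- rewrite (ger0_norm s0) (ltr0_norm t0) ger0_norm; nra.
- rewrite (ltr0_norm s0) (ger0_norm t0) ler0_norm; nra.
- rewrite (ltr0_norm s0) (ltr0_norm t0).
  have [h|h] := leP t s.
    by rewrite ger0_norm; nra.
  by rewrite ltr0_norm; nra.
Qed.

(** With a = |v - u| and b = |u| the left side is at most a (2b + a), and Young's inequality bounds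
    2ab by K a^2 + b^2 / K. The last term does not involve [v] and is small for large [K]. *)
Lemma signed_sqr_dist (K u v : R) : 0 < K ->
  `|v * `|v| - u * `|u| | <= (K + 1) * (u - v) ^+ 2 + K^-1 * u ^+ 2.
Proof.
move=> K0.
have h1 : `|v * `|v| - u * `|u| | <= `|v - u| * (2 * `|u| + `|v - u|).
  have -> : v * `|v| - u * `|u| = (v - u) * `|v| + u * (`|v| - `|u|) by ring.
  apply: (le_trans (ler_normD _ _)); rewrite !normrM normr_id.
  have a1 := ler_dist_dist v u; have a2 := ler_normD (v - u) u; rewrite subrK in a2.
  have a3 := normr_ge0 u; have a4 := normr_ge0 (v - u).
  set a := `|v - u| in a1 a2 a4 *; set b := `|u| in a2 a3 *; set c := `|v| in a2 *.
  have : a * c <= a * (a + b) by rewrite ler_wpM2l.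
  have : b * `|c - b| <= b * a by rewrite ler_wpM2l.
  lra.
apply: (le_trans h1).
rewrite -[u ^+ 2]real_normK ?num_real// -[(u - v) ^+ 2]real_normK ?num_real// (distrC u v).
set a := `|v - u|; set b := `|u|.
have : 0 <= K^-1 * (K * a - b) ^+ 2 by rewrite mulr_ge0 ?sqr_ge0// invr_ge0 ltW.
have -> : K^-1 * (K * a - b) ^+ 2 = K * a ^+ 2 - 2 * a * b + K^-1 * b ^+ 2.
  by field; rewrite gt_eqF.
lra.
Qed.

Let sqsum (v : ell2_vec R J) : fbounded (fun j => v j ^+ 2).
Proof.
apply: esum_fbounded => [j|]; first exact: sqr_ge0.
exact: ell2_summable.
Qed.

Let sqsumB (v w : ell2_vec R J) : fbounded (fun j => (v j - w j) ^+ 2).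
Proof.
apply: (@le_fbounded _ _ _ (fun j => 2 * v j ^+ 2 + 2 * w j ^+ 2)).
  by move=> j; have := sqr_ge0 (v j + w j); nra.
by apply: fboundedD; apply: fboundedZ.
Qed.

Lemma ell2_distE (v w : ell2_vec R J) :
  ell2_dist v w = Num.sqrt (tsum (fun j => (v j - w j) ^+ 2)).
Proof.
by rewrite /ell2_dist esum_tsum => [//|j|//]; exact: sqr_ge0.
Qed.

Lemma ell2_vec_ext (v w : ell2_vec R J) : (forall j, v j = w j) -> v = w.
Proof.
case: v w => [v pv] [w pw] /= /funext e; rewrite e in pv *.
by congr Ell2Vec; exact: Prop_irrelevance.
Qed.

Let root_summable (a : J -> R^o) : l1 a ->
  (\esum_(j in [set: J]) ((signed_sqrt (a j)) ^+ 2)%:E < +oo)%E.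
Proof.
move=> la; under eq_esum do rewrite signed_sqrt_sqr.
by rewrite esum_tsum// ltry.
Qed.

Let zero_summable : (\esum_(j in [set: J]) ((0 : R) ^+ 2)%:E < +oo)%E.
Proof. by rewrite esum1 ?ltry// => j _; rewrite expr0n. Qed.

Definition mazur (a : J -> R^o) : ell2_vec R J :=
  match pselect (l1 a) with
  | left la => Ell2Vec (root_summable la)
  | right _ => Ell2Vec zero_summable
  end.

Definition mazur_inv (v : ell2_vec R J) : J -> R^o := fun j => v j * `|v j|.

Lemma mazurE a j : l1 a -> mazur a j = signed_sqrt (a j).
Proof. by move=> la; rewrite /mazur; case: pselect. Qed.

Lemma mazur_inv_l1 v : l1 (mazur_inv v).
Proof.
rewrite /l1; have -> : (fun j => `|mazur_inv v j|) = (fun j => v j ^+ 2).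
  by apply/funext => j; rewrite /mazur_inv normrM normr_id -expr2 real_normK ?num_real.
exact: sqsum.
Qed.

Lemma mazur_homeo : mhomeo (@l1 R J) (ndist (@n1 R J)) [set: ell2_vec R J]
  (@ell2_dist R J) mazur mazur_inv.
Proof.
split; first split=> //.
- by move=> v _; exact: mazur_inv_l1.
- by move=> a la; apply/funext => j; rewrite /mazur_inv mazurE// signed_sqrtK.
- move=> v _; apply: ell2_vec_ext => j; rewrite mazurE; last exact: mazur_inv_l1.
  exact: signed_sqrKK.
split.
  move=> a e la e0; exists (e ^+ 2 / 3); first by rewrite divr_gt0// exprn_gt0.
  move=> b lb; rewrite /ndist ell2_distE => h.
  rewrite -(gtr0_norm e0) -sqrtr_sqr ltr_sqrt ?exprn_gt0//.
  apply: (@le_lt_trans _ _ (2 * n1 (b - a))); last by have := exprn_gt0 2 e0; lra.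
  have lB : l1 (b - a) by exact: (sn_memB (seminormed_l1 J)).
  rewrite /n1 -tsumZ//; apply: le_tsum; last exact: fboundedZ.
  by move=> j; rewrite !mazurE// -normrN opprB; exact: signed_sqrt_dist.
move=> v e _ e0.
pose U := tsum (fun j => v j ^+ 2).
have U0 : 0 <= U by apply: tsum_ge0; exact: sqsum.
(* This makes [K^-1 * U] at most e/2, whatever [w] is. *)
pose K := (2 * U + 1) / e.
have K0 : 0 < K by rewrite divr_gt0//; lra.
have d0 : 0 < e / (2 * (K + 1)) by rewrite divr_gt0//; lra.
exists (Num.sqrt (e / (2 * (K + 1)))); first by rewrite sqrtr_gt0.
move=> w _; rewrite ell2_distE ltr_sqrt// => h.
set D := tsum _ in h.
apply: (@le_lt_trans _ _ ((K + 1) * D + K^-1 * U)).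
  rewrite /D /U -!tsumZ//; try lra; last by rewrite invr_ge0 ltW.
  apply: le_trans (tsumD_le _ _); last 2 first.
  - by apply: fboundedZ => //; lra.
  - by apply: fboundedZ => //; rewrite invr_ge0 ltW.
  apply: le_tsum; last by apply: fboundedD; apply: fboundedZ => //; rewrite ?invr_ge0; lra.
  by move=> j; exact: signed_sqr_dist.
have h2 : (K + 1) * D < e / 2.
  rewrite mulrC -ltr_pdivlMr; last by lra.
  by apply: (lt_le_trans h); rewrite invfM mulrA.
have h3 : K^-1 * U <= e / 2.
  rewrite /K invf_div mulrAC ler_pdivrMr; last by lra.
  nra.
lra.
Qed.

End Mazur.

(** * The local model of the space of bounded maps *)

Section Metric.
Context {R : realType} (X : Type) (d : X -> X -> R).
Hypothesis md : is_metric d.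

Lemma is_metric_ge0 x y : 0 <= d x y. Proof. by case: md. Qed.
Lemma is_metric_sym x y : d x y = d y x. Proof. by case: md. Qed.
Lemma is_metric_tri x y z : d x z <= d x y + d y z. Proof. by case: md. Qed.
Lemma is_metric_refl x : d x x = 0. Proof. by case: md => _ H _ _; apply/H. Qed.
Lemma is_metric_eq0 x y : d x y = 0 -> x = y. Proof. by case: md => _ H _ _ /H. Qed.

Lemma is_metric_gt0 x y : x <> y -> 0 < d x y.
Proof.
move=> xy; rewrite lt0r is_metric_ge0 andbT; apply/eqP => /is_metric_eq0; exact: xy.
Qed.

Definition mclosed (C : set X) := dist_open d (~` C).

Lemma mclosedU (A B : set X) : mclosed A -> mclosed B -> mclosed (A `|` B).
Proof.
move=> cA cB x; rewrite setCU => -[/cA[a a0 aA] /cB[b b0 bB]].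
exists (Num.min a b); first by rewrite lt_min a0.
by move=> y; rewrite lt_min => /andP[/aA ? /bB ?].
Qed.

Lemma mclosedI (A B : set X) : mclosed A -> mclosed B -> mclosed (A `&` B).
Proof.
move=> cA cB x; rewrite setCI => -[/cA[a a0 aA]|/cB[b b0 bB]].
  by exists a => // y /aA; left.
by exists b => // y /bB; right.
Qed.

Lemma mclosed0 : mclosed set0.
Proof. by move=> x _; exists 1 => // y _ []. Qed.

Definition rcont (C : set X) (g : X -> R) := mcont C d (fun x y => `|y - x|) g.

End Metric.

(** * Hausdorff's extension of bounded continuous functions *)

Section HausdorffExtension.
Context {R : realType} (X : Type) (d : X -> X -> R).
Hypothesis md : is_metric d.
Variable C : set X.
Hypothesis clC : mclosed d C.

Definition dist_to (x : X) : R := inf [set d x c | c in C].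

Definition ext_term (g : X -> R) (x c : X) : R := g c + d x c / dist_to x - 1.

(** Points of [C] compete with a penalty measured relative to the distance to [C], so near [C] only
    values at nearby points matter. For empty [C] the infimum is 0 by default. *)
Definition hausdorff_ext (g : X -> R) (x : X) : R :=
  if `[< C x >] then g x else inf [set ext_term g x c | c in C].

Let dist_to_le x c : C c -> dist_to x <= d x c.
Proof.
move=> Cc; apply: ge_inf; last by exists c.
by exists 0 => _ [z _ <-]; exact: is_metric_ge0.
Qed.

Let dist_to_gt0 x c0 : C c0 -> ~ C x -> 0 < dist_to x.
Proof.
move=> Cc0 nCx; have [e e0 H] := clC nCx.
apply: lt_le_trans e0 _; apply: lb_le_inf; first by exists (d x c0), c0.
by move=> _ [c Cc <-]; rewrite leNgt; apply/negP => /H.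
Qed.

Let dist_to_lip x y c0 : C c0 -> dist_to x <= dist_to y + d x y.
Proof.
move=> Cc0; rewrite -lerBlDr; apply: lb_le_inf; first by exists (d y c0), c0.
move=> _ [c Cc <-]; rewrite lerBlDr addrC.
by apply: le_trans (dist_to_le x Cc) (is_metric_tri md x y c).
Qed.

Let term_ge g x c (B : R) : C c -> ~ C x -> `|g c| <= B -> - B <= ext_term g x c.
Proof.
move=> Cc nCx; rewrite ler_norml => /andP[gB _].
have : 1 <= d x c / dist_to x.
  by rewrite ler_pdivlMr ?mul1r; [exact: dist_to_le|exact: (dist_to_gt0 Cc)].
by rewrite /ext_term; lra.
Qed.

Let ext_le_term g x c (B : R) : (forall z, C z -> `|g z| <= B) -> C c -> ~ C x ->
  hausdorff_ext g x <= ext_term g x c.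
Proof.
move=> gB Cc nCx; rewrite /hausdorff_ext asboolF//; apply: ge_inf; last by exists c.
by exists (- B) => _ [z Cz <-]; apply: term_ge => //; exact: gB.
Qed.

Let ext_ge g x (m : R) c0 : C c0 -> ~ C x -> (forall c, C c -> m <= ext_term g x c) ->
  m <= hausdorff_ext g x.
Proof.
move=> Cc0 nCx H; rewrite /hausdorff_ext asboolF//; apply: lb_le_inf.
  by exists (ext_term g x c0), c0.
by move=> _ [c Cc <-]; exact: H.
Qed.

Lemma hausdorff_extE g x : C x -> hausdorff_ext g x = g x.
Proof. by move=> Cx; rewrite /hausdorff_ext asboolT. Qed.

Let ext_empty g x : ~ (exists c, C c) -> hausdorff_ext g x = 0.
Proof.
move=> nC; rewrite /hausdorff_ext asboolF; last by move=> Cx; apply: nC; exists x.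
have -> : [set ext_term g x c | c in C] = set0.
  by rewrite -subset0 => y [c Cc _]; apply: nC; exists c.
exact: inf0.
Qed.

Let ext_near g x (B e : R) c0 : (forall z, C z -> `|g z| <= B) -> C c0 -> ~ C x ->
  0 < e -> exists2 c, C c & ext_term g x c < hausdorff_ext g x + e.
Proof.
move=> gB Cc0 nCx e0; apply: contrapT => H.
have : hausdorff_ext g x + e <= hausdorff_ext g x.
  apply: (ext_ge Cc0) => // c Cc; rewrite leNgt; apply/negP => lt.
  by apply: H; exists c.
by lra.
Qed.

Let ext_dist_half g g' (B B' e : R) x : (forall z, C z -> `|g z| <= B) ->
  (forall z, C z -> `|g' z| <= B') ->
  0 <= e -> (forall z, C z -> `|g z - g' z| <= e) ->
  hausdorff_ext g x - hausdorff_ext g' x <= e.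
Proof.
move=> gB g'B e0 gg'; have [Cx|nCx] := pselect (C x).
  by rewrite !hausdorff_extE//; have := gg' _ Cx; rewrite ler_norml => /andP[].
have [[c0 Cc0]|nC] := pselect (exists c, C c); last by rewrite !ext_empty// subrr.
rewrite lerBlDl -lerBlDr; apply: (ext_ge Cc0) => // c Cc.
have := ext_le_term gB Cc nCx; have := gg' _ Cc.
by rewrite ler_norml /ext_term => /andP[_]; lra.
Qed.

(** Every term of the infimum moves by at most [e] while the penalties stay fixed. *)
Lemma hausdorff_ext_dist g g' (B B' e : R) x : (forall z, C z -> `|g z| <= B) ->
  (forall z, C z -> `|g' z| <= B') ->
  0 <= e -> (forall z, C z -> `|g z - g' z| <= e) ->
  `|hausdorff_ext g x - hausdorff_ext g' x| <= e.
Proof.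
move=> gB g'B e0 gg'; rewrite ler_norml (ext_dist_half x gB g'B e0 gg') andbT.
rewrite lerNl opprB; apply: (ext_dist_half x g'B gB e0) => z Cz.
by rewrite distrC gg'.
Qed.

Let ext0 x : hausdorff_ext (fun=> 0) x = 0.
Proof.
have [Cx|nCx] := pselect (C x); first by rewrite hausdorff_extE.
have [[c0 Cc0]|nC] := pselect (exists c, C c); last by rewrite ext_empty.
have a0 := dist_to_gt0 Cc0 nCx.
have zB z : C z -> `|(fun=> 0 : R) z| <= 0 by rewrite normr0.
apply/eqP; rewrite eq_le; apply/andP; split; last first.
  apply: (ext_ge Cc0) => // c Cc.
  by have := term_ge (g := fun=> 0) Cc nCx (zB _ Cc); rewrite oppr0.
apply/ler_addgt0Pr => e e0; rewrite add0r.
have ae : 0 < e * dist_to x by rewrite mulr_gt0.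
have hi : has_inf [set d x c | c in C].
  split; first by exists (d x c0), c0.
  by exists 0 => _ [c _ <-]; exact: is_metric_ge0.
have [_ [c Cc <-]] := inf_adherent ae hi; rewrite -/(dist_to x) => dc.
apply: (le_trans (ext_le_term zB Cc nCx)); rewrite /ext_term add0r.
rewrite lerBlDr ler_pdivrMr// mulrDl mul1r.
by rewrite addrC; exact: ltW.
Qed.

Lemma hausdorff_ext_norm g (B : R) x : 0 <= B -> (forall z, C z -> `|g z| <= B) ->
  `|hausdorff_ext g x| <= B.
Proof.
move=> B0 gB; rewrite -[hausdorff_ext g x]subr0 -{1}(ext0 x).
apply: (hausdorff_ext_dist x gB (B' := 0)) => // z Cz; first by rewrite normr0.
by rewrite subr0; exact: gB.
Qed.

Let ratio_diff x y c (M : R) : C c -> ~ C x -> ~ C y -> d x c <= M * dist_to x ->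
  d y c / dist_to y - d x c / dist_to x <= d x y * (1 + M) / dist_to y.
Proof.
move=> Cc nCx nCy dM; have ax := dist_to_gt0 Cc nCx; have ay := dist_to_gt0 Cc nCy.
have t0 := is_metric_ge0 md x y.
have h1 := is_metric_tri md y x c; have h2 := dist_to_lip x y Cc.
rewrite (is_metric_sym md y x) in h1.
rewrite ler_pdivlMr//.
have -> : (d y c / dist_to y - d x c / dist_to x) * dist_to y =
    (d y c - d x c) + (d x c / dist_to x) * (dist_to x - dist_to y).
  by field; rewrite !gt_eqF.
have q0 : 0 <= d x c / dist_to x by rewrite divr_ge0 ?is_metric_ge0// ltW.
have qM : d x c / dist_to x <= M by rewrite ler_pdivrMr.
rewrite [leRHS]mulrDr mulr1; apply: lerD; first by lra.
apply: (@le_trans _ _ (d x c / dist_to x * d x y)).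
  by rewrite ler_wpM2l//; lra.
by rewrite mulrC ler_wpM2l.
Qed.

(** At a point of [C] the penalty excludes distant competitors. Off [C] a nearly optimal competitor
    lies within a fixed multiple of the distance to [C], and for those the relative penalty varies
    continuously, uniformly in the competitor. *)
Lemma hausdorff_ext_cont g (B : R) : (forall z, C z -> `|g z| <= B) ->
  rcont d C g -> rcont d setT (hausdorff_ext g).
Proof.
move=> gB' gc x e _ e0.
have [[c0 Cc0]|nC] := pselect (exists c, C c); last first.
  by exists 1 => // y _ _; rewrite !ext_empty// subrr normr0.
have B0 : 0 <= B by apply: le_trans (gB' _ Cc0).
have gB := gB'; have eB := hausdorff_ext_norm _ B0 gB.
have e20 : 0 < e / 2 by rewrite divr_gt0.
have [Cx|nCx] := pselect (C x).
  rewrite hausdorff_extE//.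
  have [eta eta0 H] := gc _ _ Cx e20.
  pose e' := Num.min 1 (e / 4).
  have e'0 : 0 < e' by rewrite lt_min ltr01 divr_gt0.
  have e'1 : e' <= 1 by rewrite ge_min lexx.
  have e'e : e' <= e / 4 by rewrite ge_min lexx orbT.
  (* If [c] is at least [eta] away from [x], then d(y, c) is at least 2B + 3 times d(x, y), so at
     least 2B + 1 times the distance from [y] to [C]: the penalty, at least 2B, outweighs any gain
     in [g]. *)
  have k0 : 0 < eta / (2 * B + 4) by rewrite divr_gt0//; lra.
  exists (eta / (2 * B + 4)) => // y _; rewrite ltr_pdivlMr; last by lra.
  move=> t.
  have t0 := is_metric_ge0 md x y.
  have tB : 0 <= d x y * B by rewrite mulr_ge0.
  have [Cy|nCy] := pselect (C y).
    rewrite hausdorff_extE//; apply: lt_le_trans (H _ Cy _) _; last by lra.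
    by lra.
  have ay := dist_to_gt0 Cx nCy.
  have ayt : dist_to y <= d x y by rewrite (is_metric_sym md x y); exact: dist_to_le.
  have upper : hausdorff_ext g y <= g x + e / 2 + e'.
    have [c Cc] : exists2 c, C c & d y c <= (1 + e') * dist_to y.
      have ae : 0 < e' * dist_to y by rewrite mulr_gt0.
      have hi : has_inf [set d y c | c in C].
        split; first by exists (d y c0), c0.
        by exists 0 => _ [c _ <-]; exact: is_metric_ge0.
      have [_ [c Cc <-]] := inf_adherent ae hi; rewrite -/(dist_to y) => dc.
      by exists c => //; rewrite mulrDl mul1r ltW.
    move=> dc; apply: (le_trans (ext_le_term gB Cc nCy)).
    have xc : d x c < eta.
      have := is_metric_tri md x y c.
      have : e' * dist_to y <= 1 * d x y by rewrite ler_pM// ltW.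
      by lra.
    have := H _ Cc xc; rewrite ltr_norml => /andP[_ gc'].
    have : d y c / dist_to y <= 1 + e' by rewrite ler_pdivrMr.
    by rewrite /ext_term; lra.
  have lower : g x - e / 2 <= hausdorff_ext g y.
    apply: (ext_ge Cc0) => // c Cc.
    have r1 : 1 <= d y c / dist_to y by rewrite ler_pdivlMr// mul1r dist_to_le.
    have [xc|xc] := ltP (d x c) eta.
      have := H _ Cc xc; rewrite ltr_norml => /andP[gc' _].
      by rewrite /ext_term; lra.
    have : 2 * B + 1 <= d y c / dist_to y.
      rewrite ler_pdivlMr//.
      have := is_metric_tri md x y c.
      have : (2 * B + 1) * dist_to y <= (2 * B + 1) * d x y.
        by rewrite ler_wpM2l//; lra.
      by lra.
    have := gB _ Cc; have := gB _ Cx; rewrite !ler_norml /ext_term => /andP[_ ?] /andP[? _].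
    by lra.
  by rewrite ltr_norml; apply/andP; split; lra.
have ax := dist_to_gt0 Cc0 nCx.
(* For a competitor optimal up to 1 the ratio of distances is at most B + B + 1 + 1. *)
pose M := 2 * B + 2.
have M0 : 0 < M by rewrite /M; lra.
pose e' := Num.min 1 (e / 4).
have e'0 : 0 < e' by rewrite lt_min ltr01 divr_gt0.
have e'1 : e' <= 1 by rewrite ge_min lexx.
have e'e : e' <= e / 4 by rewrite ge_min lexx orbT.
have nearopt y c : C c -> ~ C y -> ext_term g y c < hausdorff_ext g y + e' ->
    d y c <= M * dist_to y.
  move=> Cc nCy; rewrite /ext_term => h; rewrite -ler_pdivrMr; last exact: (dist_to_gt0 Cc).
  have := gB _ Cc; have := eB y; rewrite !ler_norml /M => /andP[_ ?] /andP[? _].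
  by lra.
exists (Num.min (dist_to x / 2) (e / 4 * dist_to x / (2 * (1 + M)))).
  rewrite lt_min divr_gt0//= divr_gt0// ?mulr_gt0// ?divr_gt0//; lra.
move=> y _; rewrite lt_min => /andP[t1]; rewrite ltr_pdivlMr; last by lra.
move=> t2; have t0 := is_metric_ge0 md x y.
have hl := dist_to_lip x y Cc0.
have nCy : ~ C y.
  move=> Cy; have := dist_to_le x Cy; by lra.
have ay2 : dist_to x / 2 <= dist_to y by lra.
have ay : 0 < dist_to y by lra.
have step : forall a : R, dist_to x / 2 <= a -> d x y * (1 + M) / a <= e / 4.
  move=> a ha; have a0 : 0 < a by lra.
  rewrite ler_pdivrMr//; apply: (@le_trans _ _ (e / 4 * (dist_to x / 2))).
    by lra.
  by rewrite ler_wpM2l//; lra.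
have one a b : ~ C a -> ~ C b -> dist_to x / 2 <= dist_to b -> d a b = d x y ->
    hausdorff_ext g b <= hausdorff_ext g a + e' + e / 4.
  move=> nCa nCb hb ab; have [c Cc hc] := ext_near gB Cc0 nCa e'0.
  have := ext_le_term gB Cc nCb.
  have := ratio_diff Cc nCa nCb (nearopt _ _ Cc nCa hc).
  have := step _ hb; rewrite ab; move: hc; rewrite /ext_term; lra.
have h1 := one x y nCx nCy ay2 erefl.
have h2 := one y x nCy nCx _ (is_metric_sym md y x).
have {}h2 := h2 ltac:(lra).
by rewrite ltr_norml; apply/andP; split; lra.
Qed.

End HausdorffExtension.

(** * Locally finite sequences in noncompact separable metric spaces *)

Section NoncompactSequence.
Context {R : realType} (X : topologicalType) (d : X -> X -> R).
Hypothesis md : is_metric d.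
Hypothesis openE : forall U : set X, open U <-> dist_open d U.
Variable D : set X.
Hypothesis countD : countable D.
Hypothesis denseD : dense D.
Hypothesis noncompactX : ~ compact [set: X].

Lemma metric_ball_open x (e : R) : open [set y | d x y < e].
Proof.
apply/openE => y /= xy; exists (e - d x y); first by lra.
by move=> z yz /=; have := is_metric_tri md x y z; lra.
Qed.

Lemma dense_near x (e : R) : 0 < e -> exists2 c, D c & d x c < e.
Proof.
move=> e0; have [|c [/= xc Dc]] := denseD _ (metric_ball_open x e).
  by exists x => /=; rewrite (is_metric_refl md).
by exists c.
Qed.

Lemma countable_code : exists f : X -> nat, {in D &, injective f}.
Proof. by move/countable_injP: countD. Qed.

Lemma inv_nat_lt (e : R) : 0 < e -> exists j : nat, j.+1%:R^-1 < e.
Proof.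
move=> e0; exists (Num.truncn e^-1).
by rewrite invf_plt ?posrE//; exact: truncnS_gt.
Qed.

(** Take a filter without cluster points. Countably many balls with complement in the filter cover
    [X], and the filter contains the complement of any finite union of them, so [e n] can be chosen
    outside all balls of index at most [n]. Each [x] has a neighbourhood inside one ball, which the
    sequence eventually leaves. *)
Lemma locally_finite_seq : exists e : nat -> X, forall x,
  exists2 eta, 0 < eta & exists M, forall n, (M <= n)%N -> eta <= d x (e n).
Proof.
have [f finj] := countable_code.
have [F FF noclus] : exists2 F : set_system X, ProperFilter F & forall x, ~ cluster F x.
  apply: contrapT => H; apply: noncompactX => F FF _; apply: contrapT => nx.
  by apply: H; exists F => // x Fx; apply: nx; exists x.
pose ballj (c : X) (j : nat) : set X := [set x | d c x < j.+1%:R^-1].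
(* [B N] is a single ball or empty, as the centre and the radius are recovered from [N]. *)
pose B (N : nat) : set X := [set x | exists c j, [/\ D c, N = choice.pickle (f c, j),
   F (~` ballj c j) & ballj c j x]].
have Bcov x : exists N, exists2 eta, 0 < eta & forall y, d x y < eta -> B N y.
  have [A [U [FA Ux AU]]] : exists A U, [/\ F A, nbhs x U & A `&` U = set0].
    apply: contrapT => H; apply: (noclus x) => A U FA Ux.
    by apply/set0P/negP => /eqP AU; apply: H; exists A, U.
  have [V [[Vo Vx] VU]] : exists V, open_nbhs x V /\ V `<=` U by move: Ux; rewrite nbhsE => -[V ? ?]; exists V.
  have [e e0 He] := (openE _).1 Vo _ Vx.
  have e20 : 0 < e / 2 by rewrite divr_gt0.
  have [j je] := inv_nat_lt e20.
  have j0 : 0 < j.+1%:R^-1 :> R by rewrite invr_gt0.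
  have [c Dc xc] := dense_near x j0.
  have cx : d c x < j.+1%:R^-1 by rewrite (is_metric_sym md).
  exists (choice.pickle (f c, j)), (j.+1%:R^-1 - d c x); first by rewrite subr_gt0.
  move=> y xy; exists c, j; split => //.
    apply: filterS FA => z Az cz; have : (A `&` U) z; last by rewrite AU.
    split=> //; apply/VU/He; have := is_metric_tri md x c z.
    by move: (lt_trans xc je) (lt_trans cz je); lra.
  by apply: (le_lt_trans (is_metric_tri md c x y)); rewrite -ltrBrDl.
have FB N : F (~` B N).
  have [[x [c [j [Dc NE Fc cx]]]]|nB] := pselect (exists x, B N x); last first.
    by apply: filterE => x Bx; apply: nB; exists x.
  apply: filterS Fc => y ncy [c' [j' [Dc' NE' _ cy]]]; apply: ncy.
  move: NE'; rewrite NE => /(pcan_inj choice.pickleK) [fc jj].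
  have cc : c = c' by apply: finj => //; rewrite inE.
  by rewrite cc jj.
have /choice[e eP] : forall n : nat, exists x, forall N, (N <= n)%N -> ~ B N x.
  move=> n; apply: (@filter_ex _ F FF).
  elim: n => [|n IH].
    by apply: filterS (FB 0%N) => x nB N; rewrite leqn0 => /eqP ->.
  apply: filterS (filterI IH (FB n.+1)) => x [h1 h2] N.
  by rewrite leq_eqVlt => /orP[/eqP -> //|]; exact: h1.
exists e => x; have [N [eta eta0 H]] := Bcov x.
exists eta => //; exists N => n Nn; rewrite leNgt; apply/negP => /H.
exact: eP.
Qed.

End NoncompactSequence.

Section SupNorm.
Context {R : realType} (I : Type).
Implicit Types g h : I -> R^o.

Definition sup_bounded h := exists M : R, forall p, `|h p| <= M.

Definition sup_norm h : R := sup [set y | y = 0 \/ exists p, y = `|h p|].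

Lemma sup_norm_le h (M : R) : 0 <= M -> (forall p, `|h p| <= M) -> sup_norm h <= M.
Proof.
by move=> M0 hM; apply: ge_sup; [exists 0; left|move=> _ [->//|[p ->]]].
Qed.

Let hub h : sup_bounded h -> has_ubound [set y | y = 0 \/ exists p, y = `|h p|].
Proof.
move=> [M hM]; exists (Num.max 0 M) => _ [->|[p ->]]; first by rewrite le_max lexx.
by rewrite le_max hM orbT.
Qed.

Lemma sup_norm_ub h p : sup_bounded h -> `|h p| <= sup_norm h.
Proof. by move=> hb; apply: ub_le_sup; [exact: hub|right; exists p]. Qed.

Lemma sup_norm_ge0 h : sup_bounded h -> 0 <= sup_norm h.
Proof. by move=> hb; apply: ub_le_sup; [exact: hub|left]. Qed.

Lemma banach_sup (P : set (I -> R^o)) : P `<=` sup_bounded -> P 0 ->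
  (forall g h, P g -> P h -> P (g + h)) ->
  (forall (a : R) h, P h -> P (a *: h)) ->
  (forall h, sup_bounded h -> (forall e : R, 0 < e ->
    exists2 g, P g & forall p, `|h p - g p| <= e) -> P h) ->
  banach P sup_norm.
Proof.
move=> Pb P0 PD PZ Pl.
have sP : seminormed P sup_norm.
  split=> //.
  - by move=> h /Pb; exact: sup_norm_ge0.
  - move=> g h /Pb gb /Pb hb; apply: sup_norm_le.
      by rewrite addr_ge0// sup_norm_ge0.
    move=> p; apply: (le_trans (ler_normD _ _)).
    by rewrite lerD// sup_norm_ub.
  - have le a h : P h -> sup_norm (a *: h) <= `|a| * sup_norm h.
      move=> /Pb hb; apply: sup_norm_le; first by rewrite mulr_ge0// sup_norm_ge0.
      move=> p; rewrite [(a *: h) p]/(a * h p) normrM.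
      by rewrite ler_wpM2l// sup_norm_ub.
    move=> a h Ph; apply/eqP; rewrite eq_le le//=.
    have [->|a0] := eqVneq a 0.
      by rewrite normr0 mul0r sup_norm_ge0//; exact/Pb/PZ.
    have := le a^-1 (a *: h) (PZ _ _ Ph).
    by rewrite scalerA mulVf// scale1r normfV -ler_pdivrMl ?invr_gt0 ?normr_gt0// invrK.
split=> //.
  move=> h /Pb hb h0; apply/funext => p; apply/normr0_eq0/eqP.
  by rewrite eq_le normr_ge0 -h0 sup_norm_ub.
move=> u Pu uC.
have PB m k : P (u m - u k) by apply: (sn_memB sP).
have /choice[l lP] : forall p, exists x : R, forall e : R, 0 < e ->
    exists M, forall m, (M <= m)%N -> `|u m p - x| < e.
  move=> p; have [||x _ xP] := banach_complete (@banach_real R) (u := fun n => u n p) => //.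
    move=> e /uC[M ME]; exists M => m k Mm Mk.
    by apply: le_lt_trans (ME _ _ Mm Mk); exact: (sup_norm_ub p (Pb _ (PB m k))).
  by exists x.
have key (e : R) M m p : (forall k, (M <= k)%N -> sup_norm (u m - u k) <= e) -> `|u m p - l p| <= e.
  move=> H; apply/ler_addgt0Pr => r r0; have [K KP] := lP p _ r0.
  have h1 := KP _ (leq_maxl K M); have h2 := H _ (leq_maxr K M).
  have h3 := sup_norm_ub p (Pb _ (PB m (maxn K M))).
  have := ler_distD (u (maxn K M) p) (u m p) (l p).
  have : `|u m p - u (maxn K M) p| <= e by apply: le_trans h2.
  lra.
have lb : sup_bounded l.
  have [M ME] := uC 1 ltr01.
  exists (sup_norm (u M) + 1) => p.
  have h1 : `|u M p - l p| <= 1 by apply: (key _ M) => k Mk; apply/ltW/ME.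
  have h2 := sup_norm_ub p (Pb _ (Pu M)).
  have := ler_normB (u M p) (u M p - l p); rewrite opprB addrC subrK; lra.
have near (e : R) : 0 < e -> exists M, forall m p, (M <= m)%N -> `|u m p - l p| <= e.
  move=> /uC[M ME]; exists M => m p Mm; apply: (key _ M) => k Mk; exact/ltW/ME.
have Pl' : P l.
  apply: Pl => // e e0; have [M MP] := near _ e0.
  by exists (u M) => // p; rewrite distrC MP.
exists l => // e e0; have e20 : 0 < e / 2 by rewrite divr_gt0.
have [M MP] := near _ e20; exists M => m Mm.
apply: (@le_lt_trans _ _ (e / 2)); last by lra.
by apply: sup_norm_le => [|p]; [exact: ltW|exact: MP].
Qed.

End SupNorm.

Lemma fin_min (R : realType) (I : finType) (f : I -> R) : (forall i, 0 < f i) ->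
  exists2 d, 0 < d & forall i, d <= f i.
Proof.
move=> f0; exists (\big[Num.min/1]_i f i); first by apply: lt_bigmin.
by move=> i; apply: bigmin_le_cond.
Qed.

Lemma hausdorff_ext_eq (R : realType) (X : Type) (d : X -> X -> R) (C : set X)
  (g g' : X -> R) x : (forall z, C z -> g z = g' z) ->
  hausdorff_ext d C g x = hausdorff_ext d C g' x.
Proof.
move=> gg'; rewrite /hausdorff_ext; case: asboolP => [/gg'//|_].
congr inf; apply/seteqP; split=> _ [c Cc <-]; exists c => //; by rewrite /ext_term gg'.
Qed.

Section Gluing.
Context {R : realType} (X Y : Type) (dX : X -> X -> R) (dY : Y -> Y -> R).

(** A point outside a closed piece has a neighbourhood missing it, so that piece imposes nothing
    there. *)
Lemma mcont_glue (A B : set X) (f : X -> Y) : mclosed dX A -> mclosed dX B ->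
  mcont A dX dY f -> mcont B dX dY f -> mcont (A `|` B) dX dY f.
Proof.
have side (C : set X) : mclosed dX C -> mcont C dX dY f -> forall x (e : R), 0 < e ->
    exists2 d, 0 < d & forall y, C y -> C x \/ ~ C x -> dX x y < d -> dY (f x) (f y) < e.
  move=> cC fC x e e0; have [Cx|nCx] := pselect (C x).
    by have [d d0 H] := fC _ _ Cx e0; exists d => // y Cy _; exact: H.
  by have [d d0 H] := cC _ nCx; exists d => // y Cy _ /H.
move=> cA cB fA fB x e _ e0.
have [d d0 H] := side _ cA fA x _ e0; have [d' d'0 H'] := side _ cB fB x _ e0.
exists (Num.min d d'); first by rewrite lt_min d0.
move=> y ABy; rewrite lt_min => /andP[h h'].
case: ABy => [Ay|By]; first by apply: H => //; exact: EM.
by apply: H' => //; exact: EM.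
Qed.

Lemma mcont_eq (A : set X) (f g : X -> Y) : (forall x, A x -> f x = g x) ->
  mcont A dX dY f -> mcont A dX dY g.
Proof.
move=> fg fA x e Ax e0; have [d d0 H] := fA _ _ Ax e0; exists d => // y Ay /(H _ Ay).
by rewrite !fg.
Qed.

End Gluing.

Section RealCont.
Context {R : realType} (X : Type) (dX : X -> X -> R).

Lemma rcontD (A : set X) (f g : X -> R) : rcont dX A f -> rcont dX A g ->
  rcont dX A (fun x => f x + g x).
Proof.
by apply: (@mcontD _ _ A dX R^o setT (fun x : R => `|x|) f g (banach_sn (@banach_real R))).
Qed.

Lemma rcontB (A : set X) (f g : X -> R) : rcont dX A f -> rcont dX A g ->
  rcont dX A (fun x => f x - g x).
Proof.
by apply: (@mcontB _ _ A dX R^o setT (fun x : R => `|x|) f g (banach_sn (@banach_real R))).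
Qed.

End RealCont.

(** * Maps near [f0] as functions on cells *)

Section LocalModel.
Context {R : realType} (X Y : Type) (dX : X -> X -> R) (dY : Y -> Y -> R) (n : nat).
Hypotheses (mX : is_metric dX) (mY : is_metric dY).
Variables (f0 : X -> Y) (m : nat) (C : nat -> set X).
Variables (phi : nat -> Y -> 'I_n -> R) (psi : nat -> ('I_n -> R) -> Y) (L e0 r0 : R).
Hypothesis f0_cont : mcont setT dX dY f0.
Hypotheses (L1 : 1 <= L) (e0_gt0 : 0 < e0) (r0_gt0 : 0 < r0).
Hypothesis C_closed : forall k, mclosed dX (C k).
Hypothesis C_cover : forall x, exists2 k, (k < m)%N & C k x.
Hypothesis phi_lip : forall k x y z i, (k < m)%N -> C k x ->
  dY (f0 x) y < e0 -> dY (f0 x) z < e0 -> `|phi k y i - phi k z i| <= L * dY y z.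
Hypothesis phiK : forall k x y, (k < m)%N -> C k x -> dY (f0 x) y < e0 ->
  psi k (phi k y) = y.
Hypothesis psiK : forall k x u i, (k < m)%N -> C k x ->
  (forall i, `|u i - phi k (f0 x) i| < r0) -> phi k (psi k u) i = u i.
Hypothesis psi_lip : forall k x u v (c : R), (k < m)%N -> C k x ->
  (forall i, `|u i - phi k (f0 x) i| < r0) -> (forall i, `|v i - phi k (f0 x) i| < r0) ->
  (forall i, `|u i - v i| <= c) -> 0 <= c -> dY (psi k u) (psi k v) <= L * c.

Definition prev_cells (k : nat) : set X := [set x | exists2 j, (j < k)%N & C j x].
Definition overlap (k : nat) : set X := C k `&` prev_cells k.

(** Continuity is asked on the whole closed cell, while the values vanish on what earlier cells
    cover. Data on different cells are thereby independent, and no nonlinear compatibility condition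
    remains. *)
Definition cell_maps : set (nat * X * 'I_n -> R^o) := [set h | [/\ sup_bounded h,
  forall k x i, ~ [/\ (k < m)%N, C k x & ~ prev_cells k x] -> h (k, x, i) = 0 &
  forall k i, rcont dX (C k) (fun x => h (k, x, i))]].

Local Notation ext k := (hausdorff_ext dX (overlap k)).

Lemma prev_cells_closed k : mclosed dX (prev_cells k).
Proof.
elim: k => [|k IH].
  rewrite (_ : prev_cells 0 = set0); first exact: (@mclosed0 R X dX).
  by rewrite -subset0 => x [j].
rewrite (_ : prev_cells k.+1 = prev_cells k `|` C k); first exact: mclosedU.
apply/seteqP; split=> x.
  move=> [j]; rewrite ltnS leq_eqVlt => /orP[/eqP ->|jk] Cj; first by right.
  by left; exists j.
by move=> [[j jk Cj]|Ck]; [exists j => //; exact: ltnW|exists k].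
Qed.

Lemma overlap_closed k : mclosed dX (overlap k).
Proof. by apply: mclosedI => //; exact: prev_cells_closed. Qed.

Lemma banach_cell_maps : banach cell_maps (@sup_norm R _).
Proof.
apply: banach_sup.
- by move=> h [].
- split=> //; first by exists 0 => p; rewrite normr0.
  by move=> k i x e _ e0'; exists 1 => // y _ _; rewrite subrr normr0.
- move=> g h [[M gM] g0 gc] [[K hK] h0 hc]; split.
  + by exists (M + K) => p; apply: (le_trans (ler_normD _ _)); rewrite lerD.
  + move=> k x i nk; have -> : (g + h) (k, x, i) = g (k, x, i) + h (k, x, i) by [].
    by rewrite g0// h0// addr0.
  + by move=> k i; apply: rcontD.
- move=> a h [[K hK] h0 hc]; split.
  + by exists (`|a| * K) => p; rewrite [(a *: h) p]/(a * h p) normrM ler_wpM2l.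
  + move=> k x i nk; have -> : (a *: h) (k, x, i) = a * h (k, x, i) by [].
    by rewrite h0// mulr0.
  + move=> k i x e Cx e_gt0.
    have e'0 : 0 < e / (`|a| + 1) by rewrite divr_gt0// ltr_wpDl.
    have [d d0 H] := hc k i x _ Cx e'0; exists d => // y Cy /(H _ Cy).
    rewrite ltr_pdivlMr ?ltr_wpDl// => h1.
    have -> : (a *: h) (k, y, i) - (a *: h) (k, x, i) = a * (h (k, y, i) - h (k, x, i)).
      by rewrite mulrBr.
    rewrite normrM.
    by apply: le_lt_trans h1; rewrite mulrC ler_wpM2l// lerDl.
- move=> h hb H; split=> //.
  + move=> k x i nk; apply/normr0_eq0/eqP; rewrite eq_le normr_ge0 andbT.
    apply/ler_addgt0Pr => e e_gt0; rewrite add0r.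
    have [g [_ g0 _] /(_ (k, x, i))] := H _ e_gt0.
    by rewrite g0// subr0.
  + move=> k i x e Cx e_gt0; have e40 : 0 < e / 4 by rewrite divr_gt0.
    have [g [_ _ gc] hg] := H _ e40.
    have e20 : 0 < e / 2 by rewrite divr_gt0.
    have [d d0 D] := gc k i x _ Cx e20; exists d => // y Cy /(D _ Cy).
    have := hg (k, x, i); have := hg (k, y, i).
    have := ler_distD (g (k, y, i)) (h (k, y, i)) (h (k, x, i)).
    have := ler_distD (g (k, x, i)) (g (k, y, i)) (h (k, x, i)).
    by rewrite (distrC (g (k, x, i)) (h _)); lra.
Qed.

Definition displ (f : X -> Y) (k : nat) (i : 'I_n) (x : X) : R :=
  phi k (f x) i - phi k (f0 x) i.

(* On the cell [C k] the displacement of [f] is only recorded modulo what the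
   earlier cells determine, so that the image is a linear space of functions. *)
Definition to_cells (f : X -> Y) : nat * X * 'I_n -> R^o := fun p =>
  let: (k, x, i) := p in
  if `[< (k < m)%N /\ C k x >] then displ f k i x - ext k (displ f k i) x else 0.

Let L0 : 0 <= L. Proof. exact: le_trans L1. Qed.

Let f0_near x : dY (f0 x) (f0 x) < e0.
Proof. by rewrite (is_metric_refl mY). Qed.

Lemma displ_norm f k i x (b : R) : (k < m)%N -> C k x -> dY (f0 x) (f x) <= b ->
  b < e0 -> `|displ f k i x| <= L * b.
Proof.
move=> km Cx fb be; apply: (le_trans (phi_lip i km Cx (le_lt_trans fb be) (f0_near x))).
by rewrite ler_wpM2l// (is_metric_sym mY).
Qed.

Lemma chart_cont (S : set X) (f : X -> Y) k i (b : R) : (k < m)%N -> S `<=` C k ->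
  b < e0 -> (forall x, S x -> dY (f0 x) (f x) <= b) -> mcont S dX dY f ->
  rcont dX S (fun x => phi k (f x) i).
Proof.
move=> km SC be fb fc x e Sx e_gt0.
have d_gt0 : 0 < Num.min (e0 - b) (e / (L + 1)).
  by rewrite lt_min subr_gt0 be/= divr_gt0// ltr_wpDl.
have [d d0 H] := fc _ _ Sx d_gt0; exists d => // y Sy /(H _ Sy).
rewrite lt_min => /andP[h1]; rewrite ltr_pdivlMr ?ltr_wpDl// => h2.
have xb := fb _ Sx; have t0 := is_metric_ge0 mY (f x) (f y).
have ny : dY (f0 x) (f y) < e0.
  by have := is_metric_tri mY (f0 x) (f x) (f y); lra.
have nx : dY (f0 x) (f x) < e0 by lra.
apply: (le_lt_trans (phi_lip i km (SC _ Sx) ny nx)).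
by rewrite (is_metric_sym mY); lra.
Qed.

Lemma displ_cont (S : set X) (f : X -> Y) k i (b : R) : (k < m)%N -> S `<=` C k ->
  b < e0 -> (forall x, S x -> dY (f0 x) (f x) <= b) -> mcont S dX dY f ->
  rcont dX S (displ f k i).
Proof.
move=> km SC be fb fc; apply: rcontB; first exact: (chart_cont i km SC be).
apply: (chart_cont i (b := 0) km SC e0_gt0).
  by move=> x _; rewrite (is_metric_refl mY).
by apply: mcont_sub f0_cont.
Qed.

Let overlapC k : overlap k `<=` C k. Proof. by move=> x []. Qed.

(** On the overlap the extension equals the displacement, so 0 is recorded there. Displacement and
    extension are at most [L * b] each, whence the factor 2. *)
Lemma to_cells_mem f (b : R) : mcont setT dX dY f -> 0 <= b -> b < e0 ->
  (forall x, dY (f0 x) (f x) <= b) ->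
  cell_maps (to_cells f) /\ forall p, `|to_cells f p| <= 2 * L * b.
Proof.
move=> fc b0 be fb.
have dn k i x : (k < m)%N -> C k x -> `|displ f k i x| <= L * b.
  by move=> km Cx; apply: displ_norm.
have Lb : 0 <= L * b by rewrite mulr_ge0.
have bound p : `|to_cells f p| <= 2 * L * b.
  case: p => [[k x] i] /=; case: asboolP => [[km Cx]|_]; last first.
    by rewrite normr0 -mulrA mulr_ge0.
  apply: (le_trans (ler_normB _ _)).
  have h1 := dn _ i _ km Cx.
  have : `|ext k (displ f k i) x| <= L * b.
    by apply: (hausdorff_ext_norm mX (@overlap_closed k) x) => // z [Cz _]; exact: dn.
  by lra.
split=> //; split; first by exists (2 * L * b).
  move=> k x i nk /=; case: asboolP => // -[km Cx].
  rewrite hausdorff_extE ?subrr//; split=> //.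
  by apply: contrapT => np; apply: nk.
move=> k i; have [km|km] := pselect (k < m)%N; last first.
  move=> x e _ e_gt0; exists 1 => // y _ _ /=.
  by do 2 (case: asboolP => [[]//|_]); rewrite subrr normr0.
apply: (mcont_eq (f := fun x => displ f k i x - ext k (displ f k i) x)).
  by move=> x Cx /=; rewrite asboolT.
apply: rcontB.
  apply: (displ_cont i km _ be) => //; apply: mcont_sub fc => //.
suff H : rcont dX setT (ext k (displ f k i)) by apply: mcont_sub H.
apply: (hausdorff_ext_cont mX (@overlap_closed k) (B := L * b)).
  by move=> z [Cz _]; exact: dn.
apply: (displ_cont i km (overlapC (k := k)) be) => //.
by apply: mcont_sub fc.
Qed.

Lemma to_cells_lip f f' (b c : R) : b < e0 -> (forall x, dY (f0 x) (f x) <= b) ->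
  (forall x, dY (f0 x) (f' x) <= b) -> 0 <= c -> (forall x, dY (f x) (f' x) <= c) ->
  forall p, `|to_cells f p - to_cells f' p| <= 2 * L * c.
Proof.
move=> be fb fb' c0 ff' [[k x] i] /=; case: asboolP => [[km Cx]|_]; last first.
  by rewrite subrr normr0 -mulrA !mulr_ge0.
have dd z : C k z -> `|displ f k i z - displ f' k i z| <= L * c.
  move=> Cz; rewrite /displ opprB addrA subrK.
  apply: (le_trans (phi_lip i km Cz (le_lt_trans (fb z) be) (le_lt_trans (fb' z) be))).
  by rewrite ler_wpM2l.
have dn (g : X -> Y) z : (forall x, dY (f0 x) (g x) <= b) -> C k z -> `|displ g k i z| <= L * b.
  by move=> gb Cz; apply: displ_norm.
have -> : displ f k i x - ext k (displ f k i) x - (displ f' k i x - ext k (displ f' k i) x) =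
   (displ f k i x - displ f' k i x) - (ext k (displ f k i) x - ext k (displ f' k i) x) by ring.
apply: (le_trans (ler_normB _ _)).
have h1 := dd _ Cx.
have : `|ext k (displ f k i) x - ext k (displ f' k i) x| <= L * c.
  apply: (hausdorff_ext_dist mX (@overlap_closed k) x (B := L * b) (B' := L * b)).
  - by move=> z [Cz _]; exact: dn.
  - by move=> z [Cz _]; exact: dn.
  - exact: mulr_ge0.
  - by move=> z [Cz _]; exact: dd.
lra.
Qed.

(** On the new part of [C k'] the coordinates are those of [f0], plus the recorded value, plus the
    extension of the displacement of the map built so far. Points not yet reached keep the value of
    [f0]. *)
Fixpoint from_cells (h : nat * X * 'I_n -> R^o) (k : nat) : X -> Y :=
  if k is k'.+1 then fun x =>
    if `[< C k' x /\ ~ prev_cells k' x >] then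
      psi k' (fun i => phi k' (f0 x) i +
        (h (k', x, i) + ext k' (displ (from_cells h k') k' i) x))
    else from_cells h k' x
  else f0.

Definition cell_coord h k x i : R :=
  phi k (f0 x) i + (h (k, x, i) + ext k (displ (from_cells h k) k i) x).

(** One step of the recursion: [psi] contributes the outer [L], the recorded value 1, and the
    extended displacement [L] times the previous constant. It controls both the distance to [f0] and
    the dependence on [h]. *)
Fixpoint lipc (k : nat) : R := if k is k'.+1 then L + L * (L * lipc k') else 0.

Let lipc_ge0 k : 0 <= lipc k.
Proof. by elim: k => //= k IH; rewrite addr_ge0// !mulr_ge0. Qed.

Let lipc_mono k : lipc k <= lipc k.+1.
Proof.
have /= h : lipc k <= L * (L * lipc k).
  have l0 := lipc_ge0 k; apply: (@le_trans _ _ (L * lipc k)); first by rewrite ler_peMl.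
  by rewrite ler_peMl// mulr_ge0.
by have := L0; lra.
Qed.

Let lipc_le k : (k <= m)%N -> lipc k <= lipc m.
Proof.
move=> km; rewrite -(subnK km); elim: (m - k)%N => // j IH.
exact: le_trans IH (lipc_mono _).
Qed.

Variable delta : R.
Hypothesis delta_gt0 : 0 < delta.
Hypothesis delta_e0 : lipc m * delta < e0.
Hypothesis delta_r0 : (1 + L * lipc m) * delta < r0.

Section Small.
Variables (h : nat * X * 'I_n -> R^o) (b : R).
Hypotheses (b0 : 0 <= b) (bd : b < delta) (hb : forall p, `|h p| <= b).

Let lipc_b k : (k <= m)%N -> lipc k * b < e0.
Proof.
move=> /lipc_le km; apply: le_lt_trans delta_e0.
by rewrite ler_pM// ltW.
Qed.

Let coord_small k x i : (k < m)%N -> C k x ->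
  (forall x, dY (f0 x) (from_cells h k x) <= lipc k * b) ->
  `|ext k (displ (from_cells h k) k i) x| <= L * (lipc k * b) /\
  `|cell_coord h k x i - phi k (f0 x) i| <= b + L * (lipc k * b).
Proof.
move=> km Cx gb.
have eb : `|ext k (displ (from_cells h k) k i) x| <= L * (lipc k * b).
  apply: (hausdorff_ext_norm mX (@overlap_closed k) x).
    by rewrite !mulr_ge0.
  move=> z [Cz _]; apply: displ_norm => //; exact/lipc_b/ltnW.
split=> //; rewrite /cell_coord addrAC subrr add0r.
by apply: (le_trans (ler_normD _ _)); rewrite lerD.
Qed.

Let coord_r0 k : (k < m)%N -> b + L * (lipc k * b) < r0.
Proof.
move=> km; apply: le_lt_trans delta_r0; rewrite mulrDl mul1r -mulrA lerD//; first exact: ltW.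
by rewrite ler_wpM2l// ler_pM//; [exact/lipc_le/ltnW|exact: ltW].
Qed.

Lemma from_cells_near k x : (k <= m)%N -> dY (f0 x) (from_cells h k x) <= lipc k * b.
Proof.
elim: k x => [|k IH] x km; first by rewrite /= (is_metric_refl mY) mul0r.
have {}IH z := IH z (ltnW km).
rewrite [from_cells h k.+1 x]/=; case: asboolP => [[Cx _]|_]; last first.
  by apply: (le_trans (IH x)); rewrite ler_wpM2r// lipc_mono.
rewrite -[X in dY X _](phiK km Cx (f0_near x)).
have -> : lipc k.+1 * b = L * (b + L * (lipc k * b)) by rewrite /=; ring.
apply: (psi_lip (u := phi k (f0 x)) (v := cell_coord h k x) km Cx).
- by move=> i; rewrite subrr normr0.
- move=> i; apply: le_lt_trans (coord_r0 km); exact: (coord_small _ km Cx IH).2.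
- by move=> i; rewrite distrC; exact: (coord_small _ km Cx IH).2.
- by rewrite addr_ge0// !mulr_ge0.
Qed.

Let coord_ok k x i : (k < m)%N -> C k x -> `|cell_coord h k x i - phi k (f0 x) i| < r0.
Proof.
move=> km Cx; apply: le_lt_trans (coord_r0 km).
by apply: (coord_small i km Cx _).2 => z; apply: from_cells_near; exact: ltnW.
Qed.

Hypothesis h_cell : cell_maps h.

Let h0 k x i : ~ [/\ (k < m)%N, C k x & ~ prev_cells k x] -> h (k, x, i) = 0.
Proof. by case: h_cell => _ H _; exact: H. Qed.

(** As [h] vanishes on the overlap, the coordinate formula for the new cell reproduces the map
    already built. It is therefore valid on the whole closed cell, which is what gluing needs. *)
Lemma coord_overlap k x i : overlap k x ->
  cell_coord h k x i = phi k (from_cells h k x) i.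
Proof.
move=> ox; rewrite /cell_coord h0 ?add0r; last by move=> [_ _]; case: ox.
by rewrite hausdorff_extE// /displ addrC subrK.
Qed.

Lemma from_cellsE k x : (k < m)%N -> C k x ->
  from_cells h k.+1 x = psi k (cell_coord h k x).
Proof.
move=> km Cx /=; case: asboolP => [//|np].
have ox : overlap k x by split=> //; apply: contrapT => nx; apply: np.
rewrite (_ : cell_coord h k x = phi k (from_cells h k x)).
  rewrite (phiK km Cx)//; apply: le_lt_trans (from_cells_near _ (ltnW km)) _.
  exact/lipc_b/ltnW.
by apply/funext => i; exact: coord_overlap.
Qed.

Lemma from_cells_stable k x j : prev_cells k x -> from_cells h (k + j) x = from_cells h k x.
Proof.
move=> px; elim: j => [|j IH]; first by rewrite addn0.
rewrite addnS /= asboolF// => -[_]; apply.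
by case: px => i ik Ci; exists i => //; apply: leq_trans (leq_addr _ _).
Qed.

Lemma from_cells_cont k : (k <= m)%N -> mcont (prev_cells k) dX dY (from_cells h k).
Proof.
elim: k => [|k IH] km; first by move=> x e [].
have {}IH := IH (ltnW km).
rewrite (_ : prev_cells k.+1 = prev_cells k `|` C k); last first.
  apply/seteqP; split=> x.
    move=> [j]; rewrite ltnS leq_eqVlt => /orP[/eqP ->|jk] Cj; first by right.
    by left; exists j.
  by move=> [[j jk Cj]|Ck]; [exists j => //; exact: ltnW|exists k].
apply: mcont_glue => //; first exact: prev_cells_closed.
  by apply: mcont_eq IH => x px; rewrite -addn1 from_cells_stable.
apply: (mcont_eq (f := fun x => psi k (cell_coord h k x))).
  by move=> x Cx; rewrite from_cellsE.
have cc i : rcont dX (C k) (fun x => cell_coord h k x i).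
  apply: rcontD.
    apply: (chart_cont i (b := 0) km _ e0_gt0) => //.
      by move=> x _; rewrite (is_metric_refl mY).
    by apply: mcont_sub f0_cont.
  apply: rcontD; first by case: h_cell.
  suff H : rcont dX setT (ext k (displ (from_cells h k) k i)) by apply: mcont_sub H.
  apply: (hausdorff_ext_cont mX (@overlap_closed k) (B := L * (lipc k * b))).
    move=> z [Cz _]; apply: displ_norm => //; last exact/lipc_b/ltnW.
    exact/from_cells_near/ltnW.
  apply: (displ_cont i km (overlapC (k := k)) (lipc_b (ltnW km))).
    by move=> x _; exact/from_cells_near/ltnW.
  by apply: mcont_sub IH => x [].
move=> x e Cx e_gt0.
(* [psi_lip] requires both points in the range around the coordinates of [f0 x] for the same [x];
   [r i] is the room left there. *)
pose r i := r0 - `|cell_coord h k x i - phi k (f0 x) i|.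
have r_gt0 i : 0 < r i by rewrite subr_gt0; exact: coord_ok.
have eL : 0 < e / (L + 1) by rewrite divr_gt0// ltr_wpDl.
have /choice[d dP] i : exists d : R, 0 < d /\ forall y, C k y -> dX x y < d ->
    `|cell_coord h k y i - cell_coord h k x i| < Num.min (r i) (e / (L + 1)).
  have m_gt0 : 0 < Num.min (r i) (e / (L + 1)) by rewrite lt_min r_gt0.
  by have [d d0 H] := cc i x _ Cx m_gt0; exists d.
have [dd dd0 ddP] := fin_min (fun i => (dP i).1).
exists dd => // y Cy xy.
have H i : `|cell_coord h k y i - cell_coord h k x i| < r i /\
    `|cell_coord h k y i - cell_coord h k x i| < e / (L + 1).
  by have := (dP i).2 y Cy (lt_le_trans xy (ddP i)); rewrite lt_min => /andP.
apply: (@le_lt_trans _ _ (L * (e / (L + 1)))); last first.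
  by rewrite mulrA ltr_pdivrMr ?ltr_wpDl// mulrDr mulr1 mulrC ltrDl.
apply: (psi_lip (x := x) km Cx) => [i|i|i|].
- exact: coord_ok.
- have [h1 _] := H i; rewrite /r in h1.
  have := ler_distD (cell_coord h k x i) (cell_coord h k y i) (phi k (f0 x) i).
  by lra.
- by rewrite distrC; apply/ltW; case: (H i).
- exact: ltW.
Qed.

Lemma from_cells_coord k x i : (k < m)%N -> C k x ->
  phi k (from_cells h m x) i = cell_coord h k x i.
Proof.
move=> km Cx; have -> : from_cells h m x = psi k (cell_coord h k x).
  rewrite -from_cellsE// -(subnKC km) from_cells_stable//.
  by exists k.
by rewrite (psiK i km Cx)// => j; exact: coord_ok.
Qed.

(** Displacements that agree on the overlap have the same extension, so recording the rebuilt map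
    subtracts exactly what the construction added. *)
Lemma from_cellsK : to_cells (from_cells h m) = h.
Proof.
apply/funext => -[[k x] i] /=; case: asboolP => [[km Cx]|nk]; last first.
  by rewrite h0// => -[km Cx _]; apply: nk.
have dE z : C k z -> displ (from_cells h m) k i z =
    h (k, z, i) + ext k (displ (from_cells h k) k i) z.
  by move=> Cz; rewrite /displ from_cells_coord// /cell_coord addrAC subrr add0r.
rewrite dE// (hausdorff_ext_eq dX x (g' := displ (from_cells h k) k i)) ?addrK//.
move=> z oz; have [Cz pz] := oz; rewrite dE// hausdorff_extE//.
by rewrite h0 ?add0r// => -[].
Qed.

End Small.

Lemma from_cells_lip h h' (b c : R) : 0 <= b -> b < delta -> (forall p, `|h p| <= b) ->
  (forall p, `|h' p| <= b) -> 0 <= c -> (forall p, `|h p - h' p| <= c) ->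
  forall k x, (k <= m)%N -> dY (from_cells h k x) (from_cells h' k x) <= lipc k * c.
Proof.
move=> b0 bd hb hb' c0 hc; elim=> [|k IH] x km.
  by rewrite /= (is_metric_refl mY) mul0r.
have {}IH z := IH z (ltnW km).
rewrite [from_cells h k.+1 x]/= [from_cells h' k.+1 x]/=; case: asboolP => [[Cx _]|_]; last first.
  by apply: (le_trans (IH x)); rewrite ler_wpM2r// lipc_mono.
have nb g z : (forall p, `|g p| <= b) -> dY (f0 z) (from_cells g k z) <= lipc k * b.
  by move=> gb; apply: from_cells_near => //; exact: ltnW.
have lb : lipc k * b < e0.
  by apply: le_lt_trans delta_e0; rewrite ler_pM//; [exact/lipc_le/ltnW|exact: ltW].
have small g i : (forall p, `|g p| <= b) -> `|cell_coord g k x i - phi k (f0 x) i| < r0.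
  move=> gb; apply: (@le_lt_trans _ _ (b + L * (lipc k * b))).
    rewrite /cell_coord addrAC subrr add0r; apply: (le_trans (ler_normD _ _)); rewrite lerD//.
    apply: (hausdorff_ext_norm mX (@overlap_closed k) x); first by rewrite !mulr_ge0.
    by move=> z [Cz _]; apply: displ_norm => //; exact: nb.
  apply: le_lt_trans delta_r0; rewrite mulrDl mul1r -mulrA lerD//; first exact: ltW.
  by rewrite ler_wpM2l// ler_pM//; [exact/lipc_le/ltnW|exact: ltW].
have -> : lipc k.+1 * c = L * (c + L * (lipc k * c)) by rewrite /=; ring.
apply: (psi_lip (u := cell_coord h k x) (v := cell_coord h' k x) km Cx).
- by move=> i; exact: small.
- by move=> i; exact: small.
- move=> i; rewrite /cell_coord opprD addrACA subrr add0r opprD addrACA.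
  apply: (le_trans (ler_normD _ _)); rewrite lerD//.
  apply: (hausdorff_ext_dist mX (@overlap_closed k) x (B := L * (lipc k * b)) (B' := L * (lipc k * b))).
  + by move=> z [Cz _]; apply: displ_norm => //; exact: nb.
  + by move=> z [Cz _]; apply: displ_norm => //; exact: nb.
  + by rewrite !mulr_ge0.
  + move=> z [Cz _]; rewrite /displ opprB addrA subrK.
    apply: (le_trans (phi_lip i km Cz (le_lt_trans (nb _ _ hb) lb) (le_lt_trans (nb _ _ hb') lb))).
    by rewrite ler_wpM2l// IH.
- by rewrite addr_ge0// !mulr_ge0.
Qed.

Lemma to_cellsK f (b : R) : b < e0 -> (forall x, dY (f0 x) (f x) <= b) ->
  from_cells (to_cells f) m = f.
Proof.
move=> be fb.
have key k x : (k <= m)%N -> prev_cells k x -> from_cells (to_cells f) k x = f x.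
  elim: k x => [|k IH] x km; first by case.
  have {}IH z := IH z (ltnW km).
  move=> px /=; case: asboolP => [[Cx npx]|npx].
    rewrite (_ : (fun i => _) = phi k (f x)).
      by rewrite (phiK km Cx)//; apply: le_lt_trans be.
    apply/funext => i; rewrite asboolT//.
    rewrite (hausdorff_ext_eq dX x (g' := displ f k i)).
      by rewrite subrK /displ addrC subrK.
    by move=> z [_ pz]; rewrite /displ IH.
  apply: IH; case: px => j; rewrite ltnS leq_eqVlt => /orP[/eqP ->|jk] Cj; last by exists j.
  by apply: contrapT => np; apply: npx; split.
apply/funext => x; apply: key => //.
Qed.

End LocalModel.

(** * Independent families of signs *)

Section IndependentSigns.

Definition trace (j : set nat) (k : nat) : seq bool := [seq `[< j i >] | i <- iota 0 k].

Lemma trace_separates (F : {fset set nat}) : exists k, forall i j, i \in F -> j \in F ->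
  trace i k = trace j k -> i = j.
Proof.
have mono i j k k' : (k <= k')%N -> trace i k' = trace j k' -> trace i k = trace j k.
  move=> kk' e; apply/eq_in_map => a; rewrite mem_iota add0n => /andP[_ ak].
  move/eq_in_map : e; apply; rewrite mem_iota add0n /=; exact: leq_trans kk'.
have pair i j : exists k, trace i k = trace j k -> i = j.
  have [->|ij] := pselect (i = j); first by exists 0%N.
  have [k kP] : exists k, `[< i k >] <> `[< j k >].
    apply: contrapT => H; apply: ij; apply/seteqP; split=> k; move: H => /forallNP/(_ k)/contrapT;
      by case: asboolP => // _; case: asboolP.
  exists k.+1 => /eq_in_map /(_ k); rewrite mem_iota add0n /= ltnSn => /(_ isT).
  by move/kP.
have {}pair i (G : {fset set nat}) : exists k, forall j, j \in G -> trace i k = trace j k -> i = j.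
  elim/fset1U_rect : G => [|j G jG [k kP]]; first by exists 0%N.
  have [k' k'P] := pair i j; exists (maxn k k') => j'; rewrite !inE => /orP[/eqP ->|j'G] e.
    exact/k'P/(mono _ _ _ _ (leq_maxr _ _) e).
  exact/kP/(mono _ _ _ _ (leq_maxl _ _) e).
suff H (G : {fset set nat}) : exists k, forall i j, i \in G -> j \in F -> trace i k = trace j k -> i = j.
  exact: H.
elim/fset1U_rect : G => [|i G iG [k kP]]; first by exists 0%N.
have [k' k'P] := pair i F; exists (maxn k k') => i' j; rewrite !inE => /orP[/eqP ->|i'G] jF e.
  exact/k'P/(mono _ _ _ _ (leq_maxr _ _) e).
exact/kP/(mono _ _ _ _ (leq_maxl _ _) e).
Qed.

(** The classical independent family of size continuum on a countable set: an index codes a length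
    [k] and a finite list [W] of words, and the sign tells whether the initial word of [j] belongs
    to [W]. *)
Definition indep_sign (R : realType) (j : set nat) (i : nat) : R :=
  if @choice.unpickle (nat * seq (seq bool))%type i is Some (k, W) then
    if trace j k \in W then 1 else -1
  else 1.

Lemma indep_sign_norm (R : realType) j i : `|indep_sign R j i| = 1.
Proof.
rewrite /indep_sign; case: choice.unpickle => [[k W]|]; last by rewrite normr1.
by case: ifP => _; rewrite ?normrN normr1.
Qed.

(** Words long enough to separate the members of [F] realise every sign pattern on [F], in
    particular that of the coefficients. *)
Lemma indep_sign_free (R : realType) (F : {fset set nat}) (a : set nat -> R) :
  exists i, forall j, j \in F -> a j * indep_sign R j i = `|a j|.
Proof.
have [k kP] := trace_separates F.
pose W := [seq trace j k | j <- F & 0 <= a j].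
exists (choice.pickle (k, W)) => j jF; rewrite /indep_sign choice.pickleK.
case: ifPn => [/mapP[j' ]|].
  rewrite mem_filter => /andP[aj' j'F] e; rewrite (kP _ _ jF j'F e).
  by rewrite mulr1 ger0_norm.
move=> nW; rewrite mulrN1 ler0_norm// leNgt; apply: contra nW => aj.
by apply: map_f; rewrite mem_filter ltW.
Qed.

End IndependentSigns.

(** * Cardinality and l1 basis of the space of cell functions *)

Section Cells.
Context {R : realType} (X : topologicalType) (d : X -> X -> R) (n m : nat).
Hypothesis md : is_metric d.
Hypothesis openE : forall U : set X, open U <-> dist_open d U.
Variable D : set X.
Hypothesis countD : countable D.
Hypothesis denseD : dense D.
Variable C : nat -> set X.
Local Notation E := (@cell_maps R X d n m C).

(** A function is coded by the strict rational lower bounds it satisfies on small balls of a cell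
    around points of [D]. Continuity on the cell recovers each value as the supremum of such bounds;
    elsewhere all values are 0. *)
Lemma cell_code : exists code : (nat * X * 'I_n -> R^o) -> set nat,
  forall g h, E g -> E h -> code g = code h -> g = h.
Proof.
have [f finj] := countable_code countD.
pose code (h : nat * X * 'I_n -> R^o) : set nat := [set N | exists c j (q : rat) k i,
  [/\ D c, N = choice.pickle (f c, j, q, k, i) &
  forall x, C k x -> d c x < j.+1%:R^-1 -> ratr q < h (k, x, i)]].
have half g h p : E g -> E h -> code g = code h -> g p <= h p.
  move=> [_ g0 gc] [_ h0 hc] e; rewrite leNgt; apply/negP.
  case: p => [[k x] i] lt.
  have Cx : C k x.
    apply: contrapT => nC; move: lt; rewrite g0 ?h0 ?ltxx//; by case.
  have [q] := rat_in_itvoo lt; rewrite in_itv /= => /andP[hq qg].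
  have [eta eta0 H] := gc k i x (g (k, x, i) - ratr q) Cx ltac:(by rewrite subr_gt0).
  have e20 : 0 < eta / 2 by rewrite divr_gt0.
  have [j je] := inv_nat_lt e20.
  have j0 : 0 < j.+1%:R^-1 :> R by rewrite invr_gt0.
  have [c Dc xc] := dense_near md openE denseD x j0.
  have : code g (choice.pickle (f c, j, q, k, i)).
    exists c, j, q, k, i; split=> // y Cy cy.
    have xy : d x y < eta.
      have := is_metric_tri md x c y.
      by move: (lt_trans xc je) (lt_trans cy je); lra.
    by have := H y Cy xy; rewrite ltr_norml => /andP[+ _]; lra.
  rewrite e => -[c' [j' [q' [k' [i' [Dc' + H']]]]]].
  move=> /(pcan_inj choice.pickleK) [fc jj qq kk ii].
  have cc : c = c' by apply: finj => //; rewrite inE.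
  rewrite -cc -jj -qq -kk -ii in H'.
  have := H' x Cx; rewrite (is_metric_sym md) => /(_ xc).
  by move/(lt_trans hq); rewrite ltxx.
exists code => g h Eg Eh e; apply/funext => p; apply/eqP; rewrite eq_le.
by rewrite !half.
Qed.

Hypothesis noncompactX : ~ compact [set: X].
Hypothesis C_closed : forall k, mclosed d (C k).
Hypothesis C_cover : forall x, exists2 k, (k < m)%N & C k x.

(** The cells with earlier ones removed cover [X] and are finite in number, so one contains
    infinitely many terms of the locally finite sequence. A value recurs only finitely often, so
    these terms have an injective subsequence. *)
Lemma cell_seq : exists (k : nat) (z : nat -> X), [/\ (k < m)%N,
  forall i, C k (z i) /\ ~ prev_cells C k (z i), injective z &
  forall x, exists2 eta, 0 < eta & exists M, forall i, (M <= i)%N -> eta <= d x (z i)].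
Proof.
have [e eP] := locally_finite_seq md openE countD denseD noncompactX.
have [k km kinf] : exists2 k, (k < m)%N & forall M, exists i, (M <= i)%N /\
    (C k (e i) /\ ~ prev_cells C k (e i)).
  apply: contrapT => H.
  have : forall k, exists M, forall i, (M <= i)%N -> (k < m)%N ->
      C k (e i) -> prev_cells C k (e i).
    move=> k; apply: contrapT => nM; apply: H; exists k.
      apply: contrapT => nk; apply: nM; exists 0%N => i _ km; by case: (nk km).
    move=> M; apply: contrapT => ni; apply: nM; exists M => i Mi _ Ci.
    by apply: contrapT => np; apply: ni; exists i.
  move=> /choice[M MP].
  pose K := \max_(k < m) M k.
  have : forall k, (k < m)%N -> ~ C k (e K).
    move=> k; elim/ltn_ind: k => k IH km Ck.
    have [] := MP k K _ km Ck; first exact: (leq_bigmax (F := fun k : 'I_m => M k) (Ordinal km)).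
    by move=> j jk; apply: IH => //; exact: ltn_trans km.
  by have [k km Ck] := C_cover (e K); move/(_ k km).
have /choice[Nx NxP] x : exists M, forall i, (M <= i)%N -> e i <> x.
  have [eta eta0 [M MP]] := eP x; exists M => i /MP.
  by move=> + ex; rewrite ex (is_metric_refl md); lra.
have /choice[next nextP] := kinf.
(* [b i] is a lower bound for the next index, raised past the index just used and past all
   recurrences of the value just taken. *)
pose b := fix b i := if i is i'.+1 then
  maxn (b i') (maxn (next (b i')).+1 (Nx (e (next (b i'))))) else 0%N.
pose z i := e (next (b i)).
have b_mono i j : (b i <= b (i + j))%N.
  elim: j => [|j IH]; first by rewrite addn0.
  by rewrite addnS; apply: (leq_trans IH); rewrite /= leq_maxl.
have b_ge i : (i <= b i)%N.
  elim: i => // i IH; apply: leq_trans (_ : (next (b i)).+1 <= _)%N.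
    by rewrite ltnS; apply: (leq_trans IH); have [] := nextP (b i).
  by rewrite /= !leq_max leqnn !orbT.
exists k, z; split => //.
- by move=> i; have [] := nextP (b i).
- have zlt i j : (i < j)%N -> z j <> z i.
    move=> ij; apply: NxP; apply: leq_trans (nextP (b j)).1.
    rewrite -(subnKC ij); apply: leq_trans (b_mono i.+1 _).
    by rewrite /= !leq_max leqnn !orbT.
  move=> i j zij; have [ij|ji|//] := ltngtP i j.
    by have := zlt _ _ ij; rewrite zij.
  by have := zlt _ _ ji; rewrite zij.
- move=> x; have [eta eta0 [M MP]] := eP x; exists eta => //; exists M => i Mi.
  apply: MP; apply: (leq_trans Mi); apply: (leq_trans (b_ge i)).
  by have [] := nextP (b i).
Qed.

(** Prescribe 0 on the earlier cells and independent signs along the sequence; this is continuous on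
    a closed set since the sequence is locally finite and avoids those cells. The extension keeps
    the norm at most 1, and evaluation at the point whose signs match the coefficients gives the
    lower bound. *)
Lemma cell_rad : (0 < n)%N -> exists rad : set nat -> nat * X * 'I_n -> R^o,
  [/\ forall j, E (rad j), forall j, sup_norm (rad j) <= 1 &
  forall (F : {fset set nat}) (a : set nat -> R),
    \sum_(j <- F) `|a j| <= sup_norm (\sum_(j <- F) a j *: rad j)].
Proof.
move=> n0; have [k [z [km zC zinj zfin]]] := cell_seq.
pose i0 : 'I_n := Ordinal n0.
pose Z : set X := [set x | prev_cells C k x \/ exists i, x = z i].
have cP := prev_cells_closed C_closed (k := k).
have Zclosed : mclosed d Z.
  move=> x /not_orP[nP nz]; have [a a0 aP] := cP _ nP.
  have [eta eta0 [M MP]] := zfin x.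
  have [b b0 bP] : exists2 b, 0 < b & forall i, b <= d x (z i).
    have [b b0 bP] := @fin_min R 'I_M (fun i => d x (z i)) (fun i =>
       is_metric_gt0 md (fun e => nz (ex_intro _ (i : nat) e))).
    exists (Num.min eta b); first by rewrite lt_min eta0.
    move=> i; rewrite ge_min; have [Mi|iM] := leqP M i; first by rewrite MP.
    by rewrite (bP (Ordinal iM)) orbT.
  exists (Num.min a b); first by rewrite lt_min a0.
  move=> y; rewrite lt_min => /andP[/aP nPy xy] [//|[i yz]].
  by have := bP i; rewrite -yz leNgt xy.
pose w j x : R := if pselect (exists i, x = z i) is left e then indep_sign R j (projT1 (cid e)) else 0.
have wz j i : w j (z i) = indep_sign R j i.
  rewrite /w; case: pselect => [e|]; last by case; exists i.
  by case: (cid e) => i' /= /zinj ->.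
have wP j x : prev_cells C k x -> w j x = 0.
  rewrite /w; case: pselect => // e Px; exfalso; case: e Px => i -> Px.
  by have [_] := zC i; apply.
have w1 j x : `|w j x| <= 1.
  by rewrite /w; case: pselect => [e|_]; rewrite ?indep_sign_norm// normr0.
have wc j : rcont d Z (w j).
  move=> x e Zx e0; case: Zx => [Px|[i xz]].
    have [eta eta0 [M MP]] := zfin x.
    have [b b0 bP] := @fin_min R 'I_M (fun i => d x (z i)) (fun i =>
       is_metric_gt0 md (fun e : x = z i => (zC i).2 (eq_ind _ _ Px _ e))).
    exists (Num.min eta b); first by rewrite lt_min eta0.
    move=> y Zy; rewrite lt_min => /andP[y1 y2].
    case: Zy => [Py|[i yz]]; first by rewrite !wP// subrr normr0.
    exfalso; have [Mi|iM] := leqP M i.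
      by have := MP _ Mi; rewrite -yz leNgt y1.
    by have := bP (Ordinal iM); rewrite /= -yz leNgt y2.
  have nPx : ~ prev_cells C k x by rewrite xz; case: (zC i).
  have [a a0 aP] := cP _ nPx.
  have [eta eta0 [M MP]] := zfin x.
  pose dd (l : nat) := if l == i then 1 else d x (z l).
  have dd0 (l : 'I_M) : 0 < dd l.
    rewrite /dd; case: eqP => [//|li]; apply: (is_metric_gt0 md).
    by rewrite xz => /zinj /esym.
  have [b b0 bP] := fin_min dd0.
  exists (Num.min a (Num.min eta b)); first by rewrite !lt_min a0 eta0.
  move=> y Zy; rewrite !lt_min => /and3P[/aP nPy y1 y2].
  case: Zy => [//|[l yz]].
  have [li|li] := eqVneq l i; first by rewrite yz xz li subrr normr0.
  exfalso; have [Ml|lM] := leqP M l.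
    by have := MP _ Ml; rewrite -yz leNgt y1.
  by have := bP (Ordinal lM); rewrite /dd /= (negPf li) -yz leNgt y2.
pose W j := hausdorff_ext d Z (w j).
have W1 j x : `|W j x| <= 1 by apply: (hausdorff_ext_norm md Zclosed x) => // y _; exact: w1.
have Wc j : rcont d setT (W j).
  by apply: (hausdorff_ext_cont md Zclosed (B := 1)) => // y _; exact: w1.
pose rad j (p : nat * X * 'I_n) : R^o :=
  if (p.1.1 == k) && `[< C k p.1.2 >] && (p.2 == i0) then W j p.1.2 else 0.
have rad1 j p : `|rad j p| <= 1.
  by rewrite /rad; case: ifP => _; [exact: W1|rewrite normr0].
exists rad; split.
- move=> j; split; first by exists 1.
    move=> k' x i nk; rewrite /rad /=; case: ifP => // /andP[/andP[/eqP kk /asboolP Cx] _].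
    rewrite /W hausdorff_extE; last first.
      by left; apply: contrapT => np; apply: nk; rewrite kk.
    by apply: wP; apply: contrapT => np; apply: nk; rewrite kk.
  move=> k' i; have [kk|kk] := eqVneq k' k; last first.
    by move=> x e _ e0; exists 1 => // y _ _; rewrite /rad /= (negPf kk) subrr normr0.
  have [ii|ii] := eqVneq i i0; last first.
    by move=> x e _ e0; exists 1 => // y _ _; rewrite /rad /= (negPf ii) !andbF subrr normr0.
  rewrite kk ii; apply: (mcont_eq (f := W j)).
    by move=> x Cx; rewrite /rad /= !eqxx asboolT.
  by apply: mcont_sub (Wc j).
- by move=> j; apply: sup_norm_le.
- move=> F a; have [i iP] := indep_sign_free F a.
  have radz j : rad j (k, z i, i0) = indep_sign R j i.
    rewrite /rad /= !eqxx asboolT /=; last by case: (zC i).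
    by rewrite /W hausdorff_extE ?wz//; right; exists i.
  have sumE (p : nat * X * 'I_n) : (\sum_(j <- F) a j *: rad j) p = \sum_(j <- F) a j * rad j p.
    by rewrite fct_sumE.
  have sb : sup_bounded (\sum_(j <- F) a j *: rad j).
    exists (\sum_(j <- F) `|a j|) => p; rewrite sumE.
    apply: (le_trans (ler_norm_sum _ _ _)); apply: ler_sum => j _.
    by rewrite normrM ler_piMr.
  apply: le_trans (sup_norm_ub (k, z i, i0) sb).
  rewrite sumE; apply: le_trans (ler_norm _).
  by rewrite big_seq [leRHS]big_seq; apply: ler_sum => j jF; rewrite radz iP.
Qed.

End Cells.

Section MetricTopology.
Context {R : realType}.

Lemma continuous_mcont (S T : topologicalType) (dS : S -> S -> R) (dT : T -> T -> R) (f : S -> T) :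
  is_metric dS -> is_metric dT ->
  (forall U : set S, open U <-> dist_open dS U) ->
  (forall U : set T, open U <-> dist_open dT U) ->
  continuous f <-> mcont setT dS dT f.
Proof.
move=> mS mT oS oT; split=> [fc x e _ e0|fc].
  have := (continuousP _).1 fc _ (metric_ball_open mT oT (f x) e).
  move=> /oS /(_ x) /=; rewrite (is_metric_refl mT) => /(_ e0)[d d0 H].
  by exists d => // y _ /H.
apply/continuousP => A /oT oA; apply/oS => x /= Afx.
have [e e0 H] := oA _ Afx; have [d d0 H'] := fc x e Logic.I e0.
by exists d => // y xy; apply/H/H'.
Qed.

Lemma dist_space_openE (T : Type) (dT : T -> T -> R) (U : set T) :
  @open (dist_space dT) U <-> dist_open dT U.
Proof. by []. Qed.

Lemma within_mcont (S T : Type) (dS : S -> S -> R) (dT : T -> T -> R) (A : set S) (f : S -> T) :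
  is_metric dS -> mcont A dS dT f ->
  {within (A : set (dist_space dS)), continuous (f : dist_space dS -> dist_space dT)}.
Proof.
move=> mS fc; apply/subspace_continuousP => x Ax B.
rewrite nbhsE => -[W [oO Ofx] OB].
have [e e0 H] := (dist_space_openE dT W).1 oO _ Ofx.
have [d d0 H'] := fc x e Ax e0.
rewrite nbhsE; exists [set y : dist_space dS | dS x y < d].
  split; last by rewrite /= (is_metric_refl mS).
  apply/dist_space_openE => y /= xy; exists (d - dS x y); first by lra.
  by move=> z yz /=; have := is_metric_tri mS x y z; lra.
by move=> y /= xy Ay; apply/OB/H/H'.
Qed.

End MetricTopology.

Section Ell2Metric.
Context {R : realType} (J : choiceType).

Let sqB (v w : ell2_vec R J) : fbounded (fun j => (v j - w j) ^+ 2).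
Proof.
have sq (u : ell2_vec R J) : fbounded (fun j => u j ^+ 2).
  apply: esum_fbounded => [j|]; first exact: sqr_ge0.
  exact: ell2_summable.
apply: (@le_fbounded _ _ _ (fun j => 2 * v j ^+ 2 + 2 * w j ^+ 2)).
  by move=> j; have := sqr_ge0 (v j + w j); nra.
by apply: fboundedD; apply: fboundedZ.
Qed.

Lemma ell2_dist_metric : is_metric (@ell2_dist R J).
Proof.
split.
- by move=> v w; rewrite sqrtr_ge0.
- move=> v w; rewrite ell2_distE; split=> [|->]; last first.
    rewrite (_ : (fun j => _) = fun=> 0); last by apply/funext => j; rewrite subrr expr0n.
    have z F : fsum (fun=> 0 : R) F = 0 :> R by rewrite /fsum big1_seq.
    have fb : fbounded (fun=> 0 : R) (J := J) by exists 0 => F; rewrite z.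
    suff -> : tsum (fun=> 0 : R) (J := J) = 0 by rewrite sqrtr0.
    by apply/eqP; rewrite eq_le tsum_ge0// andbT; apply: tsum_le => F; rewrite z.
  move=> /eqP; rewrite sqrtr_eq0 => t0; apply: ell2_vec_ext => j.
  apply/eqP; rewrite -subr_eq0 -sqrf_eq0 eq_le sqr_ge0 andbT.
  apply: le_trans t0; have := fsum_le_tsum [fset j]%fset (sqB v w).
  by rewrite /fsum big_seq_fset1.
- move=> v w; rewrite !ell2_distE; congr (Num.sqrt (tsum _)); apply/funext => j.
  by rewrite -sqrrN opprB.
move=> u v w; rewrite !ell2_distE.
set A := tsum (fun j => (u j - v j) ^+ 2); set B := tsum (fun j => (v j - w j) ^+ 2).
have A0 : 0 <= A by apply: tsum_ge0.
have B0 : 0 <= B by apply: tsum_ge0.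
set a := Num.sqrt A; set b := Num.sqrt B.
have a0 : 0 <= a by exact: sqrtr_ge0.
have b0 : 0 <= b by exact: sqrtr_ge0.
have aA : a ^+ 2 = A by rewrite sqr_sqrtr.
have bB : b ^+ 2 = B by rewrite sqr_sqrtr.
(* Minkowski through (x + y)^2 <= (1 + b/a) x^2 + (1 + a/b) y^2, with a and b
   enlarged by e to avoid dividing by zero. *)
apply/ler_addgt0Pr => e e0; pose s := a + e / 2; pose t := b + e / 2.
have s0 : 0 < s by rewrite /s; lra.
have t0 : 0 < t by rewrite /t; lra.
have -> : a + b + e = s + t by rewrite /s /t; lra.
have st0 : 0 <= s + t by rewrite addr_ge0// ltW.
rewrite -(ger0_norm st0) -sqrtr_sqr ler_wsqrtr//.
apply: (@le_trans _ _ ((1 + t / s) * A + (1 + s / t) * B)).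
  have k1 : 0 <= 1 + t / s by rewrite addr_ge0// divr_ge0 ?ltW.
  have k2 : 0 <= 1 + s / t by rewrite addr_ge0// divr_ge0 ?ltW.
  rewrite /A /B -!tsumZ//.
  apply: le_trans (tsumD_le _ _); last 2 first.
  - exact: fboundedZ.
  - exact: fboundedZ.
  apply: le_tsum; last by apply: fboundedD; exact: fboundedZ.
  move=> j; set x := u j - v j; set y := v j - w j.
  have -> : u j - w j = x + y by rewrite /x /y; lra.
  have : 0 <= (s * t)^-1 * (t * x - s * y) ^+ 2 by rewrite mulr_ge0 ?sqr_ge0// invr_ge0 ltW// mulr_gt0.
  have -> : (s * t)^-1 * (t * x - s * y) ^+ 2 = t / s * x ^+ 2 + s / t * y ^+ 2 - 2 * x * y.
    by field; rewrite !gt_eqF.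
  lra.
have hA : A <= s ^+ 2 by rewrite -aA ler_sqr ?nnegrE// ?ltW// /s; lra.
have hB : B <= t ^+ 2 by rewrite -bB ler_sqr ?nnegrE// ?ltW// /t; lra.
have h1 : (1 + t / s) * A <= (1 + t / s) * s ^+ 2 by rewrite ler_wpM2l// addr_ge0// divr_ge0 ?ltW.
have h2 : (1 + s / t) * B <= (1 + s / t) * t ^+ 2 by rewrite ler_wpM2l// addr_ge0// divr_ge0 ?ltW.
have e1 : (1 + t / s) * s ^+ 2 = s ^+ 2 + s * t by field; rewrite gt_eqF.
have e2 : (1 + s / t) * t ^+ 2 = t ^+ 2 + s * t by field; rewrite gt_eqF.
rewrite sqrrD; lra.
Qed.

End Ell2Metric.

Section BoundedMapMetric.
Context {R : realType} (X Y : topologicalType) (d : Y -> Y -> R).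
Hypothesis mY : is_metric d.
Variable x0 : X.
Implicit Types f g : bounded_map X d.

Lemma bounded_map_ext f g : (forall x, f x = g x) -> f = g.
Proof.
case: f g => [f fc fb] [g gc gb] /= /funext e; rewrite e in fc fb *.
by congr BoundedMap; exact: Prop_irrelevance.
Qed.

Let S f g : set R := range (fun x => d (f x) (g x)).

Let S_ub f g : has_ubound (S f g).
Proof.
have [M fM] := bmap_bounded f; have [K gK] := bmap_bounded g.
exists (M + d (f x0) (g x0) + K) => _ [x _ <-].
have h1 : d (f x) (f x0) <= M by apply: fM; [exists x|exists x0].
have h2 : d (g x0) (g x) <= K by apply: gK; [exists x0|exists x].
have := is_metric_tri mY (f x) (f x0) (g x); have := is_metric_tri mY (f x0) (g x0) (g x).
lra.
Qed.

Let le_sup f g x : d (f x) (g x) <= sup (S f g).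
Proof. by apply: ub_le_sup; [exact: S_ub|exists x]. Qed.

Let sup_le f g (c : R) : (forall x, d (f x) (g x) <= c) -> sup (S f g) <= c.
Proof.
by move=> H; apply: ge_sup; [exists (d (f x0) (g x0)), x0|move=> _ [x _ <-]].
Qed.

Lemma bmap_dist_le f g (c : R) : (forall x, d (f x) (g x) <= c) -> bmap_dist f g <= c.
Proof. by move=> H; rewrite /bmap_dist ge_min sup_le ?orbT. Qed.

(** Thresholds up to 1 do not see the truncation of the metric. *)
Lemma bmap_dist_lt f g (c : R) x : c <= 1 -> bmap_dist f g < c -> d (f x) (g x) < c.
Proof.
move=> c1; rewrite /bmap_dist gt_min => /orP[h|]; first by have := lt_le_trans h c1; rewrite ltxx.
exact/le_lt_trans/le_sup.
Qed.

Lemma bmap_dist_metric : is_metric (@bmap_dist R X Y d).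
Proof.
have s0 f g : 0 <= sup (S f g) by apply: le_trans (le_sup f g x0); exact: is_metric_ge0.
have d0 f g : 0 <= bmap_dist f g by rewrite /bmap_dist le_min ler01 s0.
split=> //.
- move=> f g; split=> [H|->].
    apply: bounded_map_ext => x; apply: (is_metric_eq0 mY).
    apply/eqP; rewrite eq_le is_metric_ge0// andbT.
    apply/ler_addgt0Pr => e e0; rewrite add0r.
    have m0 : 0 < Num.min 1 e by rewrite lt_min ltr01.
    have := @bmap_dist_lt f g (Num.min 1 e) x; rewrite H ge_min lexx => /(_ isT m0).
    by rewrite lt_min => /andP[_ /ltW].
  apply/eqP; rewrite eq_le d0 andbT; apply: bmap_dist_le => x.
  by rewrite (is_metric_refl mY).
- move=> f g; rewrite /bmap_dist; congr Num.min; congr sup.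
  by apply/seteqP; split=> _ [x _ <-]; exists x => //; exact: is_metric_sym.
move=> f g h; have [H|H] := leP 1 (bmap_dist f g).
  apply: (@le_trans _ _ 1); first by rewrite /bmap_dist ge_min lexx.
  by apply: (le_trans H); rewrite lerDl.
have [H'|H'] := leP 1 (bmap_dist g h).
  apply: (@le_trans _ _ 1); first by rewrite /bmap_dist ge_min lexx.
  by apply: (le_trans H'); rewrite lerDr.
apply: bmap_dist_le => x; apply: (le_trans (is_metric_tri mY _ (g x) _)).
have E (a b : bounded_map X d) : bmap_dist a b < 1 -> d (a x) (b x) <= bmap_dist a b.
  rewrite /bmap_dist; case: (leP 1 (sup _)) => [_|_ _]; first by rewrite ltxx.
  exact: le_sup.
by rewrite lerD// E.
Qed.

End BoundedMapMetric.

(** * Charts of the space of bounded maps *)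

Section Manifold.
Context {R : realType} (X Y : topologicalType) (dX : X -> X -> R) (dY : Y -> Y -> R) (n : nat).
Hypotheses (mX : is_metric dX) (mY : is_metric dY).
Hypothesis openX : forall U : set X, open U <-> dist_open dX U.
Hypothesis openY : forall U : set Y, open U <-> dist_open dY U.
Hypothesis sepX : separable X.
Hypothesis noncompactX : ~ compact [set: X].
Hypothesis n0 : (0 < n)%N.
Hypothesis charts : forall p : Y, exists (r rho L : R) (phi : Y -> 'I_n -> R)
  (psi : ('I_n -> R) -> Y), [/\ 0 < r, 0 < rho & 0 <= L] /\
  [/\ forall y z i, dY p y < r -> dY p z < r -> `|phi y i - phi z i| <= L * dY y z,
      forall y, dY p y < r -> psi (phi y) = y,
      forall u i, (forall i, `|u i - phi p i| < rho) -> phi (psi u) i = u i &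
      forall u v (c : R), (forall i, `|u i - phi p i| < rho) ->
        (forall i, `|v i - phi p i| < rho) -> (forall i, `|u i - v i| <= c) ->
        0 <= c -> dY (psi u) (psi v) <= L * c].
Hypothesis covers : forall (rad : Y -> R) (A : set Y), (forall p, 0 < rad p) ->
  dist_bounded dY A -> exists s : seq Y, forall y, A y -> exists2 p, p \in s & dY p y < rad p.

Local Notation CB := (bounded_map X dY).
Local Notation dCB := (@bmap_dist R X Y dY).

Lemma local_model (f0 : CB) : exists (V : set (ell2_vec R (set nat))) (U : set CB) f g,
  [/\ dist_open dCB U, U f0, dist_open (@ell2_dist R (set nat)) V &
   mhomeo U dCB V (@ell2_dist R (set nat)) f g].
Proof.
have [x0 _] : exists x : X, True.
  apply: contrapT => nX; apply: noncompactX.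
  rewrite (_ : [set: X] = set0); first exact: compact0.
  by apply/seteqP; split=> // x _; apply: nX; exists x.
have f0c : mcont setT dX dY f0.
  by apply/(continuous_mcont f0 mX mY openX openY); exact: bmap_continuous.
have /choice[ch chP] : forall p : Y, exists c : R * R * R * (Y -> 'I_n -> R) * (('I_n -> R) -> Y),
    let: (r, rho, L, phi, psi) := c in
    [/\ 0 < r, 0 < rho & 1 <= L] /\
    [/\ forall y z i, dY p y < r -> dY p z < r -> `|phi y i - phi z i| <= L * dY y z,
      forall y, dY p y < r -> psi (phi y) = y,
      forall u i, (forall i, `|u i - phi p i| < rho) -> phi (psi u) i = u i &
      forall u v (c : R), (forall i, `|u i - phi p i| < rho) ->
        (forall i, `|v i - phi p i| < rho) -> (forall i, `|u i - v i| <= c) ->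
        0 <= c -> dY (psi u) (psi v) <= L * c].
  move=> p; have [r [rho [L [phi [psi [[r0 rho0 L0] [h1 h2 h3 h4]]]]]]] := charts p.
  exists (r, rho, L + 1, phi, psi); split; [by split=> //; lra|split=> //].
    move=> y z i py pz; apply: (le_trans (h1 _ _ i py pz)).
    by rewrite ler_wpM2r ?is_metric_ge0//; lra.
  move=> u v c hu hv uv c0; apply: (le_trans (h4 _ _ _ hu hv uv c0)).
  by rewrite ler_wpM2r//; lra.
pose r p := (ch p).1.1.1.1; pose rho p := (ch p).1.1.1.2; pose Lp p := (ch p).1.1.2.
pose phi p := (ch p).1.2; pose psi p := (ch p).2.
have {}chP p : [/\ 0 < r p, 0 < rho p & 1 <= Lp p] /\
    [/\ forall y z i, dY p y < r p -> dY p z < r p -> `|phi p y i - phi p z i| <= Lp p * dY y z,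
      forall y, dY p y < r p -> psi p (phi p y) = y,
      forall u i, (forall i, `|u i - phi p p i| < rho p) -> phi p (psi p u) i = u i &
      forall u v (c : R), (forall i, `|u i - phi p p i| < rho p) ->
        (forall i, `|v i - phi p p i| < rho p) -> (forall i, `|u i - v i| <= c) ->
        0 <= c -> dY (psi p u) (psi p v) <= Lp p * c].
  by have := chP p; rewrite /r /rho /Lp /phi /psi; case: (ch p) => [[[[? ?] ?] ?] ?].
(* A third of [r p] lets maps within [rad] of [f0] stay in the chart; the second bound keeps the
   coordinates of the cell within half of [rho p] of the centre. *)
pose rad p := Num.min (r p / 3) (rho p / (2 * (Lp p + 1))).
have rad0 p : 0 < rad p.
  by have [[? ? ?] _] := chP p; rewrite lt_min !divr_gt0//; lra.
have [s sP] := covers rad0 (bmap_bounded f0).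
have [y0 y0s] : exists y, y \in s.
  by have [|p ps _] := sP (f0 x0); [exists x0|exists p].
pose m := size s; pose pt k := nth y0 s k.
pose C k : set X := [set x | dY (pt k) (f0 x) <= rad (pt k)].
have Cclosed k : mclosed dX (C k).
  move=> x /negP; rewrite -ltNge => lt.
  have e0 : 0 < dY (pt k) (f0 x) - rad (pt k) by rewrite subr_gt0.
  have [d d0 H] := f0c x _ Logic.I e0; exists d => // y /(H y Logic.I) xy.
  apply/negP; rewrite -ltNge.
  by have := is_metric_tri mY (pt k) (f0 y) (f0 x); rewrite (is_metric_sym mY (f0 y)); lra.
have Ccover x : exists2 k, (k < m)%N & C k x.
  have [|p ps lt] := sP (f0 x); first by exists x.
  exists (index p s); first by rewrite index_mem.
  by rewrite /C /= /pt nth_index// ltW.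
have [e0 e0_gt0 e0P] : exists2 e : R, 0 < e & forall k, (k < m)%N -> e <= rad (pt k).
  have [d d0 dP] := @fin_min R 'I_m (fun k => rad (pt k)) (fun k => rad0 _).
  by exists d => // k km; exact: (dP (Ordinal km)).
have [r0 r0_gt0 r0P] : exists2 e : R, 0 < e & forall k, (k < m)%N -> e <= rho (pt k) / 2.
  have h k : 0 < rho (pt k) / 2 by rewrite divr_gt0//; have [[]] := chP (pt k).
  have [d d0 dP] := @fin_min R 'I_m (fun k => rho (pt k) / 2) (fun k => h _).
  by exists d => // k km; exact: (dP (Ordinal km)).
pose L := \sum_(k < m) Lp (pt k) + 1.
have Lpge p : 0 <= Lp p by have [[_ _ ?] _] := chP p; lra.
have L1 : 1 <= L by rewrite /L lerDr sumr_ge0.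
have LP k : (k < m)%N -> Lp (pt k) <= L.
  move=> km; rewrite /L (bigD1 (Ordinal km))//= -addrA lerDl addr_ge0// sumr_ge0//.
have near_r k x y : (k < m)%N -> C k x -> dY (f0 x) y < e0 -> dY (pt k) y < r (pt k).
  move=> km Cx xy; have := is_metric_tri mY (pt k) (f0 x) y.
  have : rad (pt k) <= r (pt k) / 3 by rewrite ge_min lexx.
  have := e0P _ km; have [[? ? ?] _] := chP (pt k).
  by move: Cx; rewrite /C /=; lra.
have phi_lip k x y z i : (k < m)%N -> C k x -> dY (f0 x) y < e0 -> dY (f0 x) z < e0 ->
    `|phi (pt k) y i - phi (pt k) z i| <= L * dY y z.
  move=> km Cx xy xz; have [_ [h _ _ _]] := chP (pt k).
  apply: (le_trans (h y z i (near_r _ _ _ km Cx xy) (near_r _ _ _ km Cx xz))).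
  by rewrite ler_wpM2r ?is_metric_ge0// LP.
have phiK k x y : (k < m)%N -> C k x -> dY (f0 x) y < e0 -> psi (pt k) (phi (pt k) y) = y.
  by move=> km Cx xy; have [_ [_ h _ _]] := chP (pt k); apply/h/near_r/xy.
have box k x (u : 'I_n -> R) : (k < m)%N -> C k x -> (forall i, `|u i - phi (pt k) (f0 x) i| < r0) ->
    forall i, `|u i - phi (pt k) (pt k) i| < rho (pt k).
  move=> km Cx hu i; have [[rp rhop L1p] [h _ _ _]] := chP (pt k).
  have xr : dY (pt k) (f0 x) < r (pt k).
    by apply: (near_r k x) => //; rewrite (is_metric_refl mY).
  have pr : dY (pt k) (pt k) < r (pt k) by rewrite (is_metric_refl mY).
  have h1 := h _ _ i xr pr; rewrite (is_metric_sym mY) in h1.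
  have h2 : Lp (pt k) * dY (pt k) (f0 x) <= rho (pt k) / 2.
    apply: (@le_trans _ _ (Lp (pt k) * (rho (pt k) / (2 * (Lp (pt k) + 1))))).
      rewrite ler_wpM2l//; apply: (le_trans Cx); by rewrite ge_min lexx orbT.
    rewrite mulrA ler_pdivrMr; last by lra.
    by nra.
  have := ler_distD (phi (pt k) (f0 x) i) (u i) (phi (pt k) (pt k) i).
  by have := hu i; have := r0P _ km; lra.
have psiK k x u i : (k < m)%N -> C k x -> (forall i, `|u i - phi (pt k) (f0 x) i| < r0) ->
    phi (pt k) (psi (pt k) u) i = u i.
  by move=> km Cx hu; have [_ [_ _ h _]] := chP (pt k); apply/h/(box k x).
have psi_lip k x u v (c : R) : (k < m)%N -> C k x ->
    (forall i, `|u i - phi (pt k) (f0 x) i| < r0) ->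
    (forall i, `|v i - phi (pt k) (f0 x) i| < r0) ->
    (forall i, `|u i - v i| <= c) -> 0 <= c -> dY (psi (pt k) u) (psi (pt k) v) <= L * c.
  move=> km Cx hu hv uv c0; have [_ [_ _ _ h]] := chP (pt k).
  apply: (le_trans (h _ _ _ (box _ _ _ km Cx hu) (box _ _ _ km Cx hv) uv c0)).
  by rewrite ler_wpM2r// LP.
pose E := @cell_maps R X dX n m C.
pose toC := to_cells dX f0 m C (fun k => phi (pt k)).
pose fromC h := from_cells dX f0 C (fun k => phi (pt k)) (fun k => psi (pt k)) h m.
pose l := lipc L m.
have l0 : 0 <= l.
  by rewrite /l; elim: (m) => //= k IH; rewrite addr_ge0 ?mulr_ge0//; lra.
pose delta := Num.min (e0 / (2 * (l + 1))) (r0 / (2 * (1 + L * l))).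
have Ll : 0 <= L * l by rewrite mulr_ge0//; lra.
have delta0 : 0 < delta by rewrite lt_min !divr_gt0//; lra.
have delta_e0 : l * delta < e0.
  apply: (@le_lt_trans _ _ (l * (e0 / (2 * (l + 1))))).
    by rewrite ler_wpM2l// ge_min lexx.
  rewrite mulrA ltr_pdivrMr; last by lra.
  by nra.
have delta_r0 : (1 + L * l) * delta < r0.
  apply: (@le_lt_trans _ _ ((1 + L * l) * (r0 / (2 * (1 + L * l))))).
    by rewrite ler_wpM2l ?ge_min ?lexx ?orbT//; lra.
  rewrite mulrA ltr_pdivrMr; last by lra.
  by nra.
have bE : banach E (@sup_norm R _) by exact: banach_cell_maps.
have [D countD denseD] := sepX.
have [code codeP] := @cell_code R X dX n m mX openX D countD denseD C.
have [radm [rad1 rad2 rad3]] := @cell_rad R X dX n m mX openX D countD denseD C noncompactX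
  Cclosed Ccover n0.
have [F [Fi FH]] := @banach_homeo_l1 R _ E _ bE code codeP radm rad1 rad2 rad3.
have [F' [Fi' EH]] : exists F' Fi', mhomeo E (ndist (@sup_norm R _)) [set: ell2_vec R (set nat)]
    (@ell2_dist R (set nat)) F' Fi'.
  by do 2 eexists; exact: (mhomeo_trans FH (@mazur_homeo R (set nat))).
have Lp0 : 0 < L by exact: lt_le_trans L1.
have L40 : 0 < 4 * L by rewrite mulr_gt0.
have lp0 : 0 < l + 1 by rewrite ltr_wpDl.
(* Up to 1 the truncated metric controls the sup distance, and below [e0] the chart estimates
   apply. *)
pose e1 := Num.min 1 (e0 / 2).
have e1_gt0 : 0 < e1 by rewrite lt_min ltr01 divr_gt0.
have e1_1 : e1 <= 1 by rewrite ge_min lexx.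
have e1_e0 : e1 < e0.
  by apply: (@le_lt_trans _ _ (e0 / 2)); [rewrite ge_min lexx orbT|rewrite ltr_pdivrMr// ltr_pMr// ltr1n].
have mCB := bmap_dist_metric mY x0.
(* The bound by [delta] puts [toC f] in reach of [from_cells]; the condition on [Gb h] in [V]
   mirrors the first one, so that the two sets correspond. *)
pose U : set CB := [set f | dCB f0 f < e1 /\ sup_norm (toC f) < delta].
have mc (f : CB) : mcont setT dX dY f.
  by apply/(continuous_mcont f mX mY openX openY); exact: bmap_continuous.
have Unear (f : CB) : dCB f0 f < e1 -> forall x, dY (f0 x) (f x) <= e1.
  by move=> fU x; apply/ltW/(bmap_dist_lt mY x0 x e1_1 fU).
have Umem (f : CB) : dCB f0 f < e1 -> E (toC f).
  move=> fU.
  by have [] := to_cells_mem mX mY f0c L1 e0_gt0 Cclosed phi_lip (mc f) (ltW e1_gt0) e1_e0 (Unear _ fU).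
have toC_lip (f f' : CB) (c : R) : dCB f0 f < e1 -> dCB f0 f' < e1 -> 0 <= c ->
    (forall x, dY (f x) (f' x) <= c) -> sup_norm (toC f - toC f') <= 2 * L * c.
  move=> fU f'U c0 ff'; apply: sup_norm_le; first by rewrite !mulr_ge0// ltW.
  exact: (to_cells_lip mX mY L1 e0_gt0 Cclosed phi_lip e1_e0 (Unear _ fU) (Unear _ f'U) c0 ff').
have sb h : E h -> sup_bounded h by case.
have /choice[Gb GbP] : forall h, exists G : CB, E h -> sup_norm h < delta ->
    forall x, G x = fromC h x.
  move=> h; have [[Eh hd]|nh] := pselect (E h /\ sup_norm h < delta); last first.
    by exists f0 => Eh hd; case: nh.
  have hb p : `|h p| <= sup_norm h by apply: sup_norm_ub; exact: sb.
  have h0 := sup_norm_ge0 (sb _ Eh).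
  have fcont : mcont setT dX dY (fromC h).
    have H := from_cells_cont mX mY f0c L1 e0_gt0 r0_gt0 Cclosed phi_lip phiK psi_lip
      delta_e0 delta_r0 h0 hd hb Eh (leqnn m).
    by apply: (mcont_sub _ H) => x _; have [k km Ck] := Ccover x; exists k.
  have fc : continuous (fromC h) by apply/(continuous_mcont _ mX mY openX openY).
  have fn x := from_cells_near mX mY L1 e0_gt0 r0_gt0 Cclosed phi_lip phiK psi_lip
      delta_e0 delta_r0 h0 hd hb x (leqnn m).
  have fb : dist_bounded dY (range (fromC h)).
    have [M MP] := bmap_bounded f0; exists (l * sup_norm h + M + l * sup_norm h).
    move=> _ _ [x _ <-] [y _ <-].
    have t1 := is_metric_tri mY (fromC h x) (f0 x) (fromC h y).
    have t2 := is_metric_tri mY (f0 x) (f0 y) (fromC h y).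
    have t3 : dY (f0 x) (f0 y) <= M by apply: MP; [exists x|exists y].
    have := fn x; have := fn y; rewrite -/(fromC h) (is_metric_sym mY (f0 x)) /l /fromC.
    by rewrite /fromC in t1 t2; move: t1 t2 t3; clear; lra.
  by exists (BoundedMap fc fb).
have GbE h : E h -> sup_norm h < delta -> forall x, Gb h x = fromC h x := GbP h.
pose V : set (nat * X * 'I_n -> R^o) :=
  [set h | [/\ E h, sup_norm h < delta & dCB f0 (Gb h) < e1]].
have Gb_lip h h' (c : R) : E h -> E h' -> sup_norm h < delta -> sup_norm h' < delta ->
    sup_norm (h' - h) <= c -> 0 <= c -> dCB (Gb h) (Gb h') <= l * c.
  move=> Eh Eh' hd h'd hc c0; apply: (bmap_dist_le x0) => x; rewrite !GbE//.
  pose b := Num.max (sup_norm h) (sup_norm h').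
  have b0 : 0 <= b by rewrite le_max (sup_norm_ge0 (sb _ Eh)).
  have bd : b < delta by rewrite gt_max hd.
  have hb p : `|h p| <= b by rewrite le_max sup_norm_ub//; exact: sb.
  have hb' p : `|h' p| <= b by rewrite le_max orbC sup_norm_ub//; exact: sb.
  have hh p : `|h p - h' p| <= c.
    rewrite distrC; apply: le_trans hc.
    apply: (sup_norm_ub (h := h' - h) p); apply: sb; exact: (sn_memB bE).
  exact: (from_cells_lip mX mY L1 e0_gt0 r0_gt0 Cclosed phi_lip phiK psi_lip
      delta_e0 delta_r0 b0 bd hb hb' c0 hh x (leqnn m)).
have GbtoC (f : CB) : U f -> Gb (toC f) = f.
  move=> [fU fd]; apply: bounded_map_ext => x; rewrite GbE//; last exact: Umem.
  have XX := @to_cellsK R X Y dX dY n f0 m C (fun k => phi (pt k)) (fun k => psi (pt k)) e0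
    Ccover phiK f e1 e1_e0 (Unear _ fU).
  rewrite /fromC /toC.
  by rewrite XX.
have toCGb h : E h -> sup_norm h < delta -> toC (Gb h) = h.
  move=> Eh hd; have hb p : `|h p| <= sup_norm h by apply: sup_norm_ub; exact: sb.
  have h0 := sup_norm_ge0 (sb _ Eh).
  rewrite /toC (_ : bmap (Gb h) = fromC h); last by apply/funext => x; exact: GbE.
  exact: (from_cellsK mX mY L1 e0_gt0 r0_gt0 Cclosed phi_lip phiK psiK psi_lip
      delta_e0 delta_r0 h0 hd hb Eh).
have UV : mhomeo U dCB V (ndist (@sup_norm R _)) toC Gb.
  split; first split.
  - by move=> f Uf; have [fU fd] := Uf; split=> //; [exact: Umem|rewrite GbtoC].
  - by move=> h [Eh hd hU]; split=> //; rewrite toCGb.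
  - exact: GbtoC.
  - by move=> h [Eh hd _]; exact: toCGb.
  split.
    move=> f e [fU fd] e_gt0.
    have d0 : 0 < Num.min 1 (e / (4 * L)) by rewrite lt_min ltr01 divr_gt0.
    exists (Num.min 1 (e / (4 * L))) => // f' [f'U _] ff'.
    have ff x : dY (f' x) (f x) <= e / (4 * L).
      rewrite (is_metric_sym mY); have h1 : Num.min 1 (e / (4 * L)) <= 1 by rewrite ge_min lexx.
      by have := bmap_dist_lt mY x0 x h1 ff'; rewrite lt_min => /andP[_ /ltW].
    have q0 : 0 <= e / (4 * L) by rewrite ltW// divr_gt0.
    apply: (le_lt_trans (toC_lip _ _ _ f'U fU q0 ff)).
    have -> : 2 * L * (e / (4 * L)) = e / 2 by field; rewrite gt_eqF.
    by rewrite ltr_pdivrMr// ltr_pMr// ltr1n.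
  move=> h e [Eh hd _] e_gt0; exists (e / (l + 1)); first by rewrite divr_gt0.
  move=> h' [Eh' h'd _] hh'.
  have q0 : 0 <= e / (l + 1) by rewrite ltW// divr_gt0.
  apply: (le_lt_trans (Gb_lip _ _ _ Eh Eh' hd h'd (ltW hh') q0)).
  by rewrite mulrA ltr_pdivrMr// mulrDr mulr1 mulrC ltrDl.
have Uopen : dist_open dCB U.
  move=> f [fU fd].
  exists (Num.min (e1 - dCB f0 f) (Num.min 1 ((delta - sup_norm (toC f)) / (4 * L)))).
    by rewrite !lt_min subr_gt0 fU ltr01/= divr_gt0 ?subr_gt0.
  move=> f'; rewrite !lt_min => /and3P[h1 h2 h3].
  have f'U : dCB f0 f' < e1.
    by apply: (le_lt_trans (is_metric_tri mCB f0 f f')); rewrite -ltrBrDl.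
  split=> //; set c := (delta - _) / _ in h3.
  have c0 : 0 < c by apply: le_lt_trans h3; exact: is_metric_ge0.
  have ff x : dY (f' x) (f x) <= c.
    rewrite (is_metric_sym mY).
    have m1 : Num.min 1 c <= 1 by rewrite ge_min lexx.
    have m2 : dCB f f' < Num.min 1 c by rewrite lt_min h2.
    by have := bmap_dist_lt mY x0 x m1 m2; rewrite lt_min => /andP[_ /ltW].
  have := toC_lip _ _ _ f'U fU (ltW c0) ff.
  have -> : 2 * L * c = (delta - sup_norm (toC f)) / 2 by rewrite /c; field; rewrite gt_eqF.
  by move: fd (sn_suble bE (Umem _ f'U) (Umem _ fU)); clear; lra.
have Uf0 : U f0.
  have z : dCB f0 f0 = 0 by exact: is_metric_refl.
  split; first by rewrite z.
  have fn x : dY (f0 x) (f0 x) <= 0 by rewrite (is_metric_refl mY).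
  have [_ H] := to_cells_mem mX mY f0c L1 e0_gt0 Cclosed phi_lip f0c (lexx 0) e0_gt0 fn.
  apply: le_lt_trans delta0; apply: sup_norm_le => // p.
  by apply: (le_trans (H p)); rewrite mulr0.
(* Openness is relative to [E]; the homeomorphism of [E] with l2 turns it into openness in l2. *)
have Vopen h : V h -> exists2 e, 0 < e & forall h', E h' -> ndist (@sup_norm R _) h h' < e -> V h'.
  move=> [Eh hd hU].
  exists (Num.min (delta - sup_norm h) ((e1 - dCB f0 (Gb h)) / (l + 1))).
    by rewrite lt_min subr_gt0 hd/= divr_gt0 ?subr_gt0.
  move=> h' Eh'; rewrite lt_min => /andP[h1 h2].
  have h'd : sup_norm h' < delta.
    by move: h1 (sn_suble bE Eh' Eh); rewrite /ndist; clear; lra.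
  split=> //; have c0 : 0 <= ndist (@sup_norm R _) h h' by exact: (ndist_ge0 bE).
  have := Gb_lip _ _ _ Eh Eh' hd h'd (lexx _) c0.
  move: h2; rewrite ltr_pdivlMr//.
  have := is_metric_tri mCB f0 (Gb h) (Gb h').
  rewrite /ndist in c0 *; set N := sup_norm (h' - h) in c0 *.
  by rewrite mulrDr mulr1 (mulrC N); move: c0; clear; lra.
have [[EF FE FiF FFi] [Fc Fic]] := EH.
exists [set v | V (Fi' v)], U, (F' \o toC), (Gb \o Fi'); split=> //.
  move=> v /= Vv; have [e e_gt0 H] := Vopen _ Vv.
  have [d d0 H'] := Fic v e Logic.I e_gt0; exists d => // w vw.
  by apply: H; [exact: FE|exact: H'].
apply: (mhomeo_trans UV).
have VE h : V h -> E h by case.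
split; first split.
- by move=> h Vh /=; rewrite FiF//; exact: VE.
- by [].
- by move=> h /VE; exact: FiF.
- by move=> v _; exact: FFi.
split.
  move=> h e Vh e_gt0; have [d d0 H] := Fc h e (VE _ Vh) e_gt0; exists d => // h' /VE Eh'.
  exact: H.
move=> v e Vv e_gt0; have [d d0 H] := Fic v e Logic.I e_gt0; exists d => // w _.
exact: H.
Qed.

Theorem CB_ell2_manifold : ell2_manifold R (set nat) (CB_space X dY).
Proof.
have [x0 _] : exists x : X, True.
  apply: contrapT => nX; apply: noncompactX.
  rewrite (_ : [set: X] = set0); first exact: compact0.
  by apply/seteqP; split=> // x _; apply: nX; exists x.
have mCB := bmap_dist_metric mY x0.
split; first by exists dCB; split.
move=> f0; have [V [U [f [g [Uo Uf0 Vo [[fUV gVU gf fg] [fc gc]]]]]]] := local_model f0.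
exists U, V, f, g; split=> //; split=> //.
by split; apply: within_mcont => //; exact: ell2_dist_metric.
Qed.

End Manifold.

(** * Differential calculus in charts *)

Section Calculus.
Context {R : realType}.

Lemma rv_coord_le (n : nat) (v : 'rV[R]_n) i : `|v 0 i| <= `|v|.
Proof.
rewrite [leRHS]/Num.Def.normr/= mx_normrE.
by apply: (le_bigmax _ (fun ij => `|v ij.1 ij.2|) (0, i)).
Qed.

Lemma rv_norm_le (n : nat) (v : 'rV[R]_n) c :
  0 <= c -> (forall i, `|v 0 i| <= c) -> `|v| <= c.
Proof.
move=> c0 H; rewrite [leLHS]/Num.Def.normr/= mx_normrE bigmax_le// => -[a i] _ /=.
by rewrite ord1.
Qed.

Lemma near_forall (T : topologicalType) (x : T) (I : finType) (P : I -> T -> Prop) :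
  (forall i, \forall y \near x, P i y) -> \forall y \near x, forall i, P i y.
Proof. by move=> H; exact: (@filter_forall T I P (nbhs x) _ H). Qed.

Lemma mvt0 (f f' : R -> R) (c : R) :
  (forall t : R, `|t| <= `|c| -> is_derive t (1 : R) f (f' t)) ->
  exists2 t, `|t| <= `|c| & f c - f 0 = f' t * c.
Proof.
move=> df.
have fc t : `|t| <= `|c| -> {for t, continuous f}.
  move=> /df dft; apply/differentiable_continuous/derivable1_diffP; exact: ex_derive.
have [c0|c0] := lerP 0 c.
  have [||t] := @MVT_segment R f f' 0 c c0.
  - by move=> t; rewrite in_itv/= => /andP[t0 tc]; apply: df; rewrite !ger0_norm// ltW.
  - apply/continuous_in_subspaceT => t; rewrite inE/= in_itv/= => /andP[t0 tc].
    by apply: fc; rewrite !ger0_norm.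
  rewrite in_itv/= subr0 => /andP[t0 tc] ->; exists t => //.
  by rewrite !ger0_norm.
have [||t] := @MVT_segment R f f' c 0 (ltW c0).
- move=> t; rewrite in_itv/= => /andP[t0 tc]; apply: df.
  by rewrite !ler0_norm ?lerN2// ltW.
- apply/continuous_in_subspaceT => t; rewrite inE/= in_itv/= => /andP[t0 tc].
  by apply: fc; rewrite !ler0_norm ?lerN2// ltW.
rewrite in_itv/= => /andP[t0 tc] H; exists t.
  by rewrite !ler0_norm ?lerN2// ltW.
by rewrite -[LHS]opprB H sub0r mulrN opprK.
Qed.

Lemma partial_line n (f : 'rV[R]_n -> R) (y e : 'rV[R]_n) t :
  derivable f (t *: e + y) e ->
  is_derive t (1 : R) (fun s => f (s *: e + y)) ('D_e f (t *: e + y)).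
Proof.
move=> fd.
have E : (fun h : R => h^-1 *: (((fun s => f (s *: e + y)) \o shift t) (h *: 1) - f (t *: e + y)))
   = (fun h => h^-1 *: ((f \o shift (t *: e + y)) (h *: e) - f (t *: e + y))).
  apply/funext => h /=; congr (_ *: (f _ - _)).
  by rewrite scalerDl [h *: 1]mulr1 addrA.
by apply: DeriveDef; rewrite /derivable /derive E.
Qed.

(* The increment is split into moves parallel to the axes, each of which is
   governed by the mean value theorem. *)
Lemma partials_frechet n (f : 'rV[R]_n -> R) (x : 'rV[R]_n) (r : R) : 0 < r ->
  (forall y i, `|y - x| < r -> derivable f y 'e_i) ->
  (forall i, {for x, continuous (fun y => 'D_('e_i) f y)}) ->
  forall e, 0 < e -> exists2 d, 0 < d & forall h : 'rV[R]_n, `|h| < d ->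
    `|f (x + h) - f x - \sum_i h 0 i * 'D_('e_i) f x| <= e * `|h|.
Proof.
move=> r0 fd fc e e0.
pose e1 := e / (n%:R + 1).
have n1 : 0 < n%:R + 1 :> R by rewrite ltr_wpDl.
have e10 : 0 < e1 by rewrite divr_gt0.
have [d d0 H] : exists2 d, 0 < d & forall i y, `|y - x| < d ->
    `|'D_('e_i) f y - 'D_('e_i) f x| <= e1.
  have : \forall y \near x, forall i : 'I_n, `|'D_('e_i) f y - 'D_('e_i) f x| <= e1.
    apply: near_forall => i.
    have /cvgrPdist_le /(_ e1 e10) := fc i.
    by apply: filterS => y; rewrite distrC.
  move=> /nbhs_ballP[d d0 dH]; exists d => // i y yx; apply: dH.
  by rewrite -ball_normE /ball_/= distrC.
exists (Num.min d r); first by rewrite lt_min d0.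
move=> h; rewrite lt_min => /andP[hd hr].
pose hk (k : nat) : 'rV[R]_n := \row_j (if (j < k)%N then h 0 j else 0).
have hkS (k : 'I_n) : hk k.+1 = h 0 k *: 'e_k + hk k.
  apply/rowP => j; rewrite !mxE eqxx /= ltnS leq_eqVlt.
  rewrite -(inj_eq val_inj j k)/=; have [/val_inj->|jk] := eqVneq (j : nat) k.
    by rewrite ltnn mulr1 addr0.
  by rewrite mulr0 add0r.
have hkn : hk n = h by apply/rowP => j; rewrite mxE ltn_ord.
have hk0 : hk 0%N = 0 by apply/rowP => j; rewrite !mxE.
have near_hk (k : 'I_n) t : `|t| <= `|h 0 k| -> `|t *: 'e_k + (x + hk k) - x| <= `|h|.
  move=> th; rewrite (addrC x) addrA addrK; apply: rv_norm_le => // j.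
  rewrite !mxE eqxx /=; have [->|jk] := eqVneq j k.
    by rewrite ltnn mulr1 addr0 (le_trans th)// rv_coord_le.
  by rewrite mulr0 add0r; case: ifP => _; rewrite ?normr0// rv_coord_le.
have step (k : 'I_n) : `|f (x + hk k.+1) - f (x + hk k) - h 0 k * 'D_('e_k) f x| <= e1 * `|h|.
  have [t th E] := @mvt0 (fun s => f (s *: 'e_k + (x + hk k))) (fun t => 'D_('e_k) f (t *: 'e_k + (x + hk k))) (h 0 k)
    (fun t th => partial_line (fd _ _ (le_lt_trans (near_hk k t th) hr))).
  rewrite hkS addrCA; move: E => /=; rewrite scale0r add0r => ->.
  rewrite [h 0 k * _]mulrC -mulrBl normrM ler_pM//; last exact: rv_coord_le.
  exact: H (le_lt_trans (near_hk k t th) hd).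
have -> : f (x + h) - f x - \sum_i h 0 i * 'D_('e_i) f x =
    \sum_(k < n) (f (x + hk k.+1) - f (x + hk k) - h 0 k * 'D_('e_k) f x).
  rewrite sumrB; congr (_ - _).
  rewrite -(big_mkord xpredT (fun k => f (x + hk k.+1) - f (x + hk k))).
  by rewrite telescope_sumr// hkn hk0 addr0.
apply: (le_trans (ler_norm_sum _ _ _)).
apply: (@le_trans _ _ (\sum_(k < n) e1 * `|h|)); first by apply: ler_sum => k _; exact: step.
rewrite sumr_const card_ord -mulr_natl mulrA ler_wpM2r//.
by rewrite /e1 mulrA ler_pdivrMr// mulrC ler_pM2l// lerDl.
Qed.

Lemma mulmxr_continuous n m (J : 'M[R]_(n, m)) : continuous (mulmxr J : 'rV[R]_n -> 'rV[R]_m).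
Proof.
move=> x; apply/(@cvgrPdist_le _ _ _ (nbhs x)) => e e0.
pose K := \sum_i \sum_j `|J i j|.
have K0 : 0 <= K by apply: sumr_ge0 => i _; apply: sumr_ge0.
apply/nbhs_ballP; exists (e / (K + 1)); first by rewrite /= divr_gt0// ltr_wpDl.
move=> y; rewrite -ball_normE /ball_/= => xy.
rewrite -mulmxBl; apply: rv_norm_le; first exact: ltW.
move=> j; rewrite mxE; apply: (le_trans (ler_norm_sum _ _ _)).
apply: (@le_trans _ _ (\sum_i `|x - y| * `|J i j|)).
  by apply: ler_sum => i _; rewrite normrM ler_wpM2r// rv_coord_le.
rewrite -mulr_sumr; apply: (@le_trans _ _ (`|x - y| * K)).
  rewrite ler_wpM2l//; apply: ler_sum => i _.
  by rewrite (bigD1 j)//= lerDl sumr_ge0.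
move: xy; rewrite ltr_pdivlMr ?ltr_wpDl// mulrDr mulr1 => xy.
by apply: ltW; apply: le_lt_trans xy; rewrite lerDl.
Qed.

(** Continuous partial derivatives give a first-order expansion of each component, and uniqueness of
    the differential identifies it with the matrix [J] of partials. *)
Lemma Ck1_differentiable n m (U : set 'rV[R]_n) (f : 'rV[R]_n -> 'rV[R]_m) x :
  open U -> U x -> Ck_on 1 U f -> differentiable f x.
Proof.
move=> oU Ux [fcont fC].
have [r r0 rU] : exists2 r, 0 < r & forall y, `|y - x| < r -> U y.
  have /nbhs_ballP[r r0 H] := open_nbhs_nbhs (conj oU Ux).
  by exists r => // y yx; apply: H; rewrite -ball_normE /ball_/= distrC.
pose J : 'M[R]_(n, m) := \matrix_(i, a) ('D_('e_i) f x) 0 a.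
have fd y i : U y -> derivable f y 'e_i by move=> Uy; have [+ _] := fC i; apply.
have fda y i a : U y -> derivable (fun z => f z 0 a) y 'e_i.
  by move=> /(fd _ i) /derivable_mxP /(_ 0 a).
have fDa y i a : U y -> 'D_('e_i) (fun z => f z 0 a) y = ('D_('e_i) f y) 0 a.
  by move=> /(fd _ i) /derive_mx ->; rewrite mxE.
have est e : 0 < e -> \forall h \near (0 : 'rV[R]_n), `|f (x + h) - f x - h *m J| <= e * `|h|.
  move=> e0.
  have : \forall h \near (0 : 'rV[R]_n), forall a : 'I_m, `|(f (x + h) - f x - h *m J) 0 a| <= e * `|h|.
    apply: near_forall => a.
    have [||d d0 H] := @partials_frechet n (fun z => f z 0 a) x r r0 _ _ e e0.
    - by move=> y i /rU; exact: fda.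
    - move=> i; have [_ [+ _]] := fC i => /(_ x Ux) Dc.
      apply/(@cvgrPdist_lt _ _ _ (nbhs x)) => e' e'0; move/(@cvgrPdist_lt _ _ _ (nbhs x)) : Dc => /(_ e' e'0) Dc.
      near=> y.
      have Uy : U y.
        apply: rU; rewrite distrC; near: y; apply/nbhs_ballP; exists r => // z.
        by rewrite -ball_normE.
      rewrite !fDa//.
      have : `|'D_('e_i) f x - 'D_('e_i) f y| < e' by near: y.
      by apply: le_lt_trans; have := rv_coord_le ('D_('e_i) f x - 'D_('e_i) f y) a; rewrite !mxE.
    apply/nbhs_ballP; exists d => // h; rewrite -ball_normE /ball_/= sub0r normrN => /H.
    congr (`|_| <= _); rewrite !mxE; congr (_ - _); apply: eq_bigr => i _.
    by rewrite fDa// mxE.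
  apply: filterS => h hH; apply: rv_norm_le => //.
  by rewrite mulr_ge0// ltW.
apply/diff_locallyP.
have HH : f \o shift x = cst (f x) + mulmxr J +o_ (0 : 'rV[R]_n) id.
  apply/eqaddoP => e e0; apply: filterS (est e e0) => h /=.
  have -> // : (f \o shift x - (cst (f x) + mulmxr J)) h = f (x + h) - f x - h *m J.
  by rewrite (addrC x) -addrA -opprD.
have dE := diff_unique (@mulmxr_continuous n m J) HH.
by rewrite dE; split => //; exact: mulmxr_continuous.
Unshelve. all: by end_near. Qed.

Lemma derive1_chain n m (f : 'rV[R]_n -> 'rV[R]_m) (c : R -> 'rV[R]_n) s :
  derivable c s 1 -> differentiable f (c s) ->
  derivable (f \o c) s 1 /\ derive1 (f \o c) s = 'D_(derive1 c s) f (c s).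
Proof.
move=> /derivable1_diffP cd fd; have fcd := differentiable_comp cd fd.
split; first by apply/derivable1_diffP.
by rewrite derive1E'// diff_comp//= deriveE// derive1E'.
Qed.

Lemma derive_rowE n m (f : 'rV[R]_n -> 'rV[R]_m) x (v : 'rV[R]_n) :
  differentiable f x -> 'D_v f x = \sum_i v 0 i *: 'D_('e_i) f x.
Proof.
move=> fd; rewrite deriveE// {1}[v]row_sum_delta linear_sum; apply: eq_bigr => i _.
by rewrite linearZ /= deriveE.
Qed.

End Calculus.

Section QuadraticForms.
Context {R : realType}.

Lemma cvg_sum_fin (V : normedModType R) (T : Type) (F : set_system T) (FF : Filter F)
    (I : finType) (f : I -> T -> V) (a : I -> V) :
  (forall i, f i x @[x --> F] --> a i) ->
  \sum_i f i x @[x --> F] --> \sum_i a i.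
Proof.
move=> H; rewrite (_ : (fun x => _) = \sum_i f i); last first.
  by apply/funext => x; rewrite fct_sumE.
apply: (big_ind2 (fun (u : T -> V) v => u @ F --> v)) => //; first exact: cvg_cst.
by move=> u1 v1 u2 v2 h1 h2; exact: cvgD.
Qed.

Lemma qformE n (G : 'M[R]_n) (u v : 'rV[R]_n) :
  qform G u v = \sum_a \sum_b u 0 a * G a b * v 0 b.
Proof.
rewrite /qform mxE exchange_big /=; apply: eq_bigr => b _.
by rewrite !mxE mulr_suml.
Qed.

Lemma qform_cvg (T : Type) (F : set_system T) (FF : Filter F) n (G : T -> 'M[R]_n)
    (v : T -> 'rV[R]_n) (G0 : 'M[R]_n) (v0 : 'rV[R]_n) :
  (forall a b, G x a b @[x --> F] --> G0 a b) ->
  (forall a, v x 0 a @[x --> F] --> v0 0 a) ->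
  qform (G x) (v x) (v x) @[x --> F] --> qform G0 v0 v0.
Proof.
move=> hG hv; rewrite (_ : (fun x => _) = fun x => \sum_a \sum_b v x 0 a * G x a b * v x 0 b).
  rewrite qformE; apply: (@cvg_sum_fin R^o) => a; apply: (@cvg_sum_fin R^o) => b.
  by apply: cvgM => //; exact: cvgM.
by apply/funext => x; rewrite qformE.
Qed.

End QuadraticForms.

(** * Chart independence and continuity of the speed *)

Section Charts.
Variables (R : realType) (n : nat) (Y : topologicalType) (M : smooth_manifold R n Y).
Implicit Types i j : chart_idx M.

Lemma chart_mem i y : chart_dom i y -> chart_cod i (chart i y).
Proof. by have [[+ _ _ _] _] := chart_homeo i; apply. Qed.

Lemma chart_inv_mem i x : chart_cod i x -> chart_dom i (chart_inv i x).
Proof. by have [[_ + _ _] _] := chart_homeo i; apply. Qed.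

Lemma chartK i y : chart_dom i y -> chart_inv i (chart i y) = y.
Proof. by have [[_ _ + _] _] := chart_homeo i; apply. Qed.

Lemma chart_invK i x : chart_cod i x -> chart i (chart_inv i x) = x.
Proof. by have [[_ _ _ +] _] := chart_homeo i; apply. Qed.

Lemma chart_continuous i y : chart_dom i y -> {for y, continuous (chart i)}.
Proof.
move=> yi; have [_ []] := chart_homeo i.
rewrite (continuous_open_subspace _ (chart_dom_open i)) => + _.
by apply; rewrite inE.
Qed.

Lemma chart_inv_continuous i x : chart_cod i x -> {for x, continuous (chart_inv i)}.
Proof.
move=> xi; have [_ [_]] := chart_homeo i.
rewrite (continuous_open_subspace _ (@chart_cod_open _ _ _ M i)); apply.
by rewrite inE.
Qed.

Lemma transition_domE i j : chart i @` (chart_dom i `&` chart_dom j) =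
  [set x | chart_cod i x /\ chart_dom j (chart_inv i x)].
Proof.
apply/seteqP; split=> [_ [y [yi yj] <-]|x [xi xj]] /=.
  by split; [exact: chart_mem|rewrite chartK].
by exists (chart_inv i x); [split=> //; exact: chart_inv_mem|exact: chart_invK].
Qed.

Lemma transition_dom_open i j : open (chart i @` (chart_dom i `&` chart_dom j)).
Proof.
rewrite transition_domE openE => x [xi xj].
apply: filterI; first exact: open_nbhs_nbhs (conj (@chart_cod_open _ _ _ M i) xi).
apply: (chart_inv_continuous xi); exact: open_nbhs_nbhs (conj (chart_dom_open j) xj).
Qed.

Lemma transition_Ck1 i j :
  Ck_on 1 (chart i @` (chart_dom i `&` chart_dom j)) (chart j \o chart_inv i).
Proof. exact: chart_transition_smooth. Qed.

Lemma transition_differentiable i j y : chart_dom i y -> chart_dom j y ->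
  differentiable (chart j \o chart_inv i) (chart i y).
Proof.
move=> yi yj; have H : (chart i @` (chart_dom i `&` chart_dom j)) (chart i y) by exists y.
exact: (@Ck1_differentiable R n n _ _ _ (@transition_dom_open i j) H (transition_Ck1 i j)).
Qed.

Lemma near_dom i (c : R -> Y) s : {for s, continuous c} -> chart_dom i (c s) ->
  \forall r \near s, chart_dom i (c r).
Proof. by move=> cs ci; apply: cs; exact: open_nbhs_nbhs (conj (chart_dom_open i) ci). Qed.

(** The chain rule through the transition map; with [gram_transition] it makes the speed independent
    of the chart. *)
Lemma chart_switch i j (c : R -> Y) (s : R) :
  {for s, continuous c} -> chart_dom i (c s) -> chart_dom j (c s) ->
  derivable (chart i \o c) s 1 ->
  derivable (chart j \o c) s 1 /\
  derive1 (chart j \o c) s = 'D_(derive1 (chart i \o c) s) (chart j \o chart_inv i) (chart i (c s)).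
Proof.
move=> cs ci cj di.
have [d1 d2] := derive1_chain di (transition_differentiable ci cj).
have E : {near s, ((chart j \o chart_inv i) \o (chart i \o c)) =1 (chart j \o c)}.
  by apply: filterS (near_dom cs ci) => r ri /=; rewrite chartK.
split; first exact: (near_eq_derivable E d1).
by rewrite -d2 !derive1E; apply/esym/near_eq_derive.
Qed.

Variable g : riemannian_metric M.

Lemma speedE i (c : R -> Y) (s : R) :
  {for s, continuous c} -> chart_dom i (c s) -> derivable (chart i \o c) s 1 ->
  speed g c s = Num.sqrt (qform (gram g i (chart i (c s)))
    (derive1 (chart i \o c) s) (derive1 (chart i \o c) s)).
Proof.
move=> cs ci di; rewrite /speed /=.
have cj := mem_chart_at M (c s).
have [_ ->] := chart_switch cs ci cj di.
by rewrite -(gram_transition g).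
Qed.

Lemma speed_ge0 (c : R -> Y) s : 0 <= speed g c s.
Proof. exact: sqrtr_ge0. Qed.

Lemma gram_continuous i x a b : chart_cod i x -> {for x, continuous (fun x => gram g i x a b)}.
Proof. by move=> xi; have [+ _] := gram_smooth g i a b 0; apply. Qed.

Lemma C1_at_continuous (c : R -> Y) t : C1_at M c t -> {for t, continuous c}.
Proof. by move=> [/nbhs_singleton]. Qed.

(** [speed] uses the chart selected at [c s], which may jump with [s]. Near [t] it agrees with the
    expression in the one chart selected at [t], which is continuous. *)
Lemma speed_continuous (c : R -> Y) t : C1_at M c t -> {for t, continuous (speed g c)}.
Proof.
move=> cC; have ct := C1_at_continuous cC; have [cn cd] := cC.
pose i := chart_at M (c t); have ci : chart_dom i (c t) := mem_chart_at M (c t).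
have [dn dc] := cd i ci.
have E : {near t, (fun s => Num.sqrt (qform (gram g i (chart i (c s)))
    (derive1 (chart i \o c) s) (derive1 (chart i \o c) s))) =1 speed g c}.
  near=> s; apply/esym/speedE; [near: s; exact: cn| |near: s; exact: dn].
  by near: s; exact: near_dom.
have E0 := nbhs_singleton E; rewrite /prop_for /continuous_at -E0.
apply: cvg_trans; first by apply: (near_eq_cvg E).
apply: cvg_comp; last exact: sqrt_continuous.
have cic : {for t, continuous (chart i \o c)} := continuous_comp ct (chart_continuous ci).
apply: qform_cvg => [a b|a].
  exact: (@continuous_comp _ _ _ (chart i \o c) (fun x => gram g i x a b) t cic (@gram_continuous i _ a b (chart_mem ci))).
exact: (@continuous_comp _ _ _ (derive1 (chart i \o c)) (fun v => v 0 a) t dc (@coord_continuous R 1 n 0 a _)).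
Unshelve. all: by end_near. Qed.

End Charts.

(** * Curves and the geodesic distance *)

Section Integration.
Context {R : realType}.
Notation mu := (@lebesgue_measure R).

(** Composing with the retraction [cl] onto the interval makes the integrand continuous everywhere.
    Working from [a - 1] to [b + 1] turns the endpoints into interior points, where the primitive
    has a two-sided derivative. *)
Lemma antiderivative (f : R -> R) (a b : R) : a <= b ->
  (forall t, a <= t <= b -> {for t, continuous f}) ->
  exists F : R -> R, forall t : R, a <= t <= b -> is_derive t (1 : R) F (f t).
Proof.
move=> ab fc; pose cl (t : R) := Num.max a (Num.min b t).
have clE t : a <= t <= b -> cl t = t by move=> /andP[at_ tb]; rewrite /cl min_r// max_r.
have clm t : a <= cl t <= b by rewrite /cl le_max lexx/= ge_max ab ge_min lexx.
pose h := f \o cl.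
have hc : continuous h.
  move=> t; apply: continuous_comp; last exact: fc (clm t).
  apply: (@continuous_comp _ _ _ (fun t => Num.min b t) (fun t => Num.max a t)).
    by apply: continuous_min => //; exact: cst_continuous.
  by apply: continuous_max => //; exact: cst_continuous.
exists (fun x => (\int[mu]_(t in `[(a - 1)%R, x]) h t)%R) => t /andP[at_ tb].
have [d dE] : derivable (fun x => (\int[mu]_(t in `[(a - 1)%R, x]) h t)%R) t 1 /\
    derive1 (fun x => (\int[mu]_(t in `[(a - 1)%R, x]) h t)%R) t = h t.
  apply: (@continuous_FTC1_closed R h (a - 1) t (b + 1)).
  - by apply: (le_lt_trans tb); rewrite ltrDl.
  - apply: continuous_compact_integrable; first exact: segment_compact.
    exact: continuous_subspaceT.
  - by apply: lt_le_trans at_; rewrite gtrBl.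
  - exact: hc.
apply: DeriveDef; first exact: d.
by rewrite -derive1E dE /h /= clE// at_.
Qed.

Definition has_integral (f : R -> R) (a b l : R) :=
  measurable_fun `[a, b] f /\ (\int[mu]_(x in `[a, b]) (f x)%:E = l%:E)%E.

(** Agreement on the open interval suffices, which absorbs the arbitrary speed of a curve at its
    break points. *)
Lemma has_integral_FTC (f h F : R -> R) (a b : R) : a < b ->
  (forall t : R, a <= t <= b -> is_derive t (1 : R) F (h t)) ->
  (forall t, a <= t <= b -> {for t, continuous h}) ->
  (forall t, a < t < b -> f t = h t) -> has_integral f a b (F b - F a).
Proof.
move=> ab Fd hc fh.
have hcw : {within `[a, b], continuous h}.
  by apply: continuous_in_subspaceT => t; rewrite inE/= in_itv/=; exact: hc.
have mh : measurable_fun `[a, b] h by exact: subspace_continuous_measurable_fun.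
have mho : measurable_fun `]a, b[ h by apply: measurable_funS mh => //; exact: subset_itv_oo_cc.
have hf : {in `]a, b[%classic, h =1 f} by move=> t; rewrite inE/= in_itv/= => /fh.
have mfo : measurable_fun `]a, b[ f by exact: (eq_measurable_fun _ hf).
split; first exact: measurable_fun_itv_cc mfo.
rewrite integral_itv_bndoo; last exact/measurable_EFinP.
transitivity (\int[mu]_(x in `]a, b[) (h x)%:E)%E.
  by apply: eq_integral => t /hf ->.
rewrite -(@integral_itv_bndoo _ a b _ true false); last exact/measurable_EFinP.
have Fc t : a <= t <= b -> {for t, continuous F}.
  by move=> /Fd dt; apply/differentiable_continuous/derivable1_diffP; exact: ex_derive.
rewrite (@continuous_FTC2 _ h F a b)//.
  split.
  - move=> t; rewrite in_itv/= => /andP[/ltW t1 /ltW t2].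
    by apply: ex_derive; apply: Fd; rewrite t1.
  - apply: cvg_at_right_filter; apply: Fc; by rewrite lexx ltW.
  - apply: cvg_at_left_filter; apply: Fc; by rewrite lexx ltW.
move=> t; rewrite in_itv/= => /andP[/ltW t1 /ltW t2].
have dt : is_derive t (1 : R) F (h t) by apply: Fd; rewrite t1.
by rewrite derive1E derive_val.
Qed.

Lemma has_integral_cat (f : R -> R) (a m b l l' : R) : a <= m -> m <= b ->
  (forall t, 0 <= f t) ->
  has_integral f a m l -> has_integral f m b l' -> has_integral f a b (l + l').
Proof.
move=> am mb f0 [m1 i1] [m2 i2].
have U : `[a, b]%classic = `[a, m[%classic `|` `[m, b]%classic.
  by rewrite -itv_bndbnd_setU// bnd_simp.
have m1' : measurable_fun `[a, m[ f.
  by apply: measurable_funS m1 => //; apply: subset_itvl; rewrite bnd_simp.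
have mf : measurable_fun (`[a, m[ `|` `[m, b]) f by apply/measurable_funU.
split; first by rewrite U.
rewrite U ge0_integral_setU//=; last 3 first.
- exact/measurable_EFinP.
- by move=> x _; rewrite lee_fin.
- apply/disj_setPS => y [/=]; rewrite !in_itv/= => /andP[_ ym] /andP[].
  by rewrite leNgt ym.
rewrite integral_itv_bndo_bndc; last exact/measurable_EFinP.
by rewrite i1 i2 EFinD.
Qed.

End Integration.

Section Segments.
Variables (R : realType) (n : nat) (Y : topologicalType) (M : smooth_manifold R n Y).
Variable g : riemannian_metric M.

Lemma affine_continuous (k e r : R) : {for r, continuous (fun t : R => k * t + e)}.
Proof.
apply: cvgD; last exact: cvg_cst.
by apply: cvgM; [exact: cvg_cst|exact: cvg_id].
Qed.

Lemma near_affine (k e s : R) (P : R -> Prop) :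
  (\forall r \near k * s + e, P r) -> \forall r \near s, P (k * r + e).
Proof. by move=> H; exact: (@affine_continuous k e s). Qed.

Lemma derive1_affine (V : normedModType R) (f : R -> V) (k e s : R) :
  derivable f (k * s + e) 1 ->
  derivable (f \o (fun t => k * t + e)) s 1 /\
  derive1 (f \o (fun t => k * t + e)) s = k *: derive1 f (k * s + e).
Proof.
move=> /derivable1_diffP fd.
have affd : is_derive s (1 : R) (fun t : R => k * t + e) k.
  have h : is_derive s (1 : R) ((k \*: id) + cst e) (k *: 1 + 0) by apply: is_deriveD.
  by move: h; rewrite [k *: 1]mulr1 addr0.
have affD : differentiable (fun t : R => k * t + e) s by apply/derivable1_diffP.
have fd' := @differentiable_comp _ _ _ _ (fun t : R => k * t + e) f s affD fd.
split; first by apply/derivable1_diffP.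
rewrite derive1E'// diff_comp//= derive1E'//.
have -> : 'd (fun t : R => k * t + e) s 1 = k.
  by rewrite -deriveE// derive_val.
move: (k * s + e) => y; have kE : k *: (1 : R) = k by exact: mulr1.
by rewrite -{1}kE linearZ.
Qed.

Lemma qformZ (G : 'M[R]_n) (k : R) (v : 'rV[R]_n) :
  qform G (k *: v) (k *: v) = k ^+ 2 * qform G v v.
Proof.
rewrite !qformE mulr_sumr; apply: eq_bigr => a _; rewrite mulr_sumr.
by apply: eq_bigr => b _; rewrite !mxE; ring.
Qed.

Lemma C1_affine (c : R -> Y) (k e s : R) : C1_at M c (k * s + e) ->
  C1_at M (c \o (fun t => k * t + e)) s /\
  speed g (c \o (fun t => k * t + e)) s = `|k| * speed g c (k * s + e).
Proof.
move=> cC; have [cn cd] := cC.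
have affc (r : R) := @affine_continuous k e r.
have C : C1_at M (c \o (fun t => k * t + e)) s.
  split.
    near=> r.
    have h : {for k * r + e, continuous c} by near: r; exact: (near_affine (P := fun r => {for r, continuous c}) cn).
    exact: (@continuous_comp _ _ _ (fun t : R => k * t + e) c r (affc r) h).
  move=> i ci; have [dn dc] := cd i ci.
  have dn' : \forall r \near s, derivable (chart i \o c) (k * r + e) 1
    by exact: (near_affine (P := fun r => derivable (chart i \o c) r 1) dn).
  split.
    by apply: filterS dn' => r /derive1_affine[].
  have E : {near s, (fun r => k *: derive1 (chart i \o c) (k * r + e)) =1
      derive1 (chart i \o (c \o (fun t => k * t + e)))}.
    by apply: filterS dn' => r /derive1_affine[].
  rewrite /prop_for /continuous_at -(nbhs_singleton E).
  apply: cvg_trans; first exact: (near_eq_cvg E).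
  apply: (@cvgZl_tmp R 'rV[R]_n _ (nbhs s)).
  exact: (@continuous_comp _ _ _ (fun t : R => k * t + e) (derive1 (chart i \o c)) s (affc s) dc).
split=> //.
have i0 := mem_chart_at M (c (k * s + e)).
have [d1 _] := cd _ i0; have {}d1 := nbhs_singleton d1.
have [d2 d3] := derive1_affine d1.
rewrite (speedE g (C1_at_continuous C) i0 d2) (speedE g (C1_at_continuous cC) i0 d1).
have -> : derive1 (chart (chart_at M (c (k * s + e))) \o (c \o (fun t => k * t + e))) s =
  k *: derive1 (chart (chart_at M (c (k * s + e))) \o c) (k * s + e) by [].
by rewrite qformZ sqrtrM ?sqr_ge0// sqrtr_sqr.
Unshelve. all: by end_near. Qed.

(* With the primitive [F] of the speed as part of the data, lengths of pieces are
   increments of [F] and no integral has to be computed. *)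
Definition segment (p q : Y) (l : R) : Prop :=
  exists c F : R -> _, exists a b : R,
  [/\ [/\ a < b, c a = p & c b = q],
      forall t, a <= t <= b -> C1_at M c t,
      forall t : R, a <= t <= b -> is_derive t (1 : R) F (speed g c t) &
      l = F b - F a].

Lemma segment_reparam p q l a' b' : a' < b' -> segment p q l ->
  exists c F : R -> _,
  [/\ c a' = p, c b' = q,
      forall t, a' <= t <= b' -> C1_at M c t,
      forall t : R, a' <= t <= b' -> is_derive t (1 : R) F (speed g c t) &
      l = F b' - F a'].
Proof.
move=> ab' [c [F [a [b [[ab <- <-] cC Fd ->]]]]].
have b0 : 0 < b' - a' by rewrite subr_gt0.
pose k := (b - a) / (b' - a'); pose e := a - k * a'.
have k0 : 0 < k by rewrite divr_gt0 ?subr_gt0.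
have kE : k * (b' - a') = b - a by rewrite /k divfK// gt_eqF.
have ha : k * a' + e = a by rewrite /e; ring.
have hb : k * b' + e = b by rewrite /e; have := kE; rewrite mulrBr; lra.
have ht t : a' <= t <= b' -> a <= k * t + e <= b.
  move=> /andP[t1 t2]; rewrite -{1}ha -hb !lerD2r !ler_pM2l//; exact/andP.
exists (c \o (fun t => k * t + e)), (F \o (fun t => k * t + e)).
split; rewrite /= ?ha ?hb//.
  by move=> t /ht/cC/C1_affine[].
move=> t /ht tt; have [_ ->] := C1_affine (cC _ tt).
have dF := Fd _ tt; have [d1 d2] := @derive1_affine R F k e t (@ex_derive _ _ _ _ _ _ _ dF).
apply: DeriveDef; first exact: d1.
by rewrite -derive1E d2 derive1E derive_val gtr0_norm.
Qed.

Lemma segment_rev p q l : segment p q l -> segment q p l.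
Proof.
move=> [c [F [a [b [[ab <- <-] cC Fd ->]]]]].
have ht t : - b <= t <= - a -> a <= (-1) * t + 0 <= b.
  by rewrite addr0 mulN1r => /andP[t1 t2]; rewrite lerNr t2 lerNl t1.
exists (c \o (fun t => (-1) * t + 0)), (fun t => - (F \o (fun t => (-1) * t + 0)) t), (- b), (- a).
split; rewrite /= ?addr0 ?mulN1r ?opprK//; [by rewrite ltrN2| | |by rewrite addrC].
  by move=> t /ht/cC/C1_affine[].
move=> t /ht tt; have [_ ->] := C1_affine (cC _ tt).
have dF := Fd _ tt; have [d1 d2] := @derive1_affine R F (-1) 0 t (@ex_derive _ _ _ _ _ _ _ dF).
have dd := derivableP d1; rewrite -derive1E d2 derive1E derive_val scaleN1r in dd.
by rewrite normrN1 mul1r -[speed _ _ _]opprK; exact: is_deriveN.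
Qed.

Lemma segment_mono (c : R -> Y) (F : R -> R) (a b : R) :
  (forall t : R, a <= t <= b -> is_derive t (1 : R) F (speed g c t)) ->
  forall s t, a <= s -> s <= t -> t <= b -> F s <= F t.
Proof.
move=> Fd s t as_ st tb.
have [||x _ E] := @MVT_segment R F (speed g c) s t st.
- move=> x; rewrite in_itv/= => /andP[/ltW h1 /ltW h2]; apply: Fd.
  by rewrite (le_trans as_ h1) (le_trans h2 tb).
- apply: continuous_in_subspaceT => x; rewrite inE/= in_itv/= => /andP[h1 h2].
  apply/differentiable_continuous/derivable1_diffP; apply: ex_derive; apply: Fd.
  by rewrite (le_trans as_ h1) (le_trans h2 tb).
by rewrite -subr_ge0 E mulr_ge0 ?speed_ge0// subr_ge0.
Qed.

Lemma segment_ge0 p q l : segment p q l -> 0 <= l.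
Proof.
move=> [c [F [a [b [[ab _ _] _ Fd ->]]]]]; rewrite subr_ge0.
exact: (segment_mono Fd (lexx a) (ltW ab) (lexx b)).
Qed.

(** The primitive of the speed is continuous, so it takes the value [F a + s]: the curve is cut
    where it has run length exactly [s]. *)
Lemma segment_split p q l s : segment p q l -> 0 < s -> s < l ->
  exists z, segment p z s /\ segment z q (l - s).
Proof.
move=> [c [F [a [b [[ab <- <-] cC Fd ->]]]]] s0 sl.
have [||t] := @IVT R F a b (F a + s) (ltW ab).
- apply: continuous_in_subspaceT => x; rewrite inE/= in_itv/= => xab.
  apply/differentiable_continuous/derivable1_diffP; apply: ex_derive; exact: Fd.
- by rewrite ge_min le_max; apply/andP; split; apply/orP; [left|right]; lra.
rewrite in_itv/= => /andP[t1 t2] tE; exists (c t).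
have ta : a < t by rewrite lt_neqAle t1 andbT; apply/eqP => E; move: tE; rewrite E; lra.
have tb : t < b by rewrite lt_neqAle t2 andbT; apply/eqP => E; move: tE; rewrite E; lra.
split.
  exists c, F, a, t; split=> //; last by rewrite tE; ring.
  - by move=> r /andP[r1 r2]; apply: cC; rewrite r1 (le_trans r2).
  - by move=> r /andP[r1 r2]; apply: Fd; rewrite r1 (le_trans r2).
exists c, F, t, b; split=> //; last by rewrite tE; ring.
- by move=> r /andP[r1 r2]; apply: cC; rewrite r2 (le_trans t1).
- by move=> r /andP[r1 r2]; apply: Fd; rewrite r2 (le_trans t1).
Qed.

End Segments.

(** * Chains of segments compute the geodesic distance *)

Section Chains.
Variables (R : realType) (n : nat) (Y : topologicalType) (M : smooth_manifold R n Y).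
Variable g : riemannian_metric M.

Inductive chain : Y -> Y -> R -> Prop :=
| chain1 p q l : segment g p q l -> chain p q l
| chainS p q r l l' : segment g p q l -> chain q r l' -> chain p r (l + l').

Lemma chain_trans p q r l l' : chain p q l -> chain q r l' -> chain p r (l + l').
Proof.
move=> h; elim: h r l' => {p q l} [p q l pq r l' qr|p q r l l' pq _ IH r' l'' h].
  exact: chainS pq qr.
by rewrite -addrA; apply: chainS pq _; exact: IH.
Qed.

Lemma chain_rev p q l : chain p q l -> chain q p l.
Proof.
elim=> {p q l} [p q l pq|p q r l l' pq _ IH]; first exact/chain1/segment_rev.
by rewrite addrC; apply: chain_trans IH _; exact/chain1/segment_rev.
Qed.

Lemma chain_ge0 p q l : chain p q l -> 0 <= l.
Proof.
by elim=> {p q l} [p q l /segment_ge0//|p q r l l' /segment_ge0 h _ h']; exact: addr_ge0.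
Qed.

Lemma chain_split p q l s : chain p q l -> 0 < s -> s < l ->
  exists z, chain p z s /\ chain z q (l - s).
Proof.
move=> h; elim: h s => {p q l} [p q l pq s s0 sl|p q r l l' pq qr IH s s0 sl].
  by have [z [pz zq]] := segment_split pq s0 sl; exists z; split; exact: chain1.
have [sl'|ls|->] := ltgtP s l.
- have [z [pz zq]] := segment_split pq s0 sl'; exists z; split; first exact: chain1.
  by rewrite addrAC; exact: chainS zq qr.
- have [||z [qz zr]] := IH (s - l); rewrite ?subr_gt0// ?ltrBlDl//.
  exists z; split; last by rewrite (_ : l + l' - s = l' - (s - l))//; ring.
  by rewrite -(subrKC l s); exact: chainS pq qz.
- by exists q; split; [exact: chain1|rewrite addrAC subrr add0r].
Qed.

Lemma speed_near_eq (c c' : R -> Y) t : {near t, c =1 c'} -> speed g c t = speed g c' t.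
Proof.
move=> E; rewrite /speed /= (nbhs_singleton E) !derive1E.
rewrite (_ : 'D_1 (chart (chart_at M (c' t)) \o c) t = 'D_1 (chart (chart_at M (c' t)) \o c') t)//.
by apply: near_eq_derive; apply: filterS E => r /= ->.
Qed.

Lemma speed_itv_eq (c c' : R -> Y) (a b : R) : {in `[a, b], c =1 c'} ->
  forall t, a < t < b -> speed g c t = speed g c' t.
Proof.
move=> E t tab; apply: speed_near_eq.
have : \forall r \near t, r \in `]a, b[ by apply: near_in_itvoo; rewrite in_itv.
apply: filterS => r; rewrite in_itv/= => /andP[/ltW h1 /ltW h2].
by apply: E; rewrite in_itv/= h1.
Qed.

Lemma C1_segment_length (c : R -> Y) (a b : R) : a < b -> C1_segment M c a b ->
  exists l, segment g (c a) (c b) l /\ has_integral (speed g c) a b l.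
Proof.
move=> ab [c' cc' cC].
have {}cC t : a <= t <= b -> C1_at M c' t by move=> h; apply: cC; rewrite in_itv.
have [F Fd] := @antiderivative R (speed g c') a b (ltW ab)
  (fun t h => @speed_continuous _ _ _ _ g c' t (cC t h)).
exists (F b - F a); split.
  by exists c', F, a, b; split=> //; rewrite !cc'// in_itv/= lexx ltW.
exact: (@has_integral_FTC R (speed g c) (speed g c') F a b ab Fd
  (fun t h => @speed_continuous _ _ _ _ g c' t (cC t h)) (speed_itv_eq cc')).
Qed.

Lemma path_lt_le_last (a : R) s : path <%R a s -> a <= last a s.
Proof.
by elim: s a => //= x s IH a /andP[ax /IH]; exact/le_trans/ltW.
Qed.

Lemma path_lt_bounds (a : R) s k : path <%R a s -> (k < size s)%N ->
  a <= nth 0 (a :: s) k /\ nth 0 s k <= last a s.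
Proof.
elim: s a k => //= x s IH a [|k] /andP[ax xs]; first by split=> //; exact: path_lt_le_last.
rewrite ltnS => /(IH x k xs)[h1 h2]; split=> //=.
by apply: le_trans h1; exact: ltW.
Qed.

Lemma pieces_chain (c : R -> Y) (a : R) s : path <%R a s -> (0 < size s)%N ->
  (forall k, (k < size s)%N -> C1_segment M c (nth 0 (a :: s) k) (nth 0 s k)) ->
  exists l, chain (c a) (c (last a s)) l /\ has_integral (speed g c) a (last a s) l.
Proof.
elim: s a => //= x s IH a /andP[ax xs] _ H.
have [l [h1 h2]] := C1_segment_length ax (H 0%N isT).
have [->|s0] := eqVneq s [::]; first by exists l; split=> //; exact: chain1.
have [||l' [h3 h4]] := IH x xs; first by rewrite lt0n size_eq0.
  by move=> k ks; exact: (H k.+1).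
exists (l + l'); split; first exact: chainS h1 h3.
apply: has_integral_cat h2 h4 => //; [exact: ltW|exact: path_lt_le_last|].
by move=> t; exact: speed_ge0.
Qed.

Lemma curve_chain (c : R -> Y) : piecewise_C1 M c -> chain (c 0) (c 1) (curve_length g c).
Proof.
move=> [_ [s [p01 l1 H]]].
have [|l [h [_ E]]] := pieces_chain p01 _ H.
  by case: s l1 {p01 H} => //= /eqP; rewrite eq_sym oner_eq0.
by rewrite /curve_length /Rintegral; rewrite l1 in h E; rewrite E.
Qed.

Lemma has_integral_ext (f h : R -> R) (a b l : R) : (forall t, a < t < b -> f t = h t) ->
  has_integral f a b l -> has_integral h a b l.
Proof.
move=> fh [mf E].
have fh' : {in `]a, b[%classic, f =1 h} by move=> t; rewrite inE/= in_itv/=; exact: fh.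
have mfo : measurable_fun `]a, b[ f by apply: measurable_funS mf => //; exact: subset_itv_oo_cc.
have mho : measurable_fun `]a, b[ h by exact: (eq_measurable_fun _ fh').
split; first exact: measurable_fun_itv_cc mho.
rewrite integral_itv_bndoo; last exact/measurable_EFinP.
rewrite -E [RHS]integral_itv_bndoo; last exact/measurable_EFinP.
by apply: eq_integral => t /fh' ->.
Qed.

(** The first segment is moved to the left half of the interval and the rest of the chain to the
    right half, so the induction has to range over all intervals. *)
Lemma chain_curve p q l : chain p q l -> forall a b : R, a < b ->
  exists (c : R -> Y) (s : seq R),
  [/\ c a = p, c b = q, {within `[a, b], continuous c} & has_integral (speed g c) a b l] /\
  [/\ path <%R a s, last a s = b &
    forall k, (k < size s)%N -> C1_segment M c (nth 0 (a :: s) k) (nth 0 s k)].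
Proof.
have segc (c : R -> Y) (a b : R) : (forall t, a <= t <= b -> C1_at M c t) ->
    {within `[a, b], continuous c}.
  move=> cC; apply: continuous_in_subspaceT => t; rewrite inE/= in_itv/= => /cC.
  exact: C1_at_continuous.
have segi (c : R -> Y) (F : R -> R) (a b : R) : a < b -> (forall t, a <= t <= b -> C1_at M c t) ->
    (forall t : R, a <= t <= b -> is_derive t (1 : R) F (speed g c t)) ->
    has_integral (speed g c) a b (F b - F a).
  move=> ab cC Fd; exact: (@has_integral_FTC R (speed g c) (speed g c) F a b ab Fd
    (fun t h => @speed_continuous _ _ _ _ g c t (cC t h)) (fun t _ => erefl)).
have segC (c c' : R -> Y) (a b : R) : {in `[a, b], c =1 c'} ->
    (forall t, a <= t <= b -> C1_at M c' t) -> C1_segment M c a b.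
  by move=> E cC; exists c' => // t; rewrite in_itv; exact: cC.
elim=> {p q l} [p q l pq a b ab|p q r l l' pq _ IH a b ab].
  have [c [F [ca cb cC Fd ->]]] := segment_reparam ab pq.
  exists c, [:: b]; split; first by split=> //; [exact: segc|exact: segi].
  by split; rewrite /= ?ab// => -[|//] _ /=; exact: (segC c c).
pose m := (a + b) / 2.
have am : a < m by rewrite /m; lra.
have mb : m < b by rewrite /m; lra.
have [c1 [F [c1a c1m cC Fd E]]] := segment_reparam am pq.
have [c2 [s [[c2m c2b c2c c2i] [s1 s2 s3]]]] := IH m b mb.
pose c t := if t <= m then c1 t else c2 t.
have E1 : {in `[a, m], c =1 c1} by move=> t; rewrite in_itv/= /c => /andP[_ ->].
have E2 : {in `[m, b], c =1 c2}.
  move=> t; rewrite in_itv/= /c => /andP[mt _]; case: ifP => // tm.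
  by have -> : t = m; [apply/le_anti; rewrite tm|rewrite c1m c2m].
exists c, (m :: s); split; split.
- by rewrite /c (ltW am).
- by rewrite /c leNgt mb.
- rewrite (_ : `[a, b]%classic = `[a, m]%classic `|` `[m, b]%classic); last first.
    apply/seteqP; split=> t /=; rewrite !in_itv/=.
      by move=> /andP[h1 h2]; have [tm|/ltW tm] := lerP t m; [left; rewrite h1|right; rewrite h2 tm].
    move=> [/andP[h1 h2]|/andP[h1 h2]]; first by rewrite h1 (le_trans h2)// ltW.
    by rewrite h2 andbT (le_trans _ h1)// ltW.
  apply: withinU_continuous; [exact: interval_closed|exact: interval_closed| | ].
    apply: (@subspace_eq_continuous _ _ _ c1); last exact: segc.
    by move=> t; rewrite inE/= => /E1.
  apply: (@subspace_eq_continuous _ _ _ c2); last exact: c2c.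
  by move=> t; rewrite inE/= => /E2.
- apply: (@has_integral_cat _ _ a m b); [exact: ltW|exact: ltW| | | ].
  + by move=> t; exact: speed_ge0.
  + rewrite E; apply: (has_integral_ext _ (segi _ _ _ _ am cC Fd)).
    by move=> t tam; apply/esym/(speed_itv_eq E1).
  + apply: (has_integral_ext _ c2i).
    by move=> t tam; apply/esym/(speed_itv_eq E2).
- by rewrite /= am.
- by [].
- move=> [_|k ks] /=; first exact: (segC c c1).
  have [c' cc' cC'] := s3 k ks; exists c' => // t tk.
  rewrite -cc'// E2//; have [h1 h2] := path_lt_bounds s1 ks.
  by move: tk; rewrite !in_itv/= -s2 => /andP[t1 t2]; rewrite (le_trans h1 t1) (le_trans t2 h2).
Qed.

Lemma geodesic_distE p q : geodesic_dist g p q = inf [set l | chain p q l].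
Proof.
congr (inf _); apply/seteqP; split=> [_ [c [cC <- <-] <-]|l /chain_curve /(_ 0 1 ltr01)].
  exact: curve_chain.
move=> [c [s [[c0 c1 cc [_ E]] [s1 s2 s3]]]]; exists c.
  by split=> //; split=> //; exists s.
by rewrite /curve_length /Rintegral E.
Qed.

End Chains.

(** * Comparison of the Riemannian and the coordinate norm *)

Section LocalEstimates.
Context {R : realType}.

Lemma qform_bound n (G : 'M[R]_n) (c : R) (v : 'rV[R]_n) : 0 <= c ->
  (forall a b, `|G a b| <= c) -> `|qform G v v| <= n%:R * n%:R * c * `|v| ^+ 2.
Proof.
move=> c0 Gc; rewrite qformE; apply: (le_trans (ler_norm_sum _ _ _)).
apply: (@le_trans _ _ (\sum_(a < n) n%:R * (c * `|v| ^+ 2))); last first.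
  by rewrite sumr_const card_ord -[X in X <= _]mulr_natl !mulrA.
apply: ler_sum => a _; apply: (le_trans (ler_norm_sum _ _ _)).
apply: (@le_trans _ _ (\sum_(b < n) c * `|v| ^+ 2)); last first.
  by rewrite sumr_const card_ord -[X in X <= _]mulr_natl.
apply: ler_sum => b _; rewrite !normrM expr2 mulrA.
apply: ler_pM => //; last exact: rv_coord_le.
by rewrite mulrC; apply: ler_pM => //; exact: rv_coord_le.
Qed.

(** Minimise over the compact unit sphere and use homogeneity; if the sphere is empty only the
    vector 0 exists. *)
Lemma qform_coercive n (G : 'M[R]_n) : (forall v, v != 0 -> 0 < qform G v v) ->
  exists2 m, 0 < m & forall v : 'rV[R]_n, m * `|v| ^+ 2 <= qform G v v.
Proof.
move=> Gpos; pose S : set 'rV[R]_n := [set v | `|v| = 1].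
have nS (v : 'rV[R]_n) : v != 0 -> S (`|v|^-1 *: v).
  by move=> v0; rewrite /S /= normrZ normfV normr_id mulVf// normr_eq0.
have vE (v : 'rV[R]_n) : v != 0 -> qform G v v = `|v| ^+ 2 * qform G (`|v|^-1 *: v) (`|v|^-1 *: v).
  by move=> v0; rewrite qformZ mulrA -exprMn divff ?normr_eq0// expr1n mul1r.
have q0 : qform G 0 0 = 0 by rewrite /qform mul0mx mul0mx mxE.
have [S0|/set0P/negP/negPn/eqP S0] := pselect (S !=set0); last first.
  exists 1 => // v; have [->|/nS] := eqVneq v 0; last by rewrite S0.
  by rewrite normr0 expr0n mulr0 q0.
have cS : compact S.
  apply: bounded_closed_compact.
    exists 1; split; first exact: num_real.
    by move=> x x1 v /= ->; exact: ltW.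
  rewrite (_ : S = (fun v : 'rV[R]_n => `|v|) @^-1` [set 1])//.
  by apply: preimage_closed; [move=> v _; exact: norm_continuous|exact: closed_eq].
have [|v0 v0S Hmin] := @EVT_min_rV R n (fun v => qform G v v) S S0 cS.
  apply: continuous_subspaceT => v; apply: (@qform_cvg R _ (nbhs v)) => [a b|a]; first exact: cvg_cst.
  exact: coord_continuous.
move: v0S; rewrite inE => v0S.
exists (qform G v0 v0).
  by apply: Gpos; apply/eqP => v00; move: v0S; rewrite /S /= v00 normr0 => /eqP; rewrite eq_sym oner_eq0.
move=> v; have [->|v00] := eqVneq v 0; first by rewrite normr0 expr0n mulr0 q0.
rewrite (vE v v00) mulrC ler_wpM2l ?sqr_ge0//; apply: Hmin.
by rewrite inE; exact: nS.
Qed.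

Lemma qform_near n (G : 'rV[R]_n -> 'M[R]_n) (x0 : 'rV[R]_n) :
  (forall a b, {for x0, continuous (fun x => G x a b)}) ->
  (forall v, v != 0 -> 0 < qform (G x0) v v) ->
  exists l L : R, [/\ 0 < l, 0 < L & \forall x \near x0, forall v : 'rV[R]_n,
    l * `|v| <= Num.sqrt (qform (G x) v v) <= L * `|v|].
Proof.
move=> Gc /qform_coercive[m m0 mP].
pose K := \sum_a \sum_b `|G x0 a b|.
have K0 : 0 <= K by apply: sumr_ge0 => a _; exact: sumr_ge0.
have GK a b : `|G x0 a b| <= K.
  rewrite /K (bigD1 a)//= (bigD1 b)//= -addrA lerDl addr_ge0// sumr_ge0// => i _.
  exact: sumr_ge0.
pose N : R := n%:R * n%:R.
have N0 : 0 <= N by rewrite /N mulr_ge0.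
have qB G1 G2 (v : 'rV[R]_n) : qform (G1 - G2) v v = qform G1 v v - qform G2 v v.
  by rewrite /qform mulmxBr mulmxBl !mxE.
have sq (k : R) (v : 'rV[R]_n) : 0 <= k -> Num.sqrt k * `|v| = Num.sqrt (k * `|v| ^+ 2).
  by move=> k0; rewrite sqrtrM// sqrtr_sqr normr_id.
(* Entries within [e] of those at [x0] change the form by at most [N * e * |v|^2], half of the
   coercivity bound. *)
pose e := m / (2 * (N + 1)).
have e0 : 0 < e by rewrite divr_gt0// mulr_gt0// ltr_wpDl.
have Ne : N * e <= m / 2.
  rewrite /e mulrA ler_pdivrMr; last by rewrite mulr_gt0// ltr_wpDl.
  by have := m0; nra.
exists (Num.sqrt (m / 2)), (Num.sqrt (N * K + m / 2)); split.
- by rewrite sqrtr_gt0 divr_gt0.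
- by rewrite sqrtr_gt0 ltr_wpDl ?mulr_ge0// divr_gt0.
have : \forall x \near x0, forall a b, `|(G x - G x0) a b| <= e.
  apply: near_forall => a; apply: near_forall => b.
  have /(@cvgrPdist_le _ _ _ (nbhs x0)) /(_ e e0) := Gc a b.
  by apply: filterS => x; rewrite distrC !mxE.
apply: filterS => x xe v.
have h1 := qform_bound v (ltW e0) xe; rewrite qB in h1.
have h2 := qform_bound v K0 GK.
have h3 := mP v.
have v2 : 0 <= `|v| ^+ 2 by exact: sqr_ge0.
rewrite -/N in h1 h2.
have h4 : N * e * `|v| ^+ 2 <= m / 2 * `|v| ^+ 2 by rewrite ler_wpM2r.
rewrite !sq ?addr_ge0 ?mulr_ge0 ?divr_ge0 ?(ltW m0)//.
have [h5 h6] := (ler_norm (qform (G x) v v - qform (G x0) v v), ler_norm (- (qform (G x) v v - qform (G x0) v v))).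
rewrite normrN in h6; have h7 := ler_norm (qform (G x0) v v).
by apply/andP; split; apply: ler_wsqrtr; nra.
Qed.

Lemma derive1_estimate (V : normedModType R) (f : R -> V) (t e : R) :
  derivable f t 1 -> 0 < e ->
  \forall s \near t, `|f s - f t - (s - t) *: derive1 f t| <= e * `|s - t|.
Proof.
move=> fd e0; have /derivable1_diffP /diff_locally/eqaddoP/(_ e e0) := fd.
rewrite deriv1E// => /nbhs_ballP[d d0 H].
apply/nbhs_ballP; exists d => // s; rewrite -ball_normE /ball_/= => ts.
have /= := H (s - t); rewrite -ball_normE /ball_/= sub0r opprB => /(_ ts).
have -> // : (f \o shift t - (cst (f t) + ( *:%R^~ (derive1 f t) : R -> V))) (s - t)
    = f s - f t - (s - t) *: derive1 f t.
rewrite -addrA -opprD.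
by rewrite -[LHS]/(f (s - t + t) - (f t + (s - t) *: derive1 f t)) subrK.
Qed.

(** Continuous induction: with an error [e * (t - a)] allowed, the supremum [T] of the good times is
    good by the local bound from the left, and equals [b] by the local bound from the right. *)
Lemma local_domination (phi F : R -> R) (a b : R) : a < b ->
  (forall s t, a <= s -> s <= t -> t <= b -> F s <= F t) ->
  (forall t e, a <= t <= b -> 0 < e -> exists2 d, 0 < d & forall s, a <= s <= b ->
     `|s - t| < d -> `|phi s - phi t| <= `|F s - F t| + e * `|s - t|) ->
  `|phi b - phi a| <= F b - F a.
Proof.
move=> ab Fm H; apply/ler_addgt0Pr => e0 e0_gt0.
pose e := e0 / (b - a); have e_gt0 : 0 < e by rewrite divr_gt0 ?subr_gt0.
have -> : e0 = e * (b - a) by rewrite /e divfK// gt_eqF// subr_gt0.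
pose P t := `|phi t - phi a| <= F t - F a + e * (t - a).
have step s t : a <= s -> s <= t -> t <= b -> P s ->
    `|phi t - phi s| <= `|F t - F s| + e * `|t - s| -> P t.
  move=> as_ st tb; rewrite /P => Ps h.
  have := ler_distD (phi s) (phi t) (phi a).
  have Fst := Fm s t as_ st tb.
  rewrite (ger0_norm (_ : 0 <= F t - F s)) ?subr_ge0// (ger0_norm (_ : 0 <= t - s)) ?subr_ge0// in h.
  by move=> hh; rewrite !mulrBr in Ps h *; lra.
pose S := [set t | a <= t <= b /\ P t].
have Sa : S a by split; [rewrite lexx ltW|rewrite /P !subrr normr0 mulr0 addr0].
have bS : ubound S b by move=> t [/andP[]].
have hS : has_sup S by split; [exists a|exists b].
pose T := sup S.
have leT t : S t -> t <= T by move=> St; apply: ub_le_sup St; exists b.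
have aT : a <= T by exact: leT Sa.
have Tb : T <= b by apply: ge_sup => //; exists a.
have Tab : a <= T <= b by rewrite aT Tb.
have [d d0 Hd] := H T e Tab e_gt0.
have PT : P T.
  have [s [sab Ps] Ts] := sup_adherent d0 hS.
  have /andP[as_ sb] := sab.
  have sT : s <= T by exact: leT.
  apply: (step s T as_ sT Tb Ps); rewrite distrC (distrC (F T)) (distrC T).
  by apply: Hd => //; rewrite distrC ger0_norm ?subr_ge0// -/T in Ts *; lra.
have [Tb'|bT] := ltrP T b; last by have -> : b = T by apply/le_anti; rewrite Tb bT.
pose s := Num.min b (T + d / 2).
have Ts : T < s by rewrite lt_min Tb' ltrDl divr_gt0.
have sb : s <= b by rewrite ge_min lexx.
have Ss : S s.
  have as_ : a <= s by rewrite (le_trans aT)// ltW.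
  split; first by rewrite as_.
  apply: (step T s aT (ltW Ts) sb PT); apply: Hd; first by rewrite as_.
  rewrite ger0_norm ?subr_ge0 ?ltW// ltrBlDl; apply: (@le_lt_trans _ _ (T + d / 2)).
    by rewrite ge_min lexx orbT.
  by rewrite ltrD2l; lra.
by have := leT _ Ss; rewrite leNgt Ts.
Qed.

End LocalEstimates.

Section LocalGeometry.
Variables (R : realType) (n : nat) (Y : topologicalType) (M : smooth_manifold R n Y).
Variable g : riemannian_metric M.

Lemma line_derive (x w : 'rV[R]_n) (t : R) :
  derivable (fun s : R => s *: w + x) t 1 /\ derive1 (fun s : R => s *: w + x) t = w.
Proof.
have h : is_derive t (1 : R) ((fun s : R => s *: w) + cst x) (w + 0).
  apply: is_deriveD.
  have D : differentiable (fun s : R => s *: w) t by [].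
  apply: DeriveDef; first by apply/derivable1_diffP.
  by rewrite deriveE// diff_val scale1r.
by split; [exact: ex_derive|rewrite derive1E derive_val addr0].
Qed.

Lemma line_continuous (x w : 'rV[R]_n) (t : R) : {for t, continuous (fun s : R => s *: w + x)}.
Proof.
by apply/differentiable_continuous/derivable1_diffP; have [] := line_derive x w t.
Qed.

Lemma line_C1 i (x w : 'rV[R]_n) (t : R) : chart_cod (s := M) i (t *: w + x) ->
  C1_at M (fun s => chart_inv i (s *: w + x)) t.
Proof.
move=> ti; pose L (s : R) := s *: w + x.
have near_cod : \forall s \near t, chart_cod i (L s).
  by apply: (@line_continuous x w t); exact: open_nbhs_nbhs (conj (@chart_cod_open _ _ _ M i) ti).
split.
  apply: filterS near_cod => s si.
  exact: (@continuous_comp _ _ _ L (chart_inv i) s (@line_continuous x w s) (@chart_inv_continuous _ _ _ M i _ si)).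
move=> j tj; pose D := chart i @` (chart_dom i `&` chart_dom (s := M) j).
have Dt : D (L t) by rewrite /D transition_domE.
have near_D : \forall s \near t, D (L s).
  by apply: (@line_continuous x w t); exact: open_nbhs_nbhs (conj (@transition_dom_open _ _ _ M i j) Dt).
have diffD s : D (L s) -> differentiable (chart j \o chart_inv i) (L s).
  by move=> Ds; exact: (@Ck1_differentiable R n n _ _ _ (@transition_dom_open _ _ _ M i j) Ds (transition_Ck1 i j)).
split.
  apply: filterS near_D => s /diffD ds.
  by have [] := derive1_chain (line_derive x w s).1 ds.
have E : {near t, (fun s => \sum_k w 0 k *: 'D_('e_k) (chart j \o chart_inv i) (L s)) =1
    derive1 (chart j \o (fun s => chart_inv i (s *: w + x)))}.
  apply: filterS near_D => s /diffD ds.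
  have [_ h] := derive1_chain (line_derive x w s).1 ds.
  by rewrite -[RHS]/(derive1 ((chart j \o chart_inv i) \o L) s) h (line_derive x w s).2 derive_rowE.
rewrite /prop_for /continuous_at -(nbhs_singleton E).
apply: cvg_trans; first exact: (near_eq_cvg E).
apply: cvg_sum_fin => k; apply: (@cvgZl_tmp R 'rV[R]_n _ (nbhs t)).
have [_ /(_ k)[_ [Dc _]]] := transition_Ck1 (M := M) i j.
exact: (@continuous_comp _ _ _ L (fun y => 'D_('e_k) (chart j \o chart_inv i) y) t (@line_continuous x w t) (Dc _ Dt)).
Qed.

Lemma line_speed i (x w : 'rV[R]_n) (t : R) : chart_cod (s := M) i (t *: w + x) ->
  speed g (fun s => chart_inv i (s *: w + x)) t = Num.sqrt (qform (gram g i (t *: w + x)) w w).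
Proof.
move=> ti; pose L (s : R) := s *: w + x.
have near_cod : \forall s \near t, chart_cod i (L s).
  by apply: (@line_continuous x w t); exact: open_nbhs_nbhs (conj (@chart_cod_open _ _ _ M i) ti).
have E : {near t, L =1 chart i \o (fun s => chart_inv i (s *: w + x))}.
  by apply: filterS near_cod => s si; rewrite /= chart_invK.
have [d1 d2] := line_derive x w t.
have cC := C1_at_continuous (line_C1 ti).
rewrite (speedE g cC (chart_inv_mem ti) (near_eq_derivable E d1)) chart_invK//.
by rewrite derive1E -(near_eq_derive _ E) -derive1E d2.
Qed.

Lemma ball_convex (x0 x y : 'rV[R]_n) (r t : R) : `|x - x0| < r -> `|y - x0| < r ->
  0 <= t <= 1 -> `|t *: (y - x) + x - x0| < r.
Proof.
move=> xr yr /andP[t0 t1].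
have -> : t *: (y - x) + x - x0 = (1 - t) *: (x - x0) + t *: (y - x0).
  by apply/rowP => k; rewrite !mxE; ring.
apply: (le_lt_trans (ler_normD _ _)); rewrite !normrZ !ger0_norm ?subr_ge0//.
have [->|t00] := eqVneq t 0; first by rewrite mul0r subr0 mul1r addr0.
have tp : 0 < t by rewrite lt_neqAle eq_sym t00.
have h1 : t * `|y - x0| < t * r by rewrite ltr_pM2l.
have h2 : (1 - t) * `|x - x0| <= (1 - t) * r by rewrite ler_wpM2l ?subr_ge0// ltW.
lra.
Qed.

(** Control on radius [2 * rho] leaves a margin around the closed ball of radius [rho], itself a
    margin around the centres within [rho / 2] used for the cut-off. *)
Record local_bounds (p : Y) (rho lam Lam : R) : Prop := LocalBounds {
  lb_rho : 0 < rho;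
  lb_lam : 0 < lam;
  lb_Lam : 0 < Lam;
  lb_cod : forall x, `|x - chart (chart_at M p) p| < 2 * rho -> chart_cod (chart_at M p) x;
  lb_qform : forall x, `|x - chart (chart_at M p) p| < 2 * rho -> forall v,
    lam * `|v| <= Num.sqrt (qform (gram g (chart_at M p) x) v v) <= Lam * `|v|
}.

Lemma local_bounds_ex p : exists rho lam Lam, local_bounds p rho lam Lam.
Proof.
pose i := chart_at M p; have pi : chart_dom i p := mem_chart_at M p.
have xi := chart_mem pi.
have [||l [L [l0 L0 H]]] := @qform_near R n (gram g i) (chart i p).
- by move=> a b; exact: gram_continuous.
- by move=> v; exact: gram_pos.
have H2 : \forall x \near chart i p, chart_cod i x.
  exact: open_nbhs_nbhs (conj (@chart_cod_open _ _ _ M i) xi).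
move: H H2 => /nbhs_ballP[r1 r10 Hr1] /nbhs_ballP[r2 r20 Hr2].
pose r := Num.min r1 r2; have r0 : 0 < r by rewrite lt_min r10.
have [rr1 rr2] : r <= r1 /\ r <= r2 by rewrite /r !ge_min !lexx orbT.
exists (r / 2), l, L; split=> //; first by rewrite divr_gt0.
- move=> x xr; apply: Hr2.
  by rewrite -ball_normE /ball_/= distrC; apply: (lt_le_trans xr); lra.
- move=> x xr; apply: Hr1.
  by rewrite -ball_normE /ball_/= distrC; apply: (lt_le_trans xr); lra.
Qed.

Section Local.
Variables (p : Y) (rho lam Lam : R).
Hypothesis lb : local_bounds p rho lam Lam.
Let i := chart_at M p.
Let x0 := chart i p.

Definition chart_nbhd : set Y :=
  [set z | chart_dom (chart_at M p) z /\
    `|chart (chart_at M p) z - chart (chart_at M p) p| < 2 * rho].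

Lemma chart_nbhd_open : open chart_nbhd.
Proof.
rewrite openE => z [zi zr]; apply: filterI.
  exact: open_nbhs_nbhs (conj (@chart_dom_open _ _ _ M i) zi).
have : {for z, continuous (fun y => `|chart i y - x0|)}.
  apply: (@continuous_comp _ _ _ (fun y => chart i y - x0) (fun v : 'rV[R]_n => `|v|)); last exact: norm_continuous.
  apply: (@cvgB R 'rV[R]_n _ (nbhs z)); last exact: cvg_cst.
  exact: chart_continuous.
move=> /cvgr_lt; apply; exact: zr.
Qed.

Lemma chart_nbhd_center : chart_nbhd p.
Proof.
split; first exact: mem_chart_at.
by rewrite subrr normr0 mulr_gt0// (lb_rho lb).
Qed.

Lemma chart_nbhd_inv x : `|x - x0| < 2 * rho -> chart_nbhd (chart_inv i x).
Proof.
move=> xr; have xi := lb_cod lb xr.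
by split; [exact: chart_inv_mem|rewrite chart_invK].
Qed.

Lemma straight_segment x y : `|x - x0| < 2 * rho -> `|y - x0| < 2 * rho ->
  exists2 l, segment g (chart_inv i x) (chart_inv i y) l & l <= Lam * `|y - x|.
Proof.
move=> xr yr; pose c (s : R) := chart_inv i (s *: (y - x) + x).
have ti t : 0 <= t <= 1 -> `|t *: (y - x) + x - x0| < 2 * rho by exact: ball_convex.
have cC t : 0 <= t <= 1 -> C1_at M c t by move=> /ti/(lb_cod lb); exact: line_C1.
have [F Fd] := @antiderivative R (speed g c) 0 1 ler01
  (fun t h => @speed_continuous _ _ _ _ g c t (cC t h)).
exists (F 1 - F 0).
  exists c, F, 0, 1; split=> //; split=> //; rewrite /c ?scale0r ?add0r//.
  by rewrite scale1r subrK.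
have [||t] := @MVT_segment R F (speed g c) 0 1 ler01.
- by move=> t; rewrite in_itv/= => /andP[/ltW h1 /ltW h2]; apply: Fd; rewrite h1.
- apply: continuous_in_subspaceT => t; rewrite inE/= in_itv/= => h.
  by apply/differentiable_continuous/derivable1_diffP; apply: ex_derive; exact: Fd.
rewrite in_itv/= subr0 mulr1 => /ti tr ->; rewrite line_speed; last exact: lb_cod lb _ tr.
by have /andP[] := lb_qform lb tr (y - x).
Qed.

(* A cut-off of the coordinate distance to [x1]; as it is defined on all of [Y],
   length bounds need no first exit time from the chart. *)
Definition cutoff_dist (x1 : 'rV[R]_n) (z : Y) : R :=
  if asbool (chart_nbhd z) then Num.min (rho / 2) `|chart (chart_at M p) z - x1| else rho / 2.

Lemma chart_ball_compact : compact (chart_inv i @` [set x | `|x - x0| <= rho]).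
Proof.
have r2 : rho < 2 * rho by have := lb_rho lb; lra.
apply: continuous_compact.
  apply: continuous_in_subspaceT => x; rewrite inE/= => xr.
  by apply: chart_inv_continuous; apply: (lb_cod lb); exact: le_lt_trans r2.
apply: bounded_closed_compact.
  exists (rho + `|x0|); split; first exact: num_real.
  move=> y hy v /= vr; apply: ltW; apply: le_lt_trans hy.
  by rewrite -[v](subrK x0); apply: (le_trans (ler_normD _ _)); rewrite lerD2r.
rewrite (_ : [set x | _] = (fun x : 'rV[R]_n => `|x - x0|) @^-1` [set r | r <= rho])//.
apply: preimage_closed; last exact: closed_le.
move=> x _; apply: (@continuous_comp _ _ _ (fun y : 'rV[R]_n => y - x0) (fun v : 'rV[R]_n => `|v|)).
  by apply: (@cvgB R 'rV[R]_n _ (nbhs x)); [exact: cvg_id|exact: cvg_cst].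
exact: norm_continuous.
Qed.

(** The chart ball is compact, hence closed as [Y] is Hausdorff; this makes the cut-off locally
    constant outside the chart neighbourhood. *)
Lemma far_open : open (~` (chart_inv i @` [set x | `|x - x0| <= rho])).
Proof.
apply: closed_openC; apply: compact_closed; first exact: (manifold_hausdorff M).
exact: chart_ball_compact.
Qed.

Lemma cutoff_dist_far (x1 : 'rV[R]_n) z : `|x1 - x0| <= rho / 2 ->
  ~ (chart_inv i @` [set x | `|x - x0| <= rho]) z -> cutoff_dist x1 z = rho / 2.
Proof.
move=> x1r zK; rewrite /cutoff_dist; case: asboolP => // -[zi zr].
rewrite min_l//; rewrite leNgt; apply/negP => h; apply: zK.
exists (chart i z); last by rewrite chartK.
rewrite /=; have := ler_distD x1 (chart i z) x0.
by have := h; have := x1r; rewrite -/i; lra.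
Qed.

Lemma min_dist (a b c : R) : `|Num.min a b - Num.min a c| <= `|b - c|.
Proof.
have [ab|ba] := lerP a b; have [ac|ca] := lerP a c.
- by rewrite subrr normr0.
- rewrite !ger0_norm ?subr_ge0 ?(ltW ca)//; last by lra.
  by rewrite lerD2r.
- by rewrite distrC (distrC b) !ger0_norm ?subr_ge0 ?(ltW ba)//; [rewrite lerD2r|lra].
- by [].
Qed.

(** In the chart neighbourhood the cut-off changes no faster than the coordinates, hence at a rate
    at most the speed over [lam]; elsewhere it is locally constant. [local_domination] integrates
    this against the primitive of the speed. *)
Lemma segment_lower x1 y z l : `|x1 - x0| <= rho / 2 -> segment g y z l ->
  lam * `|cutoff_dist x1 z - cutoff_dist x1 y| <= l.
Proof.
move=> x1r [c [F [a [b [[ab <- <-] cC Fd ->]]]]].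
have lam0 := lb_lam lb.
rewrite -{1}(gtr0_norm lam0) -normrM mulrBr.
apply: (@local_domination R (fun t => lam * cutoff_dist x1 (c t)) F a b ab).
  exact: segment_mono Fd.
move=> t e tab e0.
have ct := C1_at_continuous (cC t tab).
suff : \forall s \near t, `|lam * cutoff_dist x1 (c s) - lam * cutoff_dist x1 (c t)|
    <= `|F s - F t| + e * `|s - t|.
  move=> /nbhs_ballP[d d0 H]; exists d => // s _ st; apply: H.
  by rewrite -ball_normE /ball_/= distrC.
have [ctN|ctN] := pselect (chart_nbhd (c t)); last first.
  have far : ~ (chart_inv i @` [set x | `|x - x0| <= rho]) (c t).
    move=> [x xr xE]; apply: ctN; rewrite -xE; apply: chart_nbhd_inv.
    by apply: (le_lt_trans xr); have := lb_rho lb; lra.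
  have : \forall s \near t, (~` (chart_inv i @` [set x | `|x - x0| <= rho])) (c s).
    by apply: ct; exact: open_nbhs_nbhs (conj far_open far).
  apply: filterS => s hs; rewrite !cutoff_dist_far// subrr normr0.
  by rewrite addr_ge0// mulr_ge0// ltW.
have [ci cr] := ctN.
have [_ /(_ i ci)[/nbhs_singleton cd _]] := cC t tab.
(* Per unit of time, linearising the curve in the chart costs [lam * e1] and linearising [F] costs
   [e1]. *)
pose e1 := e / (1 + lam).
have e10 : 0 < e1 by rewrite divr_gt0// addr_gt0.
have nN : \forall s \near t, chart_nbhd (c s).
  by apply: ct; exact: open_nbhs_nbhs (conj chart_nbhd_open ctN).
have n1 := derive1_estimate cd e10.
have Fdt := Fd t tab.
have n2 := @derive1_estimate R _ F t e1 (@ex_derive _ _ _ _ _ _ _ Fdt) e10.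
have F't : derive1 F t = speed g c t by rewrite derive1E derive_val.
have /andP[sp _] := lb_qform lb cr (derive1 (chart i \o c) t).
rewrite -(speedE g ct ci cd) in sp; rewrite F't in n2.
near=> s.
have sN : chart_nbhd (c s) by near: s.
have h1 : `|(chart i \o c) s - (chart i \o c) t - (s - t) *: derive1 (chart i \o c) t| <= e1 * `|s - t| by near: s.
have h2 : `|F s - F t - (s - t) *: speed g c t| <= e1 * `|s - t| by near: s.
rewrite -mulrBr normrM (gtr0_norm lam0) /cutoff_dist !asboolT//.
apply: (@le_trans _ _ (lam * `|chart i (c s) - chart i (c t)|)).
  rewrite ler_wpM2l ?(ltW lam0)//; apply: (le_trans (min_dist _ _ _)).
  apply: (le_trans (ler_dist_dist _ _)).
  by rewrite opprB addrA subrK.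
have h3 : `|chart i (c s) - chart i (c t)| <= `|s - t| * `|derive1 (chart i \o c) t| + e1 * `|s - t|.
  rewrite -normrZ; have -> : chart i (c s) - chart i (c t) = (s - t) *: derive1 (chart i \o c) t +
    ((chart i \o c) s - (chart i \o c) t - (s - t) *: derive1 (chart i \o c) t) by rewrite [RHS]addrC subrK.
  by apply: (le_trans (ler_normD _ _)); rewrite lerD2l.
have h4 : `|s - t| * speed g c t <= `|F s - F t| + e1 * `|s - t|.
  have -> : `|s - t| * speed g c t = `|(s - t) *: speed g c t|.
    by rewrite normrM (ger0_norm (speed_ge0 g c t)).
  have := ler_distD (F s - F t) ((s - t) *: speed g c t) 0; rewrite !subr0.
  by rewrite distrC; move: h2; lra.
have E : e = e1 * (1 + lam) by rewrite /e1 divfK// gt_eqF// addr_gt0.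
have st0 : 0 <= `|s - t| by [].
have h5 : lam * `|chart i (c s) - chart i (c t)| <=
    `|s - t| * (lam * `|derive1 (chart i \o c) t|) + lam * (e1 * `|s - t|).
  apply: (@le_trans _ _ (lam * (`|s - t| * `|derive1 (chart i \o c) t| + e1 * `|s - t|))).
    by rewrite ler_wpM2l// ltW.
  by rewrite mulrDr lerD2r mulrCA.
have h6 : `|s - t| * (lam * `|derive1 (chart i \o c) t|) <= `|s - t| * speed g c t by rewrite ler_wpM2l.
by rewrite E; nra.
Unshelve. all: by end_near. Qed.

Lemma chain_lower x1 y z l : `|x1 - x0| <= rho / 2 -> chain g y z l ->
  lam * `|cutoff_dist x1 z - cutoff_dist x1 y| <= l.
Proof.
move=> x1r; elim=> {y z l} [y z l|y z w l l' /(segment_lower x1r) h _ h']; first exact: segment_lower.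
apply: le_trans (lerD h h'); rewrite -mulrDr ler_wpM2l ?(ltW (lb_lam lb))// [X in _ <= X]addrC.
exact: ler_distD.
Qed.

End Local.
End LocalGeometry.

(** * The geodesic distance as a metric with bi-Lipschitz charts *)

Section Geodesic.
Variables (R : realType) (n : nat) (Y : topologicalType) (M : smooth_manifold R n Y).
Variable g : riemannian_metric M.
Hypothesis Y_connected : connected [set: Y].
Let d := geodesic_dist g.

Lemma chain_local p rho lam Lam y z : local_bounds g p rho lam Lam ->
  chart_nbhd M p rho y -> chart_nbhd M p rho z ->
  exists2 l, chain g y z l & l <= Lam * `|chart (chart_at M p) z - chart (chart_at M p) y|.
Proof.
move=> lb [yi yr] [zi zr]; have [l h1 h2] := straight_segment lb yr zr.
by rewrite !chartK// in h1; exists l => //; exact: chain1.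
Qed.

(** The points reachable from [p] form an open set with open complement. *)
Lemma chain_connected p q : exists l, chain g p q l.
Proof.
pose A := [set q | exists l, chain g p q l].
have nb q' : exists2 N : set Y, open N /\ N q' & forall y z, N y -> N z -> exists l, chain g y z l.
  have [rho [lam [Lam lb]]] := local_bounds_ex g q'.
  exists (chart_nbhd M q' rho); first by split; [exact: chart_nbhd_open|exact: chart_nbhd_center lb].
  by move=> y z yN zN; have [l h _] := chain_local lb yN zN; exists l.
have Ap : A p by have [N [_ Np] H] := nb p; exact: H.
have oA : open A.
  rewrite openE => y [l yl]; have [N [oN Ny] H] := nb y.
  apply: filterS (open_nbhs_nbhs (conj oN Ny)) => z Nz; have [l' yz] := H y z Ny Nz.
  by exists (l + l'); exact: chain_trans yl yz.
have oAC : open (~` A).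
  rewrite openE => y Ay; have [N [oN Ny] H] := nb y.
  apply: filterS (open_nbhs_nbhs (conj oN Ny)) => z Nz [l pz]; apply: Ay.
  by have [l' zy] := H z y Nz Ny; exists (l + l'); exact: chain_trans pz zy.
have AT : A = setT.
  apply: Y_connected; first by exists p.
  - by exists A => //; rewrite setTI.
  - by exists A; [rewrite -[A]setCK; exact: open_closedC|rewrite setTI].
by have : A q by rewrite AT.
Qed.

Lemma geodesic_le p q l : chain g p q l -> d p q <= l.
Proof.
move=> pq; rewrite /d geodesic_distE; apply: ge_inf => //.
by exists 0 => x; exact: chain_ge0.
Qed.

Lemma geodesic_ge p q c : (forall l, chain g p q l -> c <= l) -> c <= d p q.
Proof.
move=> H; rewrite /d geodesic_distE; apply: lb_le_inf => //.
by have [l] := chain_connected p q; exists l.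
Qed.

Lemma geodesic_lt p q c : d p q < c -> exists2 l, chain g p q l & l < c.
Proof.
rewrite /d geodesic_distE => /inf_lt; case; last by move=> l pq lc; exists l.
by have [l] := chain_connected p q; exists l.
Qed.

Lemma geodesic_ge0 p q : 0 <= d p q.
Proof. by apply: geodesic_ge => l; exact: chain_ge0. Qed.

Lemma geodesic_tri p q r : d p r <= d p q + d q r.
Proof.
apply/ler_addgt0Pr => e e0.
have [|l pq lq] := @geodesic_lt p q (d p q + e / 2); first by rewrite ltrDl divr_gt0.
have [|l' qr lr] := @geodesic_lt q r (d q r + e / 2); first by rewrite ltrDl divr_gt0.
by have := geodesic_le (chain_trans pq qr); lra.
Qed.

Lemma geodesic_sym p q : d p q = d q p.
Proof.
by apply/le_anti/andP; split; apply: geodesic_ge => l /chain_rev/geodesic_le.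
Qed.

Lemma geodesic_upper p rho lam Lam y z : local_bounds g p rho lam Lam ->
  chart_nbhd M p rho y -> chart_nbhd M p rho z ->
  d y z <= Lam * `|chart (chart_at M p) z - chart (chart_at M p) y|.
Proof. by move=> lb yN zN; have [l /geodesic_le h] := chain_local lb yN zN; exact: le_trans. Qed.

(** The cut-off centred at [y] vanishes at [y]. A chain shorter than [lam * (rho / 2)] cannot raise
    it to its ceiling [rho / 2], so at [z] it is the true coordinate distance. *)
Lemma geodesic_lower p rho lam Lam y z : local_bounds g p rho lam Lam ->
  chart_nbhd M p rho y -> `|chart (chart_at M p) y - chart (chart_at M p) p| <= rho / 2 ->
  d y z < lam * (rho / 2) ->
  chart_nbhd M p rho z /\ lam * `|chart (chart_at M p) z - chart (chart_at M p) y| <= d y z.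
Proof.
move=> lb yN yr yz; set x1 := chart (chart_at M p) y.
have r0 := lb_rho lb; have l0 := lb_lam lb.
have cy : cutoff_dist M p rho x1 y = 0.
  by rewrite /cutoff_dist asboolT// subrr normr0 min_r// divr_ge0// ltW.
have h : lam * `|cutoff_dist M p rho x1 z| <= d y z.
  apply: geodesic_ge => l /(chain_lower lb yr); by rewrite cy subr0.
move: h; rewrite /cutoff_dist; case: asboolP => zN; last first.
  by rewrite ger0_norm ?divr_ge0 ?(ltW r0)// leNgt yz.
have [h1|h1] := lerP (rho / 2) `|chart (chart_at M p) z - x1|.
  by rewrite ger0_norm ?divr_ge0 ?(ltW r0)// leNgt yz.
by rewrite normr_id.
Qed.

Lemma geodesic_metric : is_metric d.
Proof.
split; [exact: geodesic_ge0| |exact: geodesic_sym|move=> p q r; exact: geodesic_tri].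
move=> p q; have [rho [lam [Lam lb]]] := local_bounds_ex g p.
have r0 := lb_rho lb; have l0 := lb_lam lb.
have pN := chart_nbhd_center lb.
split=> [pq|->]; last first.
  have [rho' [lam' [Lam' lb']]] := local_bounds_ex g q.
  have qN := chart_nbhd_center lb'.
  apply/le_anti; rewrite geodesic_ge0 andbT; apply: (le_trans (geodesic_upper lb' qN qN)).
  by rewrite subrr normr0 mulr0.
have [||qN] := geodesic_lower (z := q) lb pN; first by rewrite subrr normr0 divr_ge0// ltW.
  by rewrite pq mulr_gt0// divr_gt0.
rewrite pq pmulr_rle0// normr_le0 subr_eq0 => /eqP E.
by rewrite -(chartK pN.1) -E chartK//; exact: qN.1.
Qed.

Lemma geodesic_near p rho lam Lam y : local_bounds g p rho lam Lam ->
  d p y < lam * (rho / 2) ->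
  chart_nbhd M p rho y /\ lam * `|chart (chart_at M p) y - chart (chart_at M p) p| <= d p y.
Proof.
move=> lb; apply: (geodesic_lower lb); first exact: chart_nbhd_center lb.
by rewrite subrr normr0 divr_ge0// ltW// (lb_rho lb).
Qed.

Lemma geodesic_open (U : set Y) : open U <-> dist_open d U.
Proof.
split=> [oU p Up|oU].
  have [rho [lam [Lam lb]]] := local_bounds_ex g p.
  have r0 := lb_rho lb; have l0 := lb_lam lb.
  have pi := mem_chart_at M p.
  have : \forall x \near chart (chart_at M p) p, U (chart_inv (chart_at M p) x).
    apply: (@chart_inv_continuous _ _ _ M (chart_at M p) _ (chart_mem pi)).
    by rewrite chartK//; exact: open_nbhs_nbhs (conj oU Up).
  move=> /nbhs_ballP[e e0 H].
  exists (Num.min (lam * (rho / 2)) (lam * e)).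
    by rewrite lt_min !mulr_gt0// divr_gt0.
  move=> y; rewrite lt_min => /andP[/(geodesic_near lb)[[yi _] h] ye].
  rewrite -(chartK yi); apply: H; rewrite -ball_normE /ball_/= distrC.
  by rewrite -(ltr_pM2l l0); exact: le_lt_trans ye.
rewrite openE => p Up; have [e e0 H] := oU p Up.
have [rho [lam [Lam lb]]] := local_bounds_ex g p.
have L0 := lb_Lam lb.
have pi := mem_chart_at M p.
have n1 : \forall z \near p, chart_nbhd M p rho z.
  exact: open_nbhs_nbhs (conj (@chart_nbhd_open _ _ _ M p rho) (chart_nbhd_center lb)).
have n2 : \forall z \near p, `|chart (chart_at M p) p - chart (chart_at M p) z| < e / Lam.
  have /(@cvgrPdist_lt _ _ _ (nbhs p)) := @chart_continuous _ _ _ M _ _ pi.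
  by apply; rewrite divr_gt0.
near=> z; apply: H; apply: (@le_lt_trans _ _ (Lam * `|chart (chart_at M p) z - chart (chart_at M p) p|)).
  by apply: (geodesic_upper lb); [exact: chart_nbhd_center lb|near: z].
by rewrite mulrC -ltr_pdivlMr// distrC; near: z.
Unshelve. all: by end_near. Qed.

Lemma geodesic_charts (p : Y) : exists (r rho L : R) (phi : Y -> 'I_n -> R)
  (psi : ('I_n -> R) -> Y), [/\ 0 < r, 0 < rho & 0 <= L] /\
  [/\ forall y z i, d p y < r -> d p z < r -> `|phi y i - phi z i| <= L * d y z,
      forall y, d p y < r -> psi (phi y) = y,
      forall u i, (forall i, `|u i - phi p i| < rho) -> phi (psi u) i = u i &
      forall u v (c : R), (forall i, `|u i - phi p i| < rho) ->
        (forall i, `|v i - phi p i| < rho) -> (forall i, `|u i - v i| <= c) ->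
        0 <= c -> d (psi u) (psi v) <= L * c].
Proof.
have [rho [lam [Lam lb]]] := local_bounds_ex g p.
have r0 := lb_rho lb; have l0 := lb_lam lb; have L0 := lb_Lam lb.
pose i0 := chart_at M p.
pose psi (u : 'I_n -> R) := chart_inv i0 (\row_i u i).
have box u : (forall i, `|u i - chart i0 p 0 i| < rho) -> `|\row_i u i - chart i0 p| < 2 * rho.
  move=> hu; apply: (@le_lt_trans _ _ rho); last by lra.
  by apply: rv_norm_le => [|i]; [exact: ltW|rewrite !mxE; exact/ltW].
(* Two points this close to [p] are less than [lam * (rho / 4)] apart, with coordinates within
   [rho / 8] of the centre, so [geodesic_lower] applies. [lam^-1] serves the chart and [Lam] its
   inverse. *)
exists (lam * (rho / 8)), rho, (lam^-1 + Lam), (fun y i => chart i0 y 0 i), psi.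
split; first by split; rewrite ?mulr_gt0 ?divr_gt0 ?addr_ge0 ?invr_ge0 ?ltW.
have rr : lam * (rho / 8) < lam * (rho / 2) by rewrite ltr_pM2l//; lra.
split.
- move=> y z i py pz.
  have [yN yh] := geodesic_near lb (lt_trans py rr).
  have yr : `|chart i0 y - chart i0 p| <= rho / 2.
    have := le_lt_trans yh py; rewrite ltr_pM2l// => h; apply: ltW; apply: (lt_trans h); lra.
  have yz : d y z < lam * (rho / 2).
    apply: (le_lt_trans (geodesic_tri y p z)); rewrite geodesic_sym.
    have -> : lam * (rho / 2) = 4 * (lam * (rho / 8)) by field.
    by have : 0 < lam * (rho / 8); [rewrite mulr_gt0// divr_gt0|move: py pz; lra].
  have [_ h] := geodesic_lower lb yN yr yz.
  rewrite distrC; have := rv_coord_le (chart i0 z - chart i0 y) i; rewrite !mxE => h2.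
  apply: (le_trans h2); rewrite mulrDl; apply: ler_wpDr; first by rewrite mulr_ge0 ?geodesic_ge0// ltW.
  by rewrite mulrC ler_pdivlMr// mulrC.
- move=> y py; have [[yi _] _] := geodesic_near lb (lt_trans py rr).
  by rewrite /psi (_ : \row_i _ = chart i0 y) ?chartK//; apply/rowP => i; rewrite mxE.
- move=> u i /box/(lb_cod lb) hu; by rewrite /psi chart_invK// mxE.
- move=> u v c /box hu /box hv uv c0.
  have uN := chart_nbhd_inv lb hu; have vN := chart_nbhd_inv lb hv.
  apply: (le_trans (geodesic_upper lb uN vN)).
  rewrite (chart_invK (lb_cod lb hv)) (chart_invK (lb_cod lb hu)).
  rewrite mulrDl; apply: ler_wpDl; first by rewrite mulr_ge0// invr_ge0 ltW.
  rewrite ler_pM2l//; apply: rv_norm_le => // i; rewrite !mxE distrC; exact: uv.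
Qed.

(** A chain shorter than [L] is cut at length [s]; if its length does not exceed [s], its endpoint
    serves. *)
Lemma geodesic_between p q (L s : R) : d p q < L -> 0 <= s -> s <= L ->
  exists z, d p z <= s /\ d z q <= L - s.
Proof.
have mp := geodesic_metric.
move=> pq s0 sL; have [l cl lL] := geodesic_lt pq.
have [->|s00] := eqVneq s 0.
  by exists p; split; rewrite ?(is_metric_refl mp)// subr0 ltW.
have sp : 0 < s by rewrite lt_neqAle eq_sym s00.
have [ls|sl] := lerP l s.
  by exists q; split; rewrite ?(is_metric_refl mp) ?subr_ge0//; exact: le_trans (geodesic_le cl) ls.
have [z [pz zq]] := chain_split cl sp sl; exists z; split; first exact: geodesic_le.
by apply: (le_trans (geodesic_le zq)); rewrite lerD2r ltW.
Qed.

Lemma geodesic_locally_compact p : exists2 r, 0 < r &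
  exists2 K : set Y, compact K & [set y | d p y < r] `<=` K.
Proof.
have [rho [lam [Lam lb]]] := local_bounds_ex g p.
have r0 := lb_rho lb; have l0 := lb_lam lb.
exists (lam * (rho / 2)); first by rewrite mulr_gt0// divr_gt0.
exists (chart_inv (chart_at M p) @` [set x | `|x - chart (chart_at M p) p| <= rho]).
  exact: chart_ball_compact lb.
move=> y /= py; have [[yi _] h] := geodesic_near lb py.
exists (chart (chart_at M p) y); last by rewrite chartK.
by have := le_lt_trans h py; rewrite /= ltr_pM2l// => h'; lra.
Qed.

End Geodesic.

(** * Finite covers of bounded sets *)

Section BoundedCovers.
Context {R : realType} (Y : choiceType) (d : Y -> Y -> R).
Hypothesis md : is_metric d.
Hypothesis complete_d : dist_complete d.
Hypothesis between : forall p q (L s : R), d p q < L -> 0 <= s -> s <= L ->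
  exists z, d p z <= s /\ d z q <= L - s.

Definition fin_covered (rad : Y -> R) (A : set Y) :=
  exists s : seq Y, forall y, A y -> exists2 p, p \in s & d p y < rad p.

(* A substitute for compactness that is inherited by subsets, so that no closedness
   of balls is needed. *)
Definition gauge_covered (A : set Y) :=
  forall rad : Y -> R, (forall p, 0 < rad p) -> fin_covered rad A.

Hypothesis locally_covered : forall p, exists2 r, 0 < r & gauge_covered [set y | d p y < r].

Lemma fin_covered_sub rad A B : A `<=` B -> fin_covered rad B -> fin_covered rad A.
Proof. by move=> AB [s H]; exists s => y Ay; exact/H/AB. Qed.

Lemma fin_covered_bigU rad (s : seq Y) (B : Y -> set Y) A :
  (forall y, A y -> exists2 c, c \in s & B c y) ->
  (forall c, c \in s -> fin_covered rad (A `&` B c)) -> fin_covered rad A.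
Proof.
move=> AB H.
have [t tP] : exists t : seq Y, forall c y, c \in s -> A y -> B c y ->
    exists2 p, p \in t & d p y < rad p.
  elim: s {AB} H => [|c s IH] H; first by exists [::].
  have [|t Ht] := IH; first by move=> c' c's; apply: H; rewrite in_cons c's orbT.
  have [u Hu] := H c (mem_head _ _).
  exists (u ++ t) => c' y; rewrite in_cons => /predU1P[->|c's] Ay By.
    by have [p pu py] := Hu y (conj Ay By); exists p => //; rewrite mem_cat pu.
  by have [p pt py] := Ht c' y c's Ay By; exists p => //; rewrite mem_cat pt orbT.
by exists t => y Ay; have [c cs By] := AB y Ay; exact: tP cs Ay By.
Qed.

(** Cover the ball by finitely many balls of half the local radii. A point at distance at most
    [T + e] from [p] lies within [2 * e] of the ball, hence within the full radius of some
    centre. *)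
Lemma extend_ball p (T : R) : 0 <= T -> gauge_covered [set y | d p y <= T] ->
  exists2 e, 0 < e & gauge_covered [set y | d p y <= T + e].
Proof.
move=> T0 cT; have /choice[r rP] : forall q, exists r, 0 < r /\ gauge_covered [set y | d q y < r].
  by move=> q; have [r r0 h] := locally_covered q; exists r.
have [|s sP] := cT (fun q => r q / 2).
  by move=> q; have [r0 _] := rP q; rewrite divr_gt0.
have [e e0 eP] : exists2 e, 0 < e & forall q, q \in s -> 2 * e <= r q / 2.
  elim: s {sP} => [|q s [e e0 eP]]; first by exists 1.
  have [r0 _] := rP q; exists (Num.min e (r q / 4)); first by rewrite lt_min e0 divr_gt0.
  have [m1 m2] : Num.min e (r q / 4) <= e /\ Num.min e (r q / 4) <= r q / 4.
    by rewrite !ge_min !lexx orbT.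
  by move=> q'; rewrite in_cons => /predU1P[->|/eP]; lra.
exists e => // rad rad0; apply: (@fin_covered_bigU _ s (fun q => [set y | d q y < r q])).
  move=> y /= py; have [||z [pz zy]] := @between p y (T + 2 * e) T _ T0; first by lra.
    by lra.
  have [q qs qz] := sP z pz; exists q => //.
  by have := eP q qs; have := is_metric_tri md q z y; lra.
move=> q qs; have [_ h] := rP q.
by apply: fin_covered_sub (h rad rad0) => y [].
Qed.

(** Since the smaller balls are covered, this one is totally bounded. If it had no finite cover,
    repeated subdivision would give nested bad sets of shrinking diameter, and completeness a point
    [l] whose own gauge ball contains one of them. *)
Lemma limit_ball p (T : R) : 0 <= T ->
  (forall t, 0 <= t -> t < T -> gauge_covered [set y | d p y <= t]) ->
  gauge_covered [set y | d p y <= T].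
Proof.
move=> T0 H rad rad0; apply: contrapT => bad0.
(* A point of the ball is within 3e/8 of the ball of radius [T - e / 4], whose points are within e/2
   of a centre. *)
have tb (e : R) : 0 < e -> exists s : seq Y, forall y, d p y <= T ->
    exists2 c, c \in s & d c y < e.
  move=> e0; have [Te|eT] := lerP T (e / 2).
    exists [:: p] => y py; exists p; first by rewrite mem_seq1.
    by apply: le_lt_trans py _; lra.
  have [|||s sP] := H (T - e / 4) _ _ (fun=> e / 2); [lra|lra|by move=> _; rewrite divr_gt0|].
  exists s => y py.
  have [||| z [pz zy]] := @between p y (T + e / 8) (T - e / 4); [lra|lra|lra|].
  have [c cs cz] := sP z pz; exists c => //.
  by have := is_metric_tri md c z y; lra.
pose bad K := K `<=` [set y | d p y <= T] /\ ~ fin_covered rad K.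
have halve (k : nat) K : bad K -> exists c, bad (K `&` [set y | d c y < 2^-1 ^+ k]).
  move=> [KT badK]; have [|s sP] := tb (2^-1 ^+ k); first by rewrite exprn_gt0 ?invr_gt0.
  apply: contrapT => nc; apply: badK.
  apply: (@fin_covered_bigU _ s (fun c => [set y | d c y < 2^-1 ^+ k])).
    by move=> y /KT /sP.
  move=> c cs; apply: contrapT => bc; apply: nc; exists c; split=> // y [Ky _]; exact: KT.
have /choice[f fP] : forall kK : nat * set Y, exists c, bad kK.2 ->
    bad (kK.2 `&` [set y | d c y < 2^-1 ^+ kK.1]).
  move=> [k K]; have [bK|nK] := pselect (bad K); last by exists p.
  by have [c hc] := halve k K bK; exists c.
pose fix Ks (k : nat) : set Y :=
  if k is k'.+1 then Ks k' `&` [set y | d (f (k', Ks k')) y < 2^-1 ^+ k']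
  else [set y | d p y <= T].
have badKs k : bad (Ks k).
  by elim: k => [|k IH] /=; [split|exact: (fP (k, Ks k))].
have Ksm k m : (k <= m)%N -> Ks m `<=` Ks k.
  elim: m => [|m IH]; first by rewrite leqn0 => /eqP ->.
  by rewrite leq_eqVlt => /predU1P[->//|]; rewrite ltnS => /IH h y [/h].
have /choice[y yP] : forall k, exists y, Ks k y.
  move=> k; apply: contrapT => nK; have [_] := badKs k; apply.
  by exists [::] => y Ky; case: nK; exists y.
have geo (e : R) : 0 < e -> exists N, (2^-1 : R) ^+ N < e.
  move=> e0; have [N HN] := exp2n_lt 1 e0; exists N.
  by have := HN N (leqnn N); rewrite div1r exprVn.
have near_y k m : (k < m)%N -> d (f (k, Ks k)) (y m) < 2^-1 ^+ k.
  by move=> km; have [] := Ksm _ _ km _ (yP m).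
have [|l lP] := complete_d (u := y).
  move=> e e0; have [N HN] := geo (e / 2) (divr_gt0 e0 (ltr0Sn _ 1)).
  exists N.+1 => m k Nm Nk.
  have h1 := near_y N m Nm; have h2 := near_y N k Nk.
  have := is_metric_tri md (y m) (f (N, Ks N)) (y k).
  by rewrite (is_metric_sym md (y m) (f _)); lra.
have r4 : 0 < rad l / 4 by rewrite divr_gt0.
have [N1 HN1] := geo _ r4; have [N2 HN2] := lP _ r4.
have [_] := badKs N1.+1; apply; exists [:: l] => z Kz; exists l; first by rewrite mem_seq1.
pose m := maxn N1.+1 N2.
have h1 := near_y N1 m (leq_maxl _ _).
have h2 : d (f (N1, Ks N1)) z < 2^-1 ^+ N1 by case: Kz.
have h3 := HN2 m (leq_maxr _ _).
have := is_metric_tri md l (y m) z; have := is_metric_tri md (y m) (f (N1, Ks N1)) z.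
rewrite (is_metric_sym md l (y m)) (is_metric_sym md (y m) (f _)).
by have := rad0 l; lra.
Qed.

(** The good radii include 0 and are closed downwards. Were they bounded by [B], their supremum
    would be good by [limit_ball] and could be exceeded by [extend_ball]. *)
Lemma bounded_gauge_covered (A : set Y) : dist_bounded d A -> gauge_covered A.
Proof.
move=> [B AB]; have [[p Ap]|nA] := pselect (A !=set0); last first.
  by move=> rad rad0; exists [::] => y Ay; case: nA; exists y.
pose S := [set t : R | 0 <= t /\ gauge_covered [set y | d p y <= t]].
have S0 : S 0.
  split=> // rad rad0; exists [:: p] => y /= py; exists p; first by rewrite mem_seq1.
  exact: le_lt_trans py (rad0 p).
have Sdown s t : 0 <= s -> s <= t -> S t -> S s.
  move=> s0 st [_ h]; split=> // rad rad0; apply: fin_covered_sub (h rad rad0) => y /= py.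
  exact: le_trans st.
suff [t St Bt] : exists2 t, S t & B <= t.
  move=> rad rad0; apply: fin_covered_sub (St.2 rad rad0) => y Ay /=.
  exact: le_trans (AB p y Ap Ay) Bt.
apply: contrapT => nS.
have ubS : ubound S B.
  move=> t St; rewrite leNgt; apply/negP => /ltW Bt; apply: nS; by exists t.
pose T := sup S.
have T0 : 0 <= T by apply: ub_le_sup S0; exists B.
have ST : S T.
  split=> //; apply: limit_ball => // t t0 tT.
  have [||s Ss ts] := @sup_adherent R S (T - t); first by rewrite subr_gt0.
    by split; [exists 0|exists B].
  have ts' : t <= s by move: ts; rewrite -/T; lra.
  by have [_ h] := Sdown t s t0 ts' Ss.
have [e e0 h] := extend_ball T0 ST.2.
have : S (T + e) by split=> //; rewrite addr_ge0// ltW.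
move=> /(ub_le_sup (ex_intro _ B ubS)); rewrite -/T => hh; lra.
Qed.

End BoundedCovers.

Section RiemannianCovers.
Variables (R : realType) (n : nat) (Y : topologicalType) (M : smooth_manifold R n Y).
Variable g : riemannian_metric M.
Hypothesis Y_connected : connected [set: Y].
Let d := geodesic_dist g.

Lemma geodesic_locally_covered p : exists2 r : R, 0 < r & gauge_covered d [set y | d p y < r].
Proof.
have mY := geodesic_metric g Y_connected.
have oY := geodesic_open g Y_connected.
have [r r0 [K cK rK]] := geodesic_locally_compact g Y_connected p.
exists r => // rad rad0; apply: (fin_covered_sub rK).
(* The point [p] makes [Y] a pointed space, so that compactness can be used through finite
   subcovers. *)
pose Yp := HB.pack_for ptopologicalType Y (isPointed.Build Y p).
have cK' : cover_compact (T := Yp) K by rewrite -compact_cover.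
move: cK' => /(_ Y setT (fun p => [set y | d p y < rad p])).
case=> [q _|y _|D _ DK].
- exact: (metric_ball_open mY oY).
- by exists y => //=; rewrite /d (is_metric_refl mY).
- by exists (enum_fset D) => y /DK[q /= qD qy]; exists q.
Qed.

End RiemannianCovers.

Theorem corollary1p3 (R : realType)
    (X : topologicalType)
    (X_metrizable : metrizable R X)
    (X_separable : separable X)
    (X_noncompact : ~ compact [set: X])
    (n : nat) (n_gt0 : (0 < n)%N)
    (Y : topologicalType)
    (M : smooth_manifold R n Y)
    (g : riemannian_metric M)
    (Y_connected : connected [set: Y])
    (Y_complete : dist_complete (geodesic_dist g)) :
  ell2_manifold R (set nat) (CB_space X (geodesic_dist g)).
Proof.
have [dX [mX openX]] := X_metrizable.
have mY := geodesic_metric g Y_connected.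
apply: (CB_ell2_manifold mX mY openX (geodesic_open g Y_connected) X_separable X_noncompact n_gt0).
  exact: geodesic_charts.
move=> rad A rad0 bA; apply: (bounded_gauge_covered mY Y_complete _ _ bA rad0).
  exact: geodesic_between.
exact: geodesic_locally_covered.
Qed.
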